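(* Let $d\ge 1$ be an integer. There is a constant $c_d>0$ depending only on $d$ such that for every integer $m\ge 1$ there is $\delta_0>0$ (not depending on the weight) with the following property. For every $d\times d$ matrix weight $W$ on $\mathbb R^m$ with $[W]_{A_2^h}\le 1+\delta_0$ and all $f,g\in C_c^\infty(\mathbb R^m;\mathbb C^d)$, $$2\int_{\mathbb R^{m+1}_+}\sum_{i=1}^m\Big|\Big(\frac{\partial f^h(x,t)}{\partial x_i},\frac{\partial g^h(x,t)}{\partial x_i}\Big)_{\mathbb C^d}\Big|\,dx\,dt\le\Big(1+c_d\sqrt{[W]_{A_2^h}-1}\Big)\|f\|_{2,W}\,\|g\|_{2,W^{-1}}.$$
   Context: A $d\times d$ matrix weight on $\mathbb R^m$ is a function $W:\mathbb R^m\to\mathbb C^{d\times d}$ with entries in $L^1_{loc}(\mathbb R^m)$ whose values are (almost everywhere) positive and invertible, i.e. positive definite Hermitian, matrices. $W^{-1}$ denotes the pointwise inverse. Heat extension: for a (scalar-, vector- or matrix-valued) function $F$ on $\mathbb R^m$ and $(x,t)\in\mathbb R^{m+1}_+=\mathbb R^m\times(0,\infty)$, $$F^h(x,t)=\frac{1}{(4\pi t)^{m/2}}\int_{\mathbb R^m}F(y)\exp\Big(-\frac{|x-y|^2}{4t}\Big)\,dy .$$ Heat $A_2$ characteristic: $$[W]_{A_2^h}=\sup_{(x,t)\in\mathbb R^{m+1}_+}\Big\|\big(W^h(x,t)\big)^{1/2}\big((W^{-1})^h(x,t)\big)^{1/2}\Big\|,$$ where $\|\cdot\|$ is the operator norm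 of matrices on $\mathbb C^d$ with its Euclidean norm and the square roots are those of positive matrices. The characteristic is finite only if the integrals defining $W^h$ and $(W^{-1})^h$ converge. Note that no square is taken in this definition. For a weight $V$ (here $V=W$ or $V=W^{-1}$), $\|f\|_{2,V}=\big(\int_{\mathbb R^m}(V(x)f(x),f(x))_{\mathbb C^d}\,dx\big)^{1/2}$, where $(\cdot,\cdot)_{\mathbb C^d}$ is the standard Hermitian inner product on $\mathbb C^d$. *)

(* Defs.v *)
From HB Require Import structures.
From mathcomp Require Import all_boot all_order all_algebra complex.
From mathcomp Require Import all_classical all_reals all_analysis.
Set Implicit Arguments.
Unset Strict Implicit.
Unset Printing Implicit Defensive.
Import Order.TTheory GRing.Theory Num.Theory.
Import numFieldNormedType.Exports.
Local Open Scope classical_set_scope.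
Local Open Scope ring_scope.
Local Open Scope sesquilinear_scope.
Import ComplexField.

Section rV_measurable.
Context {d} {T : sigmaRingType d}.
Variable n : nat.

Let coors : 'I_n -> 'rV[T]_n -> T := fun i x => x ord0 i.

Let rV_set0 : g_sigma_preimage coors set0.
Proof. exact: sigma_algebra0. Qed.

Let rV_setC A : g_sigma_preimage coors A -> g_sigma_preimage coors (~` A).
Proof. exact: sigma_algebraC. Qed.

Let rV_bigcup (F : _^nat) : (forall i, g_sigma_preimage coors (F i)) ->
  g_sigma_preimage coors (\bigcup_i (F i)).
Proof. exact: sigma_algebra_bigcup. Qed.

(* The product sigma-algebra, as the library does for [n.-tuple T]; for
   [T] the reals it is the Borel sigma-algebra. *)
HB.instance Definition _ := @isMeasurable.Build (measure_tuple_display d)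
  'rV[T]_n (g_sigma_preimage coors) rV_set0 rV_setC rV_bigcup.

End rV_measurable.

Lemma measurable_rV_coord d (T : sigmaRingType d) n (i : 'I_n) :
  measurable_fun [set: 'rV[T]_n] (fun x : 'rV[T]_n => x ord0 i).
Proof.
move=> _ Y mY; rewrite setTI; apply: sub_sigma_algebra => /=.
rewrite -bigcup_seq/=; exists i => /=; first by rewrite mem_index_enum.
by exists Y => //; rewrite setTI.
Qed.

Lemma measurable_fun_rVP d1 d2 (T1 : measurableType d1) (T2 : measurableType d2)
    n (f : T1 -> 'rV[T2]_n) :
  measurable_fun [set: T1] f <->
  forall i, measurable_fun [set: T1] (fun x => f x ord0 i).
Proof.
split=> [mf i|mf].
  exact: (measurableT_comp (measurable_rV_coord i) mf).
pose coors := fun (i : 'I_n) (x : 'rV[T2]_n) => x ord0 i.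
have H : g_sigma_preimage (fun i => coors i \o f) `<=` measurable.
  apply: smallest_sub; first exact: sigma_algebra_measurable.
  case: n => [|n] in f mf coors *; first by rewrite big_ord0.
  rewrite -bigcup_mkord_ord; apply: bigcup_sub => i Ii.
  by move=> A [B mB <-]; exact: mf.
move=> _ A mA; apply: H.
by rewrite g_sigma_preimage_comp; exists A.
Qed.

Section lebesgue_rV.
Context {R : realType}.

Definition rV_cons n (p : measurableTypeR R * 'rV[R]_n) : 'rV[R]_n.+1 :=
  row_mx (p.1 : R)%:M p.2.

Definition rV_uncons n (x : 'rV[R]_n.+1) : measurableTypeR R * 'rV[R]_n :=
  (x ord0 ord0, \row_j x ord0 (lift ord0 j)).

Lemma rV_cons0 n p : @rV_cons n p ord0 ord0 = p.1.
Proof.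
have -> : @ord0 n = @lshift 1 n ord0 by exact/val_inj.
by rewrite [LHS]row_mxEl mxE eqxx.
Qed.

Lemma rV_consS n p j : @rV_cons n p ord0 (lift ord0 j) = p.2 ord0 j.
Proof.
have -> : lift ord0 j = @rshift 1 n j by exact/val_inj.
by rewrite [LHS]row_mxEr.
Qed.

Lemma rV_consK n : cancel (@rV_cons n) (@rV_uncons n).
Proof.
move=> [x v]; rewrite /rV_uncons rV_cons0; congr pair.
by apply/rowP => j; rewrite mxE rV_consS.
Qed.

Lemma measurable_rV_cons n : measurable_fun setT (@rV_cons n).
Proof.
apply/measurable_fun_rVP => i; case: (unliftP ord0 i) => [j|] ->.
  under eq_fun do rewrite rV_consS.
  exact: (measurableT_comp (measurable_rV_coord j) measurable_snd).
under eq_fun do rewrite rV_cons0.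
exact: measurable_fst.
Qed.

Lemma measurable_rV_uncons n : measurable_fun setT (@rV_uncons n).
Proof.
apply: measurable_fun_pair; first exact: measurable_rV_coord.
apply/measurable_fun_rVP => i /=.
under eq_fun do rewrite mxE.
exact: measurable_rV_coord.
Qed.

Section step.
Variables (n : nat) (mu : {sigma_finite_measure set 'rV[R]_n -> \bar R}).

Definition lebesgue_cons : set 'rV[R]_n.+1 -> \bar R :=
  pushforward (lebesgue_measure \x mu)%E (@rV_cons n).

Let lebesgue_cons0 : lebesgue_cons set0 = 0%E.
Proof. by rewrite /lebesgue_cons /pushforward preimage_set0 measure0. Qed.

Let mpre A : measurable A -> measurable (@rV_cons n @^-1` A).
Proof. by move=> mA; rewrite -[X in measurable X]setTI; exact: measurable_rV_cons. Qed.

Let lebesgue_cons_ge0 A : (0 <= lebesgue_cons A)%E.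
Proof. by rewrite /lebesgue_cons /pushforward measure_ge0. Qed.

Let lebesgue_cons_sigma_additive : semi_sigma_additive lebesgue_cons.
Proof.
move=> F mF tF mUF; rewrite /lebesgue_cons /pushforward preimage_bigcup.
apply: measure_semi_sigma_additive.
- by move=> i; exact: mpre.
- apply/trivIsetP => /= i j _ _ ij; rewrite -preimage_setI.
  by move/trivIsetP : tF => /(_ _ _ _ _ ij) ->//; rewrite preimage_set0.
- by rewrite -preimage_bigcup; exact: mpre.
Qed.

HB.instance Definition _ := isMeasure.Build _ _ _ lebesgue_cons
  lebesgue_cons0 lebesgue_cons_ge0 lebesgue_cons_sigma_additive.

Let lebesgue_cons_sigma_finite : sigma_finite setT lebesgue_cons.
Proof.
have /sigma_finiteP[F [FT ndF Ffin]] :=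
  sigma_finiteT (@lebesgue_measure R).
have /sigma_finiteP[G [GT ndG Gfin]] := sigma_finiteT mu.
exists (fun k => @rV_uncons n @^-1` (F k `*` G k)).
  apply/seteqP; split => // x _.
  have [i _ Fi] : (\bigcup_i F i) (rV_uncons x).1 by rewrite -FT.
  have [j _ Gj] : (\bigcup_i G i) (rV_uncons x).2 by rewrite -GT.
  exists (maxn i j) => //; split.
    by apply: subsetPset (ndF _ _ (leq_maxl i j)) _ Fi.
  by apply: subsetPset (ndG _ _ (leq_maxr i j)) _ Gj.
move=> k; have [mF lF] := Ffin k; have [mG lG] := Gfin k; split.
  rewrite -[X in measurable X]setTI; apply: measurable_rV_uncons => //.
  exact: measurableX.
rewrite /lebesgue_cons /pushforward -comp_preimage.
rewrite (_ : _ \o _ = id); last by apply/funext => p /=; rewrite rV_consK.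
rewrite preimage_id product_measure1E//.
by apply: lte_mul_pinfty => //; rewrite ge0_fin_numE.
Qed.

HB.instance Definition _ := @Measure_isSigmaFinite.Build _ _ _ lebesgue_cons
  lebesgue_cons_sigma_finite.

End step.

Definition lebesgue_rV0 : {sigma_finite_measure set 'rV[R]_0 -> \bar R} :=
  dirac (0 : 'rV[R]_0).

Definition lebesgue_rVS n (mu : {sigma_finite_measure set 'rV[R]_n -> \bar R}) :
  {sigma_finite_measure set 'rV[R]_n.+1 -> \bar R} := lebesgue_cons mu.

(* Lebesgue measure on R^n: the image of the product of n copies of the
   one-dimensional Lebesgue measure; see [lebesgue_rV_box]. *)
Fixpoint lebesgue_rV n : {sigma_finite_measure set 'rV[R]_n -> \bar R} :=
  match n with
  | 0 => lebesgue_rV0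
  | n'.+1 => lebesgue_rVS (lebesgue_rV n')
  end.

Lemma lebesgue_rV_box n (a b : 'I_n -> R) : (forall i, a i <= b i) ->
  lebesgue_rV n [set x : 'rV[R]_n | forall i, x ord0 i \in `[a i, b i]] =
  (\prod_(i < n) (b i - a i))%:E.
Proof.
elim: n a b => [|n IH] a b ab.
  rewrite big_ord0 /= diracE mem_set//=; by case.
rewrite big_ord_recl /=.
have mB : measurable [set x : 'rV[R]_n | forall i, x ord0 i \in
    `[a (lift ord0 i), b (lift ord0 i)]].
  rewrite (_ : mkset _ = \bigcap_(i in [set: 'I_n]) ((fun x : 'rV[R]_n => x ord0 i)
      @^-1` `[a (lift ord0 i), b (lift ord0 i)])).
    apply: fin_bigcap_measurable => // i _.
    by rewrite -[X in measurable X]setTI; exact: measurable_rV_coord.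
  by apply/seteqP; split => x /= h => [i _|i]; exact: h.
have preE : @rV_cons n @^-1` [set x : 'rV[R]_n.+1 | forall i,
    x ord0 i \in `[a i, b i]] = `[a ord0, b ord0]%classic `*`
    [set x : 'rV[R]_n | forall i,
      x ord0 i \in `[a (lift ord0 i), b (lift ord0 i)]].
  apply/seteqP; split => -[x v] /=.
    move=> h; split; first by have := h ord0; rewrite rV_cons0.
    by move=> i; have := h (lift ord0 i); rewrite rV_consS.
  move=> [h1 h2] i; case: (unliftP ord0 i) => [j|] ->.
    by rewrite rV_consS; exact: h2.
  by rewrite rV_cons0.
rewrite /lebesgue_cons /pushforward preE product_measure1E// IH//.
rewrite EFinM; congr (_ * _)%E.
transitivity (lebesgue_measure `[a ord0, b ord0]%classic) => //.
rewrite lebesgue_measure_itv/= lte_fin.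
have := ab ord0; rewrite le_eqVlt => /predU1P[->|->]; last by rewrite EFinB.
by rewrite ltxx subrr.
Qed.

End lebesgue_rV.

Section complex_vectors.
Context {R : realType}.
Local Notation C := R[i].

Definition cdot d (u v : 'cV[C]_d) : C :=
  \sum_(k < d) u k ord0 * Num.conj (v k ord0).

Definition enorm d (v : 'cV[C]_d) : R := Num.sqrt (complex.Re (cdot v v)).

Definition opnorm d (A : 'M[C]_d) : R :=
  sup [set enorm (A *m v) | v in [set v : 'cV[C]_d | enorm v <= 1]].

Definition posdefmx d (A : 'M[C]_d) : Prop :=
  A^t* = A /\ forall v : 'cV[C]_d, v != 0 -> 0 < cdot (A *m v) v.

Definition possemidefmx d (A : 'M[C]_d) : Prop :=
  A^t* = A /\ forall v : 'cV[C]_d, 0 <= cdot (A *m v) v.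

(* The positive square root by functional calculus in the spectral
   decomposition; meaningful for positive semidefinite matrices. *)
Definition sqrtmx d (A : 'M[C]_d) : 'M[C]_d :=
  invmx (spectralmx A) *m diag_mx (map_mx (fun z : C => sqrtC z) (spectral_diag A))
    *m spectralmx A.

Lemma cdotE d (u v : 'cV[C]_d) : cdot u v = (v^t* *m u) ord0 ord0.
Proof. by rewrite mxE; apply: eq_bigr => k _; rewrite !mxE mulrC. Qed.

Lemma sqrtmxP d (A : 'M[C]_d) : possemidefmx A ->
  possemidefmx (sqrtmx A) /\ sqrtmx A *m sqrtmx A = A.
Proof.
move=> [AH A0].
have Anormal : A \is normalmx by apply/normalmxP; rewrite AH.
have AE := orthomx_spectralP Anormal.
set P := spectralmx A in AE *; set D := spectral_diag A in AE *.
have Pu : P \is unitarymx := spectral_unitarymx A.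
have PV : invmx P = P^t* := invmx_unitary Pu.
have PVP : invmx P *m P = 1%:M by rewrite mulVmx// unitarymx_unit.
have PPV : P *m invmx P = 1%:M by rewrite mulmxV// unitarymx_unit.
have tC m n p (M : 'M[C]_(m, n)) (N : 'M[C]_(n, p)) :
    (M *m N)^t* = N^t* *m M^t*.
  by rewrite trmx_mul map_mxM.
have quad (E : 'rV[C]_d) (v : 'cV[C]_d) :
    cdot (invmx P *m diag_mx E *m P *m v) v =
    \sum_k E ord0 k * `|(P *m v) k ord0| ^+ 2.
  have -> : cdot (invmx P *m diag_mx E *m P *m v) v =
      cdot (diag_mx E *m (P *m v)) (P *m v).
    by rewrite !cdotE tC PV !mulmxA.
  apply: eq_bigr => k _; rewrite mul_diag_mx mxE -mulrA; congr (_ * _).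
  by rewrite normCK.
have D0 k : 0 <= D ord0 k.
  have := A0 (invmx P *m delta_mx k ord0); rewrite [in X in cdot X _]AE quad.
  rewrite mulmxA PPV mul1mx (bigD1 k)//= big1 => [|j jk].
    by rewrite mxE !eqxx normr1 expr1n mulr1 addr0.
  by rewrite mxE (negbTE jk) normr0 expr0n mulr0.
have S0 k : 0 <= (map_mx (fun z : C => sqrtC z) D) ord0 k by rewrite mxE sqrtC_ge0.
rewrite /sqrtmx -/P -/D; split; first split.
- rewrite !tC PV trmxCK mulmxA; congr (_ *m _ *m _).
  apply/matrixP => i j; rewrite !mxE eq_sym.
  case: eqVneq => [->|_]; last by rewrite !mulr0n conjC0.
  by rewrite !mulr1n; apply/CrealP/ger0_real; rewrite sqrtC_ge0.
- move=> v; rewrite quad; apply: sumr_ge0 => k _.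
  by rewrite mulr_ge0// exprn_ge0.
- rewrite !mulmxA -(mulmxA _ P (invmx P)) PPV mulmx1 -(mulmxA (invmx P)) mulmx_diag.
  rewrite [RHS]AE; congr (_ *m diag_mx _ *m _).
  by apply/rowP => k; rewrite !mxE -expr2 sqrtCK.
Qed.

End complex_vectors.

Section complex_integral.
Context d (T : measurableType d) {R : realType}.
Variable mu : {measure set T -> \bar R}.

Definition cintegrable (D : set T) (h : T -> R[i]) : Prop :=
  mu.-integrable D (EFin \o (fun x => complex.Re (h x))) /\
  mu.-integrable D (EFin \o (fun x => complex.Im (h x))).

Definition cintegral (h : T -> R[i]) : R[i] :=
  Complex (\int[mu]_x complex.Re (h x)) (\int[mu]_x complex.Im (h x)).

End complex_integral.

Section heat.
Context {R : realType}.
Local Notation C := R[i].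
Local Notation mu := (@lebesgue_rV R _).

(* The squared Euclidean norm; [`|z|] on ['rV[R]_m] is the sup norm. *)
Definition sqnorm m (z : 'rV[R]_m) : R := \sum_(i < m) z ord0 i ^+ 2.

Definition heat_kernel m (t : R) (z : 'rV[R]_m) : R :=
  ((4 * pi * t) `^ (m%:R / 2))^-1 * expR (- (sqnorm z / (4 * t))).

Definition heat_integrand m p q (F : 'rV[R]_m -> 'M[C]_(p, q)) (x : 'rV[R]_m)
    (t : R) (i : 'I_p) (j : 'I_q) (y : 'rV[R]_m) : C :=
  F y i j * (heat_kernel t (x - y))%:C%C.

Definition heat_converges m p q (F : 'rV[R]_m -> 'M[C]_(p, q))
    (x : 'rV[R]_m) (t : R) : Prop :=
  forall i j, cintegrable mu setT (heat_integrand F x t i j).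

Definition heat_ext m p q (F : 'rV[R]_m -> 'M[C]_(p, q)) (x : 'rV[R]_m)
    (t : R) : 'M[C]_(p, q) :=
  \matrix_(i, j) cintegral mu (heat_integrand F x t i j).

(* Measurability is Borel measurability: a class in L^1_loc always has a Borel
   representative, and changing W on a null set changes none of the integrals
   below. *)
Definition matrix_weight m d (W : 'rV[R]_m -> 'M[C]_d) : Prop :=
  [/\ forall i j, measurable_fun setT (fun x => complex.Re (W x i j)) /\
                  measurable_fun setT (fun x => complex.Im (W x i j)),
      forall (K : set 'rV[R]_m), compact K ->
        forall i j, cintegrable mu K (fun x => W x i j)
    & {ae mu, forall x, posdefmx (W x)}].

Definition winv m d (W : 'rV[R]_m -> 'M[C]_d) : 'rV[R]_m -> 'M[C]_d :=
  fun x => invmx (W x).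

(* [+oo] at the points where one of the two heat extensions diverges, so that
   a finite characteristic forces convergence everywhere. *)
Definition heat_A2_at m d (W : 'rV[R]_m -> 'M[C]_d) (p : 'rV[R]_m * R) : \bar R :=
  if `[< heat_converges W p.1 p.2 /\ heat_converges (winv W) p.1 p.2 >]
  then (opnorm (sqrtmx (heat_ext W p.1 p.2) *m
                sqrtmx (heat_ext (winv W) p.1 p.2)))%:E
  else +oo%E.

Definition heat_A2 m d (W : 'rV[R]_m -> 'M[C]_d) : \bar R :=
  ereal_sup [set heat_A2_at W p | p in [set p : 'rV[R]_m * R | 0 < p.2]].

Definition wnorm m d (V : 'rV[R]_m -> 'M[C]_d) (f : 'rV[R]_m -> 'cV[C]_d) : \bar R :=
  sqrte (\int[mu]_x (complex.Re (cdot (V x *m f x) (f x)))%:E)%E.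

Definition rpartial m (i : 'I_m) (u : 'rV[R]_m -> R) : 'rV[R]_m -> R :=
  fun x => 'D_('e_i) u x.

Definition iter_partial m (s : seq 'I_m) (u : 'rV[R]_m -> R) : 'rV[R]_m -> R :=
  foldr (@rpartial m) u s.

(* All iterated partial derivatives exist and are continuous. *)
Definition smooth m (u : 'rV[R]_m -> R) : Prop :=
  forall s : seq 'I_m, continuous (iter_partial s u) /\
    forall i x, derivable (iter_partial s u) x 'e_i.

Definition Ccinfty m d (f : 'rV[R]_m -> 'cV[C]_d) : Prop :=
  (forall k, smooth (fun x => complex.Re (f x k ord0)) /\
             smooth (fun x => complex.Im (f x k ord0))) /\
  compact (closure [set x | f x != 0]).

Definition partial m d (i : 'I_m) (F : 'rV[R]_m -> 'cV[C]_d) (x : 'rV[R]_m) :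
    'cV[C]_d :=
  \col_k Complex (rpartial i (fun y => complex.Re (F y k ord0)) x)
                 (rpartial i (fun y => complex.Im (F y k ord0)) x).

Definition bilinear_integrand m d (f g : 'rV[R]_m -> 'cV[C]_d)
    (p : 'rV[R]_m * R) : R :=
  \sum_(i < m) Normc.normc (cdot (partial i (fun x => heat_ext f x p.2) p.1)
                                 (partial i (fun x => heat_ext g x p.2) p.1)).

Definition heat_form m d (f g : 'rV[R]_m -> 'cV[C]_d) : \bar R :=
  (\int[mu \x (@lebesgue_measure R)]_(p in [set p : 'rV[R]_m * R | (0 < p.2)%R])
    (bilinear_integrand f g p)%:E)%E.

End heat.

(* Main.v *)
Require Import Defs.
From mathcomp Require Import all_boot all_order all_algebra complex.
From mathcomp Require Import all_classical all_reals all_analysis.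
From mathcomp Require Import measurable_realfun ring lra.
Set Implicit Arguments.
Unset Strict Implicit.
Unset Printing Implicit Defensive.
Import Order.TTheory GRing.Theory Num.Theory.
Import numFieldNormedType.Exports.
Local Open Scope classical_set_scope.
Local Open Scope ring_scope.
Local Open Scope sesquilinear_scope.
Import ComplexField.

(** Write A and B for the heat extensions of W and of its inverse, and u for
    that of f.  The characteristic bounds the defect d - tr (A^-1 B^-1) by
    H = d (r - 1), where r = [W]^2.  Divide (B^-1 u, u) by a concave function of
    the defect with values in [1, 1 + e], e of order sqrt H.  The quotient lies
    below the heat extension of (W f, f), and is convex along the heat flow up
    to a factor 1 + 2e: averaging its tangent inequality against the heat kernel
    over a time step, and telescoping in time, gives
      2 int int sum_i (B^-1 u_i, u_i) <= (1 + 2e) ||f||_W^2,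
    u_i being the i-th partial derivative of u.  By symmetry the same holds for g,
    with A and the inverse weight.  As B <= r A^-1, Cauchy-Schwarz and an
    optimisation over a scalar bound the form by (1 + 2e) [W] ||f|| ||g||.
    A finite time step is used so that no derivative in time is needed. *)

(** * Positive matrices *)

(** [(B^-1 u, u)] is already jointly convex, but its second variation is twice the [B^-1]-square of
    [du - dB B^-1 u]. It vanishes when the increment of [u] follows that of [B], so it does not
    control the energy of [du] alone. The divisor pays for the term in [dB]: the defect is concave
    with a gain [tr (B^-1 dB B^-1 dB) / 4] in the directions of [B], and a slope of order [1 / e]
    turns this gain into a bound for the cross term, at the price of a fraction [e] of the energy.
    The defect ranges over an interval of length [H], so such a slope makes the divisor vary by
    about [H / e]; keeping this of order [e] forces [e ^ 2] to be of order [H], which is the origin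
    of the square root of [[W] - 1]. All inequalities are exact for finite increments: tangent
    planes come from Fenchel's inequality, and convexity of matrix inversion from a remainder that
    is a square. For a fixed test vector they are affine in [(u, A, B)]; with a test vector affine
    in space, averaging needs only the moments of order at most two of a Brownian bridge. *)

Section linear_algebra.
Context {R : realType}.
Local Notation C := R[i].

Lemma ReD (x y : C) : complex.Re (x + y) = complex.Re x + complex.Re y.
Proof. by case: x y => [a b] [a' b']. Qed.

Lemma ReN (x : C) : complex.Re (- x) = - complex.Re x.
Proof. by case: x. Qed.

Lemma ReZ (r : R) (x : C) : complex.Re (r%:C%C * x) = r * complex.Re x.
Proof. by case: x => [a b] /=; rewrite mul0r subr0. Qed.

Lemma ReJ (x : C) : complex.Re (Num.conj x) = complex.Re x.
Proof. by case: x. Qed.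

Lemma Re_sum (I : Type) (s : seq I) (P : pred I) (F : I -> C) :
  complex.Re (\sum_(i <- s | P i) F i) = \sum_(i <- s | P i) complex.Re (F i).
Proof. by apply: (big_morph _ ReD). Qed.

Lemma conj_realc (r : R) : Num.conj (r%:C%C : C) = r%:C%C.
Proof. exact: conjc_real. Qed.

Lemma trmxCM m n p (M : 'M[C]_(m, n)) (N : 'M[C]_(n, p)) :
  (M *m N)^t* = N^t* *m M^t*.
Proof. by rewrite trmx_mul map_mxM. Qed.

Lemma trmxCD m n (M N : 'M[C]_(m, n)) : (M + N)^t* = M^t* + N^t*.
Proof. by apply/matrixP => i j; rewrite !mxE rmorphD. Qed.

Lemma trmxCN m n (M : 'M[C]_(m, n)) : (- M)^t* = - M^t*.
Proof. by apply/matrixP => i j; rewrite !mxE rmorphN. Qed.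

Lemma trmxCB m n (M N : 'M[C]_(m, n)) : (M - N)^t* = M^t* - N^t*.
Proof. by rewrite trmxCD trmxCN. Qed.

Lemma trmxCV n (M : 'M[C]_n) : (invmx M)^t* = invmx (M^t*).
Proof. by rewrite trmx_inv map_invmx. Qed.

Section dim.
Variable d : nat.
Implicit Types (A B K M N S X Y : 'M[C]_d) (u v w : 'cV[C]_d).

Definition ip u v : R := complex.Re (cdot u v).

Lemma ipDl u v w : ip (u + v) w = ip u w + ip v w.
Proof.
rewrite /ip -ReD; congr complex.Re; rewrite /cdot -big_split /=.
by apply: eq_bigr => k _; rewrite mxE mulrDl.
Qed.

Lemma ipC u v : ip u v = ip v u.
Proof.
rewrite /ip /cdot !Re_sum; apply: eq_bigr => k _.
by rewrite -ReJ rmorphM /= conjCK mulrC.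
Qed.

Lemma ipDr u v w : ip w (u + v) = ip w u + ip w v.
Proof. by rewrite ipC ipDl !(ipC w). Qed.

Lemma ipZl (r : R) u v : ip (r%:C%C *: u) v = r * ip u v.
Proof.
rewrite /ip /cdot -ReZ mulr_sumr; congr complex.Re.
by apply: eq_bigr => k _; rewrite mxE mulrA.
Qed.

Lemma ipZr (r : R) u v : ip u (r%:C%C *: v) = r * ip u v.
Proof. by rewrite ipC ipZl ipC. Qed.

Lemma ipNl u v : ip (- u) v = - ip u v.
Proof.
rewrite /ip /cdot -ReN -sumrN; congr complex.Re.
by apply: eq_bigr => k _; rewrite mxE mulNr.
Qed.

Lemma ipNr u v : ip u (- v) = - ip u v.
Proof. by rewrite ipC ipNl ipC. Qed.

Lemma ipBl u v w : ip (u - v) w = ip u w - ip v w.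
Proof. by rewrite ipDl ipNl. Qed.

Lemma ipBr u v w : ip w (u - v) = ip w u - ip w v.
Proof. by rewrite ipDr ipNr. Qed.

Lemma ip0l u : ip 0 u = 0.
Proof. by rewrite -(subrr u) ipBl subrr. Qed.

Lemma ip0r u : ip u 0 = 0.
Proof. by rewrite ipC ip0l. Qed.

Lemma ip_suml (I : Type) (s : seq I) (F : I -> 'cV[C]_d) v :
  ip (\sum_(i <- s) F i) v = \sum_(i <- s) ip (F i) v.
Proof.
apply: (big_morph (fun u => ip u v)); last exact: ip0l.
by move=> u w; rewrite ipDl.
Qed.

Lemma ip_sumr (I : Type) (s : seq I) (F : I -> 'cV[C]_d) v :
  ip v (\sum_(i <- s) F i) = \sum_(i <- s) ip v (F i).
Proof. by rewrite ipC ip_suml; apply: eq_bigr => i _; rewrite ipC. Qed.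

Lemma cdot_adj M u v : cdot (M *m u) v = cdot u (M^t* *m v).
Proof. by rewrite !cdotE trmxCM trmxCK mulmxA. Qed.

Lemma ip_adj M u v : ip (M *m u) v = ip u (M^t* *m v).
Proof. by rewrite /ip cdot_adj. Qed.

Lemma ip_ge0 u : 0 <= ip u u.
Proof.
rewrite /ip /cdot Re_sum; apply: sumr_ge0 => k _.
by case: (u k ord0) => a b /=; rewrite mulrN opprK addr_ge0 // -expr2 sqr_ge0.
Qed.

Lemma ip_gt0 u : u != 0 -> 0 < ip u u.
Proof.
move=> u0; rewrite lt_neqAle ip_ge0 andbT; apply: contra u0.
rewrite eq_sym /ip /cdot Re_sum psumr_eq0 => [/allP h|k _]; last first.
  by case: (u k ord0) => a b /=; rewrite mulrN opprK addr_ge0 // -expr2 sqr_ge0.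
apply/eqP/matrixP => k j; rewrite (ord1 j) mxE.
have /= := h k (mem_index_enum _).
case: (u k ord0) => a b /=; rewrite mulrN opprK -!expr2 paddr_eq0 ?sqr_ge0//.
by rewrite !sqrf_eq0 => /andP[/eqP -> /eqP ->].
Qed.

Definition herm M := M^t* = M.

Definition psd M := herm M /\ forall v, 0 <= ip (M *m v) v.

Definition pd M := herm M /\ forall v, v != 0 -> 0 < ip (M *m v) v.

Lemma pd_psd M : pd M -> psd M.
Proof.
move=> [h p]; split=> // v; have [->|/p/ltW//] := eqVneq v 0.
by rewrite ip0r.
Qed.

Lemma herm_cdot_real M v : herm M -> complex.Im (cdot (M *m v) v) = 0.
Proof.
move=> hM; have : cdot (M *m v) v = Num.conj (cdot (M *m v) v).
  rewrite {1}cdot_adj hM /cdot rmorph_sum; apply: eq_bigr => k _.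
  by rewrite rmorphM /= conjCK mulrC.
by case: (cdot _ _) => a b [/eqP]; rewrite -addr_eq0 -mulr2n mulrn_eq0 => /eqP.
Qed.

Lemma psd_possemidef M : psd M -> possemidefmx M.
Proof.
move=> [h p]; split=> // v; rewrite lecE /= herm_cdot_real// eqxx /=.
exact: p.
Qed.

Lemma posdef_pd M : posdefmx M -> pd M.
Proof. by move=> [h p]; split=> // v /p; rewrite ltcE => /andP[]. Qed.

Lemma pd_unit M : pd M -> M \in unitmx.
Proof.
move=> [h p]; rewrite unitmxE unitfE -det_tr; apply/negP => /det0P[v v0 vM].
have /p : v^T != 0 by rewrite -trmx0 (inj_eq trmx_inj).
by rewrite -{1}(trmxK M) -trmx_mul vM trmx0 ip0l ltxx.
Qed.

Lemma herm_inv M : herm M -> herm (invmx M).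
Proof. by rewrite /herm trmxCV => ->. Qed.

Lemma pd_inv M : pd M -> pd (invmx M).
Proof.
move=> pM; have [h p] := pM; have uM := pd_unit pM; split.
  exact: herm_inv.
move=> v v0; have -> : ip (invmx M *m v) v =
    ip (M *m (invmx M *m v)) (invmx M *m v).
  by rewrite mulKVmx// ipC.
apply: p; apply: contra v0 => /eqP h0.
by rewrite -(mulKVmx uM v) h0 mulmx0.
Qed.

Definition rtr M : R := complex.Re (\tr M).

Lemma rtrD M N : rtr (M + N) = rtr M + rtr N.
Proof. by rewrite /rtr raddfD /= ReD. Qed.

Lemma rtrN M : rtr (- M) = - rtr M.
Proof. by rewrite /rtr raddfN /= ReN. Qed.

Lemma rtrB M N : rtr (M - N) = rtr M - rtr N.
Proof. by rewrite rtrD rtrN. Qed.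

Lemma rtrC M N : rtr (M *m N) = rtr (N *m M).
Proof. by rewrite /rtr mxtrace_mulC. Qed.

Lemma psd_conj M S : psd M -> psd (S^t* *m M *m S).
Proof.
move=> [h p]; split.
  by rewrite /herm !trmxCM trmxCK h mulmxA.
by move=> v; rewrite -!mulmxA ip_adj trmxCK p.
Qed.

Lemma psd_tr M : psd M -> 0 <= rtr M.
Proof.
move=> [h p]; rewrite /rtr /mxtrace Re_sum; apply: sumr_ge0 => k _.
have := p (delta_mx k ord0); rewrite /ip /cdot (bigD1 k)//= big1 ?addr0.
  by rewrite -colE !mxE !eqxx conjC1 mulr1.
by move=> j jk; rewrite !mxE (negbTE jk) conjC0 mulr0.
Qed.

(** With [S] the square root of [M], the trace is that of [S N S]. *)
Lemma rtr_psd_mul M N : psd M -> psd N -> 0 <= rtr (M *m N).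
Proof.
move=> pM pN; have [[sh _] sM] := sqrtmxP (psd_possemidef pM).
rewrite -sM -mulmxA rtrC -{1}sh; apply: psd_tr; exact: psd_conj.
Qed.

(** Positivity of the form of [invmx B] at [u - B w]. The left side is affine in [u] and in [B], so
    it can be integrated term by term; [w = B^-1 u] gives equality. *)
Lemma pd_fenchel B u w : pd B ->
  2 * ip u w - ip (B *m w) w <= ip (invmx B *m u) u.
Proof.
move=> pB; have [hi pi] := pd_psd (pd_inv pB); have uB := pd_unit pB.
have := pi (u - B *m w).
rewrite mulmxBr mulKmx// !ipBl !ipBr [ip (invmx B *m u) (B *m w)]ip_adj hi.
by rewrite mulKmx// [ip w u]ipC [ip w _]ipC; lra.
Qed.

Lemma psd_cauchy B u v : psd B ->
  ip (B *m u) v ^+ 2 <= ip (B *m u) u * ip (B *m v) v.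
Proof.
move=> [h p]; set a := ip _ v; set b := ip _ u; set c := ip _ v.
have q (r s : R) : 0 <= r ^+ 2 * b + 2 * r * s * a + s ^+ 2 * c.
  have := p (r%:C%C *: u + s%:C%C *: v).
  rewrite mulmxDr -!scalemxAr !ipDl !ipDr !ipZl !ipZr.
  rewrite [ip (B *m v) u]ip_adj h [ip v (B *m u)]ipC -/a -/b -/c.
  by move=> ?; lra.
have b0 : 0 <= b := p u; have c0 : 0 <= c := p v.
have [b00|bn] := eqVneq b 0; last first.
  have bp : 0 < b by rewrite lt_neqAle eq_sym bn.
  by have := q (- a) b; nra.
(* With [b = 0] this choice reads [- a ^ 2 (c + 2) >= 0], hence [a = 0]. *)
have := q (- (c + 1)) a; rewrite b00; nra.
Qed.

Lemma pd_cauchy_inv B u v : pd B ->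
  ip u v ^+ 2 <= ip (invmx B *m u) u * ip (B *m v) v.
Proof.
move=> pB; have uB := pd_unit pB.
have := @psd_cauchy _ u (B *m v) (pd_psd (pd_inv pB)).
rewrite (ip_adj _ u) herm_inv; last by case: pB.
by rewrite mulKmx// [ip v _]ipC.
Qed.

Lemma cdotZr (a : C) u v : cdot u (a *: v) = Num.conj a * cdot u v.
Proof.
rewrite /cdot mulr_sumr; apply: eq_bigr => k _.
by rewrite mxE rmorphM mulrCA.
Qed.

Lemma cdotZl (a : C) u v : cdot (a *: u) v = a * cdot u v.
Proof.
by rewrite /cdot mulr_sumr; apply: eq_bigr => k _; rewrite mxE mulrA.
Qed.

(** By Cauchy-Schwarz the rank one matrix of [c] is at most [ip (B *m c) c] times [B^-1]; pairing
    with [N] under the trace concludes. This converts the trace gained in [defect_concave] into a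
    quadratic form at the vector [c]. *)
Lemma psd_le_trace N B c : psd N -> pd B ->
  ip (N *m c) c <= rtr (invmx B *m N) * ip (B *m c) c.
Proof.
move=> pN pB; have [->|c0] := eqVneq c 0; first by rewrite !ip0r mulr0.
have [hB qB] := pB; have b0 := qB _ c0; set b := ip (B *m c) c in b0 *.
pose Q := b%:C%C *: invmx B - c *m c^t*.
have cE w : c *m c^t* *m w = cdot w c *: c.
  rewrite -mulmxA cdotE; apply/matrixP => i j; rewrite (ord1 j) !mxE.
  by rewrite big_ord1 mulrC mxE.
have pQ : psd Q.
  split.
    rewrite /herm trmxCB trmxCM trmxCK; congr (_ - _).
    have := herm_inv hB; rewrite /herm => hi; rewrite -[in RHS]hi.
    by apply/matrixP => i j; rewrite !mxE rmorphM /= conj_realc.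
  move=> w; rewrite mulmxBl ipBl -scalemxAl ipZl cE.
  set a := cdot w c.
  have aa : ip (a *: c) w = ip w (a *: c).
    by rewrite ipC.
  have := pd_fenchel w ((b^-1)%:C%C *: (a *: c)) pB.
  have -> : ip (B *m ((b^-1)%:C%C *: (a *: c))) ((b^-1)%:C%C *: (a *: c)) =
      b^-1 * ip w (a *: c).
    rewrite -!scalemxAr ipZl ipZr mulrA; rewrite -[RHS]mul1r.
    have -> : ip (a *: (B *m c)) (a *: c) = b * ip w (a *: c).
      rewrite /ip cdotZl !cdotZr -/a.
      have -> : cdot (B *m c) c = b%:C%C.
        by rewrite [LHS]complexE herm_cdot_real// mulr0 addr0.
      by rewrite -ReZ; congr complex.Re; ring.
    by field; exact: lt0r_neq0.
  rewrite ipZr aa => h.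
  have : b * (2 * (b^-1 * ip w (a *: c)) - b^-1 * ip w (a *: c)) <=
     b * ip (invmx B *m w) w by rewrite ler_pM2l.
  suff -> : b * (2 * (b^-1 * ip w (a *: c)) - b^-1 * ip w (a *: c)) =
    ip w (a *: c) by move=> ?; lra.
  by field; exact: lt0r_neq0.
have := rtr_psd_mul pQ pN.
rewrite mulmxBl rtrB -scalemxAl.
have -> : rtr (c *m c^t* *m N) = ip (N *m c) c.
  rewrite -mulmxA /rtr mxtrace_mulC /ip cdotE mulmxA /mxtrace big_ord1 //.
have E : rtr (b%:C%C *: (invmx B *m N)) = b * rtr (invmx B *m N).
  by rewrite /rtr mxtraceZ ReZ.
by rewrite E mulrC; lra.
Qed.

End dim.
End linear_algebra.

(** * The Bellman function *)

Section inverse_identities.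
Context {F : comUnitRingType} {n : nat}.
Implicit Types A B D E N X Y : 'M[F]_n.

(** The first order Taylor formula of inversion at [A0], with an exact remainder in the form of a
    square: convexity of the inverse for finite increments. *)
Lemma inv_remainder A A0 : A \in unitmx -> A0 \in unitmx ->
  (invmx A - invmx A0) *m A *m (invmx A - invmx A0) =
  (invmx A - invmx A0) + invmx A0 *m (A - A0) *m invmx A0.
Proof.
move=> uA uA0; rewrite mulmxBr (mulmxK uA) !mulmxBl (mulVmx uA) mul1mx.
by rewrite mulmxBr (mulVmx uA0) mulmxBl mul1mx opprB.
Qed.

(** The same remainder through the increment of [A] instead of that of its inverse. *)
Lemma inv_remainder2 A A0 : A \in unitmx -> A0 \in unitmx ->
  (invmx A - invmx A0) *m A *m (invmx A - invmx A0) =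
  invmx A0 *m ((A - A0) *m invmx A *m (A - A0)) *m invmx A0.
Proof.
move=> uA uA0; have E : invmx A - invmx A0 = - (invmx A *m (A - A0) *m invmx A0).
  by rewrite mulmxBr (mulVmx uA) mulmxBl mul1mx (mulmxK uA0) opprB.
have E' : invmx A - invmx A0 = - (invmx A0 *m (A - A0) *m invmx A).
  by rewrite mulmxBr (mulVmx uA0) mulmxBl mul1mx (mulmxK uA) opprB.
rewrite [X in X *m _ *m _]E' {}E mulNmx mulmxN mulNmx opprK -!mulmxA.
by rewrite (mulKVmx uA).
Qed.

(** A completed square, used with [D] and [E] the increments of [A^-1] and [B^-1]: its mixed terms
    produce twice [tr (D E)], the part of [tr (A^-1 B^-1)] that has no sign. *)
Lemma tr_square A X D E B Y : A *m X = 1%:M -> X *m A = 1%:M ->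
  B *m Y = 1%:M -> Y *m B = 1%:M ->
  \tr ((D + B *m E *m X) *m A *m (D + X *m E *m B) *m Y) =
  \tr (D *m A *m D *m Y) + \tr (D *m E) + \tr (D *m E) +
  \tr (B *m (E *m X *m E)).
Proof.
move=> AX XA BY YB; rewrite !(mulmxDl, mulmxDr) !mxtraceD.
have -> : D *m A *m (X *m E *m B) *m Y = D *m E.
  by rewrite -!mulmxA BY mulmx1 (mulmxA A) AX mul1mx.
have -> : B *m E *m X *m A *m D *m Y = B *m E *m D *m Y.
  by rewrite -(mulmxA _ X A) XA mulmx1.
have -> : B *m E *m X *m A *m (X *m E *m B) *m Y = B *m (E *m X *m E).
  by rewrite -(mulmxA _ X A) XA mulmx1 -!mulmxA BY mulmx1.
have -> : \tr (B *m E *m D *m Y) = \tr (D *m E).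
  by rewrite mxtrace_mulC !mulmxA YB mul1mx mxtrace_mulC.
ring.
Qed.

Lemma tr_sandwich X E B : \tr (B *m (E *m X *m E)) = \tr (X *m (E *m B *m E)).
Proof. by rewrite [RHS]mxtrace_mulC !mulmxA [LHS]mxtrace_mulC !mulmxA. Qed.

Lemma tr_cancel B Y N : B *m Y = 1%:M -> \tr (Y *m N) = \tr (B *m (Y *m N *m Y)).
Proof. by move=> BY; rewrite !mulmxA BY mul1mx mxtrace_mulC. Qed.

Lemma tr_mul_diff X Y X0 Y0 : \tr (X *m Y) = \tr (X0 *m Y0) +
  \tr (X0 *m (Y - Y0)) + \tr ((X - X0) *m Y0) + \tr ((X - X0) *m (Y - Y0)).
Proof.
by rewrite !(mulmxBl, mulmxBr) !raddfB /=; ring.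
Qed.

End inverse_identities.

(** * Concavity of the defect, and the weight function *)

Section bellman.
Context {R : realType}.
Local Notation C := R[i].
Variable d : nat.
Implicit Types (A B N : 'M[C]_d) (u v w c : 'cV[C]_d).

Lemma herm_sub A B : herm A -> herm B -> herm (A - B).
Proof. by rewrite /herm trmxCB => -> ->. Qed.

Lemma rtr_le A B N (r : R) : psd N -> herm A -> herm B ->
  (forall v, ip (A *m v) v <= r * ip (B *m v) v) ->
  rtr (A *m N) <= r * rtr (B *m N).
Proof.
move=> pN hA hB AB.
have rZ (M : 'M[C]_d) : rtr (r%:C%C *: M) = r * rtr M.
  by rewrite /rtr mxtraceZ ReZ.
suff /rtr_psd_mul/(_ pN) : psd (r%:C%C *: B - A).
  by rewrite mulmxBl rtrB -scalemxAl rZ subr_ge0.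
split; last by move=> v; rewrite mulmxBl ipBl -scalemxAl ipZl subr_ge0.
apply: herm_sub => //; rewrite /herm -[in RHS]hB.
by apply/matrixP => i j; rewrite !mxE rmorphM /= conj_realc.
Qed.

(** Zero when [B = A^-1], as for the averages of a constant weight. *)
Definition defect A B : R := d%:R - rtr (invmx A *m invmx B).

(** The differential of [defect] at [(A0, B0)], applied to the increment towards [(A, B)]. *)
Definition defect_diff A0 B0 A B : R :=
  rtr (invmx A0 *m (invmx B0 *m (B - B0) *m invmx B0)) +
  rtr ((invmx A0 *m (A - A0) *m invmx A0) *m invmx B0).

Let concave_arith (t0 zz dady de b0exe b0ebe x0ebe r k x0e l1 dy l2 xy xy0 : R) :
  0 <= dady -> 0 <= zz -> zz = dady + de + de + b0exe -> b0exe <= 1 * b0ebe ->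
  b0ebe <= r * x0ebe -> 0 <= x0ebe -> r <= 4 / 3 -> k = b0ebe ->
  x0ebe = x0e + l1 -> dady = dy + l2 -> xy = xy0 + x0e + dy + de ->
  (t0 - xy) - (t0 - xy0) <= l1 + l2 - k / 4.
Proof.
move=> *; have ? : r * x0ebe <= 4 / 3 * x0ebe by exact: ler_wpM2r.
lra.
Qed.

Lemma defect_concave A B A0 B0 (r : R) : pd A -> pd B -> pd A0 -> pd B0 ->
  (forall v, ip (invmx A *m v) v <= ip (B *m v) v) ->
  (forall v, ip (B0 *m v) v <= r * ip (invmx A0 *m v) v) -> r <= 4 / 3 ->
  defect A B - defect A0 B0 <= defect_diff A0 B0 A B -
    rtr (invmx B0 *m ((B - B0) *m invmx B *m (B - B0))) / 4.
Proof.
move=> pA pB pA0 pB0 AB AB0 r43.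
have [[uA uB] [uA0 uB0]] := ((pd_unit pA, pd_unit pB), (pd_unit pA0, pd_unit pB0)).
have [[hA _] [hB _]] := (pA, pB); have [[hA0 _] [hB0 _]] := (pA0, pB0).
have D1 := inv_remainder uA uA0; have E1 := inv_remainder uB uB0.
have EN := inv_remainder2 uB uB0; rewrite /defect /defect_diff.
have hX := herm_inv hA; have hY := herm_inv hB.
have hX0 := herm_inv hA0; have hY0 := herm_inv hB0.
have pX0 := pd_psd (pd_inv pA0); have pY0 := pd_psd (pd_inv pB0).
have AX := mulmxV uA; have XA := mulVmx uA.
have BY0 := mulmxV uB0; have YB0 := mulVmx uB0.
move: (invmx A) (invmx B) (invmx A0) (invmx B0) AB AB0 D1 E1 EN hX hY hX0 hY0
  pX0 pY0 AX XA BY0 YB0 => X Y X0 Y0 AB AB0 D1 E1 EN hX hY hX0 hY0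
  pX0 pY0 AX XA BY0 YB0.
move: D1 E1 EN (@tr_mul_diff _ _ X Y X0 Y0) (herm_sub hX hX0) (herm_sub hY hY0).
move: (X - X0) (Y - Y0) => D E D1 E1 EN t7 hD hE.
move: ((B - B0) *m Y *m (B - B0)) EN => N EN.
(* [rtr (Z^* A Z Y0) >= 0] is the concavity of the defect, up to a second order
   term in [E] that costs a factor [r] *)
pose Z := D + X *m E *m B0.
have hZ : Z^t* = D + B0 *m E *m X.
  by rewrite trmxCD !trmxCM hD hE hX hB0 mulmxA.
have ZAZ0 : 0 <= rtr (Z^t* *m A *m Z *m Y0).
  by apply: rtr_psd_mul pY0; exact/psd_conj/pd_psd.
have ZAZ : rtr (Z^t* *m A *m Z *m Y0) = rtr (D *m A *m D *m Y0) +
    rtr (D *m E) + rtr (D *m E) + rtr (B0 *m (E *m X *m E)).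
  rewrite hZ; apply: (etrans (congr1 (@complex.Re R)
    (tr_square D E AX XA BY0 YB0))).
  by rewrite !ReD.
have pEME (M : 'M[C]_d) : psd M -> psd (E *m M *m E).
  by move=> pM; have := psd_conj E pM; rewrite hE.
have pEBE := pEME _ (pd_psd pB).
have sw M : rtr (B0 *m (E *m M *m E)) = rtr (M *m (E *m B0 *m E)).
  exact: (congr1 (@complex.Re R) (tr_sandwich M E B0)).
have t1 : rtr (B0 *m (E *m X *m E)) <= 1 * rtr (B0 *m (E *m B *m E)).
  rewrite [X in X <= _](sw X) [X in _ <= _ * X](sw B).
  apply: (rtr_le (pEME _ (pd_psd pB0)) hX hB) => v.
  by rewrite mul1r; exact: AB.
have t2 : rtr (B0 *m (E *m B *m E)) <= r * rtr (X0 *m (E *m B *m E)).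
  exact: rtr_le pEBE hB0 hX0 AB0.
have t3 : 0 <= rtr (X0 *m (E *m B *m E)) by exact: rtr_psd_mul pX0 pEBE.
have t4 : rtr (Y0 *m N) = rtr (B0 *m (E *m B *m E)).
  by rewrite EN; exact: (congr1 (@complex.Re R) (tr_cancel N BY0)).
have t5 : rtr (X0 *m (E *m B *m E)) =
    rtr (X0 *m E) + rtr (X0 *m (Y0 *m (B - B0) *m Y0)).
  by rewrite E1; apply: (etrans (congr1 _ (mulmxDr X0 E _))); exact: rtrD.
have t6 : rtr (D *m A *m D *m Y0) =
    rtr (D *m Y0) + rtr (X0 *m (A - A0) *m X0 *m Y0).
  by rewrite D1 (mulmxDl D) rtrD.
have t7' : rtr (X *m Y) =
    rtr (X0 *m Y0) + rtr (X0 *m E) + rtr (D *m Y0) + rtr (D *m E).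
  by rewrite /rtr t7 !ReD.
have DAD0 : 0 <= rtr (D *m A *m D *m Y0).
  apply: rtr_psd_mul pY0; have := psd_conj D (pd_psd pA); by rewrite hD.
exact: (concave_arith d%:R DAD0 ZAZ0 ZAZ t1 t2 t3 r43 t4 t5 t6 t7').
Qed.

Lemma sqr_le_mul4 (a x y : R) : 0 <= x -> 0 <= y -> a ^+ 2 <= 4 * x * y ->
  a <= x + y.
Proof.
move=> x0 y0 h; rewrite leNgt; apply/negP => xya.
have : (x + y) ^+ 2 < a ^+ 2 by rewrite ltr_pXn2r ?nnegrE//; lra.
have := sqr_ge0 (x - y); lra.
Qed.

(* A concave function of the defect: on [0, H] its slope, at least [64 / e],
   absorbs the second order variation of [B], its second derivative absorbs its
   own increments, and [e ^ 2 = 2048 H] keeps its values in [1, 1 + e]. *)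
Definition weight_fun (H e x : R) : R :=
  1 + 128 / e * x - 32 / (e * H) * x ^+ 2.

Definition weight_fun' (H e x : R) : R := 128 / e - 64 / (e * H) * x.

Section weight_function.
Variables (H e : R).
Hypotheses (H0 : 0 < H) (H1 : H <= 1 / 2048) (e0 : 0 < e).
Hypothesis (eH : e ^+ 2 = 2048 * H).

Let e1 : e <= 1.
Proof.
rewrite leNgt; apply/negP => ?; have : 1 < e ^+ 2 by rewrite exprn_egt1.
move: H1 eH; lra.
Qed.

Lemma weight_funE x y : weight_fun H e y =
  weight_fun H e x + weight_fun' H e x * (y - x) - 32 / (e * H) * (y - x) ^+ 2.
Proof. by rewrite /weight_fun /weight_fun'; field; rewrite !lt0r_neq0. Qed.

Lemma weight_fun'_bounds x : 0 <= x <= H -> 64 / e <= weight_fun' H e x <= 128 / e.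
Proof.
have e0' := e0; move=> /andP[x0 xH]; rewrite /weight_fun'.
have -> : 64 / (e * H) * x = 64 / e * (x / H) by field; rewrite !lt0r_neq0.
have a0 : 0 < 64 / e by rewrite divr_gt0.
have y0 : 0 <= x / H by rewrite divr_ge0// ltW.
have y1 : x / H <= 1 by rewrite ler_pdivrMr// mul1r.
have -> : 128 / e = 2 * (64 / e) by ring.
have p1 : 0 <= 64 / e * (x / H) by rewrite mulr_ge0// ltW.
have p2 : 64 / e * (x / H) <= 64 / e * 1 by rewrite ler_pM2l.
by apply/andP; split; lra.
Qed.

Lemma weight_fun_bounds x : 0 <= x <= H -> 1 <= weight_fun H e x <= 1 + e.
Proof.
have e0' := e0; move=> /andP[x0 xH]; rewrite /weight_fun.
have E : 128 / e * H = e / 16.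
  apply: (@mulfI _ e); first exact: lt0r_neq0.
  rewrite !mulrA [e * 128]mulrC mulfK ?lt0r_neq0//.
  by rewrite -expr2 eH; field.
have -> : 128 / e * x = e / 16 * (x / H).
  by rewrite -E; field; rewrite !lt0r_neq0.
have -> : 32 / (e * H) * x ^+ 2 = e / 16 * (x / H) ^+ 2 / 4.
  by rewrite -E; field; rewrite !lt0r_neq0.
have y0 : 0 <= x / H by rewrite divr_ge0// ltW.
have y1 : x / H <= 1 by rewrite ler_pdivrMr// mul1r.
move: (x / H) y0 y1 => y y0 y1.
have p1 : 0 <= e * y by rewrite mulr_ge0// ltW.
have p2 : e * y <= e * 1 by rewrite ler_pM2l.
have p3 : e * y * y <= e * y * 1 by rewrite ler_wpM2l.
have p4 : 0 <= e * y * y by rewrite mulr_ge0.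
by apply/andP; split; lra.
Qed.

(** Here [h], [h0] are the defects, [l] the linear part of [h - h0], and [q = (B c, c)],
    [b = (B0 c, c)], [s = (B c, v)], [s0 = (B0 c, v)], the scalar [v] being [(B v, v)]; [n] and [k]
    are the form at [c] and the trace of the second order increment of [B]. Two cross terms cost
    [e v / 2] each. The variation of [B] leaves [8 n / e], absorbed by the slope; the variation of
    the weight leaves a multiple of [(h - h0) ^ 2 q], absorbed by the second derivative. With a
    weight at most [1 + e] this makes [1 + 2 e]. *)
Lemma one_leg_scalar (h h0 q b n s s0 v k l : R) :
  0 <= h <= H -> 0 <= h0 <= H -> 0 <= q -> 0 <= b -> 0 <= n -> 0 <= v ->
  (s - s0) ^+ 2 <= n * v -> s ^+ 2 <= q * v -> (q - b) ^+ 2 <= n * q ->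
  n <= k * b -> h - h0 <= l - k / 4 ->
  weight_fun H e h * (q + 2 * s + v) <= 2 * (weight_fun H e h0 * s0) +
    (1 + 2 * e) * v + weight_fun H e h0 * q + weight_fun' H e h0 * b * l.
Proof.
move=> hH h0H q0 b0 n0 v0 sv sq qb nk hl.
have [[H0' H1'] [e0' e1']] := ((H0, H1), (e0, e1)).
have /andP[f1 f2] := weight_fun_bounds hH.
have /andP[g1 g2] := weight_fun_bounds h0H.
have /andP[d1 d2] := weight_fun'_bounds h0H.
have /andP[d1' d2'] := weight_fun'_bounds hH.
have F1 := weight_funE h0 h; have F2 := weight_funE h h0.
have rhoE : 32 / (e * H) = 64 / e * (2 * H)^-1.
  by field; rewrite !lt0r_neq0.
move: (32 / (e * H)) rhoE F1 F2 => rho rhoE.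
move: (weight_fun H e h) (weight_fun H e h0) (weight_fun' H e h0)
  (weight_fun' H e h) f1 f2 g1 g2 d1 d2 d1' d2' =>
  f g g' f' f1 f2 g1 g2 d1 d2 d1' d2' F1.
rewrite -(opprB h h0) sqrrN; move: (h - h0) F1 hl => t F1 hl F2.
have F2' : g - f = - f' * t - rho * t ^+ 2.
  by rewrite F2; ring.
have a0 : 0 < 64 / e by rewrite divr_gt0.
have fg2 : (f - g) ^+ 2 <= (128 / e) ^+ 2 * t ^+ 2.
  have -> : f - g = (g' + f') / 2 * t by lra.
  rewrite exprMn; apply: ler_wpM2r; first exact: sqr_ge0.
  have E : 128 / e = 2 * (64 / e) by ring.
  by rewrite lerXn2r ?nnegrE//; lra.
have i1 : 2 * g * (s - s0) <= e / 2 * v + 8 / e * n.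
  apply: sqr_le_mul4.
  - by rewrite mulr_ge0// divr_ge0// ltW.
  - by rewrite mulr_ge0// divr_ge0// ltW.
  have -> : 4 * (e / 2 * v) * (8 / e * n) = 16 * (n * v).
    by field; rewrite lt0r_neq0.
  rewrite exprMn; apply: ler_pM => //; try exact: sqr_ge0.
  have -> : 16 = 4 ^+ 2 :> R by ring.
  by rewrite lerXn2r ?nnegrE//; lra.
have i2 : 2 * (f - g) * s <= e / 2 * v + 2 / e * ((f - g) ^+ 2 * q).
  apply: sqr_le_mul4.
  - by rewrite mulr_ge0// divr_ge0// ltW.
  - by apply: mulr_ge0; [rewrite divr_ge0// ltW|rewrite mulr_ge0// sqr_ge0].
  have -> : 4 * (e / 2 * v) * (2 / e * ((f - g) ^+ 2 * q)) =
    4 * (f - g) ^+ 2 * (q * v) by field; rewrite lt0r_neq0.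
  have -> : (2 * (f - g) * s) ^+ 2 = 4 * (f - g) ^+ 2 * s ^+ 2 by ring.
  by apply: ler_wpM2l => //; rewrite mulr_ge0// sqr_ge0.
have i3 : t * (q - b) <= 2 * t ^+ 2 * q + n / 8.
  apply: sqr_le_mul4.
  - by apply: mulr_ge0 => //; rewrite mulr_ge0// sqr_ge0.
  - by rewrite divr_ge0.
  have -> : 4 * (2 * t ^+ 2 * q) * (n / 8) = t ^+ 2 * (n * q) by field.
  by rewrite exprMn; apply: ler_wpM2l => //; exact: sqr_ge0.
have i4 : t * b <= l * b - n / 4.
  have : t * b <= (l - k / 4) * b by exact: ler_wpM2r.
  lra.
have i5 : t * q <= l * b - n / 8 + 2 * t ^+ 2 * q by lra.
have i6 : g' * (t * q) <= g' * (l * b - n / 8 + 2 * t ^+ 2 * q).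
  by apply: ler_wpM2l => //; lra.
have i7 : 8 / e * n <= g' * (n / 8).
  have -> : 8 / e * n = 64 / e * (n / 8) by field; rewrite lt0r_neq0.
  by apply: ler_wpM2r => //; rewrite divr_ge0.
(* The term in [(f - g) ^ 2] has coefficient [2 / e * (128 / e) ^ 2], which is half of [rho] because
   [e ^ 2 = 2048 H]; the other half exceeds [2 g'], since [g' <= 128 / e] and [H] is small. *)
have i8 : g' * (2 * t ^+ 2 * q) + 2 / e * ((f - g) ^+ 2 * q) <= rho * t ^+ 2 * q.
  have T0 : 0 <= t ^+ 2 * q by rewrite mulr_ge0// sqr_ge0.
  have : 2 / e * ((f - g) ^+ 2 * q) <= 2 / e * ((128 / e) ^+ 2 * (t ^+ 2 * q)).
    rewrite ler_pM2l ?divr_gt0//; rewrite mulrA.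
    by apply: ler_wpM2r.
  have : 2 * g' + 2 / e * (128 / e) ^+ 2 <= rho.
    have -> : 2 / e * (128 / e) ^+ 2 = 2 * 128 * 128 / e * (e ^+ 2)^-1.
      by field; rewrite lt0r_neq0.
    rewrite rhoE eH.
    have -> : 2 * 128 * 128 / e * (2048 * H)^-1 = 64 / e * (4 * H)^-1.
      by field; rewrite !lt0r_neq0.
    have : 4 <= (4 * H)^-1.
      by rewrite -[4]invrK lef_pV2 ?posrE ?mulr_gt0//; lra.
    have -> : (2 * H)^-1 = 2 * (4 * H)^-1 by field; rewrite lt0r_neq0.
    have ? : 128 / e = 2 * (64 / e) by ring.
    move=> h4; have : 64 / e * 4 <= 64 / e * (4 * H)^-1 by rewrite ler_pM2l.
    lra.
  move=> k1 k2; have k3 := ler_wpM2r T0 k1.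
  rewrite mulrDl in k3; lra.
have i9 : f * q = g * q + g' * (t * q) - rho * t ^+ 2 * q.
  by rewrite F1; ring.
have i10 : f * v <= (1 + e) * v by apply: ler_wpM2r.
have -> : f * (q + 2 * s + v) = f * q + 2 * (g * s0) + 2 * g * (s - s0) +
   2 * (f - g) * s + f * v by ring.
rewrite i9; lra.
Qed.

End weight_function.

End bellman.

Lemma scale_invmxK (F : fieldType) n (B : 'M[F]_n) (u : 'cV[F]_n) (a : F) :
  B \in unitmx -> a != 0 -> a *: (B *m (a^-1 *: (invmx B *m u))) = u.
Proof. by move=> uB a0; rewrite -scalemxAr scalerA mulfV// scale1r mulKVmx. Qed.

(** * The tangent inequality of the Bellman function *)

Section bellman_function.
Context {R : realType}.
Local Notation C := R[i].
Variable d : nat.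
Implicit Types (A B N : 'M[C]_d) (u v w c : 'cV[C]_d).

(** [A^-1 <= B <= r A^-1] as quadratic forms. For the heat averages of a weight and of its inverse
    the first half is Jensen's inequality, and the second comes from the characteristic, [r] being
    the square of a bound for it. *)
Definition flat_pair (r : R) A B := [/\ pd A, pd B,
  forall v, ip (invmx A *m v) v <= ip (B *m v) v &
  forall v, ip (B *m v) v <= r * ip (invmx A *m v) v].

Lemma rtr1 : rtr (1%:M : 'M[C]_d) = d%:R.
Proof.
by rewrite /rtr mxtrace1 -[in LHS](rmorph_nat (real_complex R)).
Qed.

(** Paired with [B^-1] under the trace, the two form inequalities give
    [d / r <= tr (A^-1 B^-1) <= d]. *)
Lemma defect_bounds r A B : 1 <= r -> flat_pair r A B ->
  0 <= defect A B <= d%:R * (r - 1).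
Proof.
move=> r1 [pA pB AB BA]; rewrite /defect.
have [[hA _] [hB _]] := (pA, pB).
have hX := herm_inv hA; have uB := pd_unit pB.
have pY := pd_psd (pd_inv pB).
have := @rtr_le _ _ (invmx A) B (invmx B) 1 pY hX hB.
rewrite mulmxV// rtr1 mul1r => /(_ _)/wrap[v|h1]; first by rewrite mul1r.
have := @rtr_le _ _ B (invmx A) (invmx B) r pY hB hX BA.
rewrite mulmxV// rtr1 => h2.
have : 0 <= rtr (invmx A *m invmx B).
  exact: rtr_psd_mul (pd_psd (pd_inv pA)) pY.
by move=> h3; apply/andP; split; nra.
Qed.

Definition bell (H e : R) u A B : R :=
  ip (invmx B *m u) u / weight_fun H e (defect A B).

Let one_leg_arith (f uc uv fb a w s e bv gc gl : R) : 0 < f ->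
  2 * (f * (uc + uv)) - f * (f * fb) <= w ->
  f * fb <= 2 * s + e * bv + gc + gl ->
  2 * uc + 2 * (uv - s) - e * bv - gc - gl <= w / f.
Proof.
move=> f0 h1 h2; rewrite ler_pdivlMr//.
have : f * (f * fb) <= f * (2 * s + e * bv + gc + gl) by rewrite ler_pM2l.
lra.
Qed.

(** Fenchel's inequality at [f (c + v)], with [f] the weight at [(A, B)]; [one_leg_scalar] then
    bounds the quadratic term. The vector [c] is half the gradient of [bell] in [u] at the base
    point, so [v = 0] gives the tangent plane there, and the terms in [v] carry the gain of
    convexity. For fixed [v] the left side is affine in [u], [A] and [B]. *)
Lemma one_leg (r H e : R) A B A0 B0 u u0 v : 1 <= r -> r <= 4 / 3 ->
  H = d%:R * (r - 1) -> 0 < H -> H <= 1 / 2048 -> 0 < e ->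
  e ^+ 2 = 2048 * H -> flat_pair r A B -> flat_pair r A0 B0 ->
  let g := weight_fun H e (defect A0 B0) in
  let c := (g^-1)%:C%C *: (invmx B0 *m u0) in
  2 * ip u c + 2 * ip (u - u0) v - (1 + 2 * e) * ip (B *m v) v -
    g * ip (B *m c) c - weight_fun' H e (defect A0 B0) * ip (B0 *m c) c *
    defect_diff A0 B0 A B <= bell H e u A B.
Proof.
move=> r1 r43 HE H0 H1 e0 eH fl fl0; cbv zeta.
set g := weight_fun H e (defect A0 B0).
set c := (g^-1)%:C%C *: (invmx B0 *m u0).
have hH := defect_bounds r1 fl; have h0H := defect_bounds r1 fl0.
rewrite -HE in hH h0H.
have /andP[f1 _] := weight_fun_bounds H0 e0 eH hH.
have /andP[g1 _] := weight_fun_bounds H0 e0 eH h0H.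
have key0 := one_leg_scalar H0 H1 e0 eH hH h0H.
rewrite /bell; rewrite -/g in g1 key0.
have [pA pB AB _] := fl; have [pA0 pB0 _ BA0] := fl0.
have conc := defect_concave pA pB pA0 pB0 AB BA0 r43.
move: (weight_fun' H e (defect A0 B0)) key0 => g' key0.
have g0 : g != 0 := lt0r_neq0 (lt_le_trans ltr01 g1).
have f0 := lt_le_trans ltr01 f1.
have u0E : u0 = g%:C%C *: (B0 *m c).
  rewrite /c fmorphV /= scale_invmxK//; first exact: pd_unit.
  by rewrite fmorph_eq0.
move: (weight_fun H e (defect A B)) f0 key0 {f1} => f f0 key0.
move: g c u0E key0 {g1 g0} => g c u0E key0.
move: (defect A B - defect A0 B0) (defect_diff A0 B0 A B) conc key0 {hH h0H}.
move=> t l conc key0.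
have [hB _] := pB; have [hB0 _] := pB0.
have hD := herm_sub hB hB0.
move: (B - B0) (fun w => ipBl (B *m c) (B0 *m c) w) (mulmxBl B B0 c) hD conc.
move=> D D1 DE hD conc.
have {}D1 w : ip (B *m c) w - ip (B0 *m c) w = ip (D *m c) w.
  by rewrite -D1 DE.
have pN : psd (D *m invmx B *m D).
  by have := psd_conj D (pd_psd (pd_inv pB)); rewrite hD.
have NE : ip (D *m invmx B *m D *m c) c = ip (invmx B *m (D *m c)) (D *m c).
  by rewrite -!mulmxA ip_adj hD.
have key := key0 _ _ _ _ _ _ _ _ ((pd_psd pB).2 c) ((pd_psd pB0).2 c) (pN.2 c)
  ((pd_psd pB).2 v) _ (psd_cauchy c v (pd_psd pB)) _ (psd_le_trace c pN pB0) conc.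
have {}key : f * (ip (B *m c) c + 2 * ip (B *m c) v + ip (B *m v) v) <=
  2 * (g * ip (B0 *m c) v) + (1 + 2 * e) * ip (B *m v) v +
    g * ip (B *m c) c + g' * ip (B0 *m c) c * l.
  by apply: key; rewrite D1 NE; exact: pd_cauchy_inv.
have fen := pd_fenchel u (f%:C%C *: (c + v)) pB.
have e1 : ip u (f%:C%C *: (c + v)) = f * (ip u c + ip u v).
  by rewrite ipZr ipDr.
have e2 : ip (B *m (f%:C%C *: (c + v))) (f%:C%C *: (c + v)) =
   f * (f * (ip (B *m c) c + 2 * ip (B *m c) v + ip (B *m v) v)).
  rewrite -scalemxAr ipZr ipZl mulmxDr !ipDl !ipDr.
  have -> : ip (B *m v) c = ip (B *m c) v by rewrite ip_adj hB ipC.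
  ring.
have e3 : ip (u - u0) v = ip u v - g * ip (B0 *m c) v.
  by rewrite ipBl u0E ipZl.
rewrite e1 e2 in fen; rewrite e3.
exact: one_leg_arith f0 fen key.
Qed.

End bellman_function.

(** * Gaussian integrals *)

Section has_int.
Context d (T : measurableType d) {R : realType}.
Variable mu : {measure set T -> \bar R}.
Implicit Types (f g : T -> R) (a b : R).

(** Integrability is bundled with the value, so that linearity and comparison compose without side
    conditions. *)
Definition has_int f a : Prop :=
  mu.-integrable setT (EFin \o f) /\ (\int[mu]_x (f x)%:E = a%:E)%E.

Lemma has_int_measurable f a : has_int f a -> measurable_fun setT f.
Proof. by move=> [/integrableP[/measurable_EFinP]]. Qed.

Lemma has_int_Rintegral f : mu.-integrable setT (EFin \o f) ->
  has_int f (\int[mu]_x f x).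
Proof. by move=> fi; split=> //; rewrite fineK// integrable_fin_num. Qed.

Lemma has_intE f a : has_int f a -> \int[mu]_x f x = a.
Proof. by move=> [_ fa]; rewrite /Rintegral fa. Qed.

Lemma has_int_inj f a b : has_int f a -> has_int f b -> a = b.
Proof. by move=> [_ fa] [_]; rewrite fa => -[]. Qed.

Lemma has_int_ge0 f a : measurable_fun setT f -> (forall x, 0 <= f x) ->
  (\int[mu]_x (f x)%:E = a%:E)%E -> has_int f a.
Proof.
move=> mf f0 fa; split=> //; apply/integrableP; split.
  exact/measurable_EFinP.
under eq_integral do rewrite /= ger0_norm//.
by rewrite fa ltry.
Qed.

Lemma eq_has_int f g a : f =1 g -> has_int f a -> has_int g a.
Proof. by move=> /funext ->. Qed.

Lemma has_intD f g a b : has_int f a -> has_int g b ->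
  has_int (fun x => f x + g x) (a + b).
Proof.
move=> [fi fa] [gi gb]; split.
  have := integrableD measurableT fi gi; apply: eq_integrable => //.
by rewrite integralD_EFin// fa gb.
Qed.

Lemma has_intZ f a c : has_int f a -> has_int (fun x => c * f x) (c * a).
Proof.
move=> [fi fa]; split.
  have := integrableZl measurableT c fi; apply: eq_integrable => //.
by under eq_integral do rewrite EFinM; rewrite integralZl// fa.
Qed.

Lemma has_intN f a : has_int f a -> has_int (fun x => - f x) (- a).
Proof.
move=> h; rewrite -mulN1r; apply: eq_has_int (has_intZ (-1) h) => x.
by rewrite mulN1r.
Qed.

Lemma has_intB f g a b : has_int f a -> has_int g b ->
  has_int (fun x => f x - g x) (a - b).
Proof. by move=> fa gb; apply: has_intD => //; exact: has_intN. Qed.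

Lemma has_int0 : has_int (fun=> 0) 0.
Proof. by split; [exact: integrable0|rewrite integral0]. Qed.

Lemma has_int_sum (I : Type) (s : seq I) (F : I -> T -> R) (A : I -> R) :
  (forall i, has_int (F i) (A i)) ->
  has_int (fun x => \sum_(i <- s) F i x) (\sum_(i <- s) A i).
Proof.
move=> h; elim: s => [|i s IH].
  by rewrite big_nil; apply: eq_has_int has_int0 => x; rewrite big_nil.
rewrite big_cons; apply: eq_has_int (has_intD (h i) IH) => x.
by rewrite big_cons.
Qed.

Lemma has_int_le f g a b : has_int f a -> has_int g b ->
  (forall x, f x <= g x) -> a <= b.
Proof.
move=> [fi fa] [gi gb] fg; rewrite -lee_fin -fa -gb.
by apply: le_integral => // x _; rewrite lee_fin.
Qed.

End has_int.

(** * Invariance of Lebesgue measure under translation and reflection *)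

Section lebesgue_invariance.
Context {R : realType}.
Local Notation mu := (@lebesgue_measure R).

Lemma lebesgue_measureD (a : R) (A : set R) : measurable A ->
  pushforward mu ((fun x => x + a) : _ -> measurableTypeR R) A = mu A.
Proof.
move=> mA; have mt : measurable_fun setT ((fun x => x + a) : R -> measurableTypeR R).
  exact: measurable_funD.
apply/esym/lebesgue_measure_unique => //= _ [[b c]] _ <-.
rewrite /pushforward; have -> : (fun x : R => x + a) @^-1` `]b, c] =
    `]b - a, c - a]%classic.
  by apply/seteqP; split=> x /=; rewrite !in_itv /= ltrBlDr lerBrDr.
rewrite !lebesgue_measure_itv/= !lte_fin ltrBlDr subrK.
by case: ifP => // _; rewrite -!EFinB; congr EFin; rewrite opprB addrA subrK.
Qed.

Lemma ge0_integral_translate (a : R) (f : R -> \bar R) :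
  measurable_fun setT f -> (forall x, 0 <= f x)%E ->
  (\int[mu]_x f (x + a)%R = \int[mu]_x f x)%E.
Proof.
move=> mf f0.
pose phi : measurableTypeR R -> measurableTypeR R := fun x => x + a.
have mt : measurable_fun setT phi by exact: measurable_funD.
rewrite -[LHS](@ge0_integral_pushforward _ _ _ _ _ _ mt mu setT f) => //.
by apply: eq_measure_integral => A mA _; exact: lebesgue_measureD.
Qed.

Lemma has_int_reflect (a c : R) (f : R -> R) :
  has_int mu f c -> has_int mu (fun x => f (a - x)) c.
Proof.
move=> [fi fc]; have mf := has_int_measurable (conj fi fc).
pose phi : measurableTypeR R -> measurableTypeR R := fun x => a - x.
have mt : measurable_fun setT phi by exact: measurable_funB.
have E (A : set R) : measurable A -> pushforward mu phi A = mu A.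
  move=> mA; rewrite -(lebesgue_measureD a mA) -[RHS]lebesgue_measureN.
    by rewrite /pushforward; congr mu; apply/seteqP; split=> x /=;
      rewrite /phi addrC.
  by rewrite -[X in measurable X]setTI; apply: measurable_funD.
have mf' := (measurable_EFinP _ _).2 mf.
have fi' : mu.-integrable (phi @^-1` setT) ((EFin \o f) \o phi).
  apply/integrableP; split.
    by rewrite preimage_setT; exact: (measurableT_comp mf' mt).
  rewrite -(@ge0_integral_pushforward _ _ _ _ _ _ mt mu setT
    (EFin \o (fun y => `|f y|))) => //; last 2 first.
  - by apply/measurable_EFinP; apply: measurableT_comp.
  - by move=> y _; rewrite lee_fin /=.
  rewrite (eq_measure_integral mu); last by move=> A mA _; exact: E.
  by case/integrableP : fi.
split; first by rewrite preimage_setT in fi'.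
rewrite -[LHS](@integral_pushforward _ _ _ _ _ _ mt mu setT _ mf' fi')//.
by rewrite (eq_measure_integral mu) => // A mA _; exact: E.
Qed.

End lebesgue_invariance.

(** * Gaussian moments in dimension one *)

Section gauss1.
Context {R : realType}.
Local Notation mu := (@lebesgue_measure R).
Implicit Types r a z : R.

(** The one-dimensional heat kernel at time [r] centred at [a], that is, the normal density of
    variance [2 r]. *)
Definition gauss1 r a z : R :=
  (Num.sqrt (4 * pi * r))^-1 * expR (- ((z - a) ^+ 2 / (4 * r))).

Lemma gauss1_norm_gt0 r : 0 < r -> 0 < Num.sqrt (4 * pi * r).
Proof. by move=> r0; rewrite sqrtr_gt0 !mulr_gt0// pi_gt0. Qed.

Lemma gauss1_gt0 r a z : 0 < r -> 0 < gauss1 r a z.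
Proof. by move=> r0; rewrite mulr_gt0 ?expR_gt0// invr_gt0 gauss1_norm_gt0. Qed.

Lemma measurable_gauss1 r a : measurable_fun setT (gauss1 r a).
Proof.
apply: measurable_funM => //; apply: measurableT_comp => //.
apply: measurableT_comp => //; apply: measurable_funM => //.
by apply: measurable_funX; exact: measurable_funB.
Qed.

Lemma has_int_gauss1 r a : 0 < r -> has_int mu (gauss1 r a) 1.
Proof.
move=> r0; have s0 : Num.sqrt (2 * r) != 0.
  by rewrite gt_eqF// sqrtr_gt0 mulr_gt0.
have E : gauss1 r a = normal_pdf a (Num.sqrt (2 * r)).
  rewrite normal_pdfE//; apply/funext => z; rewrite /gauss1 /normal_peak /normal_fun.
  rewrite sqr_sqrtr ?mulr_ge0 ?(ltW r0)//; congr (_^-1 * expR _).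
    by congr Num.sqrt; rewrite -mulr_natl; ring.
  by rewrite mulNr; congr (- (_ / _)); rewrite -mulr_natl; ring.
apply: has_int_ge0; first exact: measurable_gauss1.
  by move=> x; exact/ltW/gauss1_gt0.
by rewrite E; exact: integral_normal_pdf.
Qed.

(** Half of the exponent absorbs the square, by [w / (8 r) <= exp (w / (8 r))]; the other half is
    the exponent at the doubled time. *)
Lemma gauss1_sqr_le r a z : 0 < r ->
  (z - a) ^+ 2 * gauss1 r a z <= 8 * r * Num.sqrt 2 * gauss1 (2 * r) a z.
Proof.
move=> r0; rewrite /gauss1; set w := (z - a) ^+ 2.
have w0 : 0 <= w by exact: sqr_ge0.
have -> : Num.sqrt (4 * pi * (2 * r)) = Num.sqrt 2 * Num.sqrt (4 * pi * r).
  by rewrite -sqrtrM//; congr Num.sqrt; ring.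
have n0 := gauss1_norm_gt0 r0; set n := Num.sqrt (4 * pi * r) in n0 *.
have s0 : 0 < Num.sqrt 2 :> R by rewrite sqrtr_gt0.
have -> : 8 * r * Num.sqrt 2 * ((Num.sqrt 2 * n)^-1 *
    expR (- (w / (4 * (2 * r))))) = n^-1 * (8 * r * expR (- (w / (8 * r)))).
  have -> : 4 * (2 * r) = 8 * r by ring.
  by field; rewrite !lt0r_neq0.
rewrite mulrCA ler_pM2l ?invr_gt0//.
have -> : - (w / (4 * r)) = - (w / (8 * r)) + - (w / (8 * r)).
  by field; rewrite lt0r_neq0.
rewrite expRD mulrA ler_pM2r ?expR_gt0// expRN -ler_pdivlMr ?invr_gt0 ?expR_gt0//.
rewrite invrK -ler_pdivrMl ?mulr_gt0// mulrC.
by apply: le_trans (expR_ge1Dx _); rewrite lerDr.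
Qed.

Lemma integrable_gauss1_sqr r a : 0 < r ->
  mu.-integrable setT (EFin \o (fun z => (z - a) ^+ 2 * gauss1 r a z)).
Proof.
move=> r0; have r20 : 0 < 2 * r by rewrite mulr_gt0.
have [gi _] := has_intZ (8 * r * Num.sqrt 2) (has_int_gauss1 a r20).
apply: le_integrable gi => //.
  apply/measurable_EFinP; apply: measurable_funM; last exact: measurable_gauss1.
  by apply: measurable_funX; exact: measurable_funB.
move=> z _; rewrite /= lee_fin !ger0_norm ?gauss1_sqr_le//.
- by rewrite !mulr_ge0 ?sqrtr_ge0// ltW// gauss1_gt0.
- by rewrite mulr_ge0 ?sqr_ge0// ltW// gauss1_gt0.
Qed.

Lemma has_int_gauss1_lin r a : 0 < r ->
  has_int mu (fun z => (z - a) * gauss1 r a z) 0.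
Proof.
move=> r0.
have fi : mu.-integrable setT (EFin \o (fun z => (z - a) * gauss1 r a z)).
  have [gi _] := has_intD (has_int_gauss1 a r0)
    (has_int_Rintegral (integrable_gauss1_sqr a r0)).
  apply: le_integrable gi => //.
    apply/measurable_EFinP; apply: measurable_funM; last exact: measurable_gauss1.
    exact: measurable_funB.
  move=> z _; have g0 := ltW (gauss1_gt0 a z r0).
  have E : gauss1 r a z + (z - a) ^+ 2 * gauss1 r a z =
    (1 + (z - a) ^+ 2) * gauss1 r a z by ring.
  rewrite /= lee_fin normrM (ger0_norm g0) E [leRHS]ger0_norm; last by rewrite mulr_ge0// addr_ge0// sqr_ge0.
  rewrite ler_wpM2r// ler_norml; move: (z - a) => w.
  by have := sqr_ge0 (w - 1 / 2); have := sqr_ge0 (w + 1 / 2); lra.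
have h := has_int_Rintegral fi.
(* Reflection about [a] changes the sign of the integrand, so the integral equals its opposite. *)
have h1 := has_int_reflect (a + a) h.
have h2 := has_intN h.
have : has_int mu (fun z => - ((z - a) * gauss1 r a z))
    (\int[mu]_x ((x - a) * gauss1 r a x)).
  apply: eq_has_int h1 => z /=; rewrite /gauss1.
  have -> : a + a - z - a = - (z - a) by ring.
  by rewrite sqrrN mulNr.
move=> /(has_int_inj h2) E.
by have -> : 0 = \int[mu]_x ((x - a) * gauss1 r a x); [lra|].
Qed.

Lemma has_int_gauss1_sqr r a : 0 < r ->
  has_int mu (fun z => (z - a) ^+ 2 * gauss1 r a z) (2 * r).
Proof.
move=> r0; have h := has_int_Rintegral (integrable_gauss1_sqr a r0).
set M := \int[mu]_x _ in h.
suff <- : M = 2 * r by [].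
(* comparison with the variance [k ^ 2 r], for [k] close to 1 on both sides *)
have key k : 0 < k -> M * (k ^+ 2 - 1) <= 4 * r * k ^+ 2 * (k - 1).
  move=> k0; have kr0 : 0 < k ^+ 2 * r by rewrite mulr_gt0// exprn_gt0.
  have h1 := has_intZ k (has_int_gauss1 a kr0).
  (* [c] is the gap [1 / (4 r) - 1 / (4 k ^ 2 r)] between the exponents: multiplying by [exp (c w)]
     turns the density at time [r] into [k] times the density at time [k ^ 2 r]. The inequality
     [1 + c w <= exp (c w)] is then integrated. *)
  pose c := (k ^+ 2 - 1) / (4 * r * k ^+ 2).
  have h2 := has_intD (has_int_gauss1 a r0) (has_intZ c h).
  have : 1 + c * M <= k * 1.
    apply: has_int_le h2 h1 _ => z; rewrite /gauss1.
    have -> : Num.sqrt (4 * pi * (k ^+ 2 * r)) = k * Num.sqrt (4 * pi * r).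
      have -> : 4 * pi * (k ^+ 2 * r) = k ^+ 2 * (4 * pi * r) by ring.
      by rewrite sqrtrM ?sqr_ge0// sqrtr_sqr ger0_norm// ltW.
    have n0 := gauss1_norm_gt0 r0; move: (Num.sqrt _) n0 => n n0.
    move: ((z - a) ^+ 2) => w.
    have -> : k * ((k * n)^-1 * expR (- (w / (4 * (k ^+ 2 * r))))) =
      n^-1 * (expR (c * w) * expR (- (w / (4 * r)))).
      rewrite -expRD /c.
      have -> : (k ^+ 2 - 1) / (4 * r * k ^+ 2) * w + - (w / (4 * r)) =
        - (w / (4 * (k ^+ 2 * r))) by field; rewrite !lt0r_neq0.
      by field; rewrite !lt0r_neq0.
    have -> : n^-1 * expR (- (w / (4 * r))) + c * (w * (n^-1 *
        expR (- (w / (4 * r))))) = n^-1 * ((1 + c * w) * expR (- (w / (4 * r)))).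
      by ring.
    by rewrite ler_pM2l ?invr_gt0// ler_pM2r ?expR_gt0// expR_ge1Dx.
  have p0 : 0 < 4 * r * k ^+ 2 by rewrite !mulr_gt0// exprn_gt0.
  rewrite mulr1 -(ler_pM2l p0).
  have -> : 4 * r * k ^+ 2 * (1 + c * M) = 4 * r * k ^+ 2 + M * (k ^+ 2 - 1).
    by rewrite /c; field; rewrite !lt0r_neq0.
  lra.
apply/eqP; rewrite eq_le; apply/andP; split; apply/ler_addgt0Pr => e e0.
  pose x := Num.min 1 (e / (12 * r)).
  have x0 : 0 < x by rewrite lt_min ltr01 divr_gt0// mulr_gt0.
  have x1 : x <= 1 by rewrite ge_min lexx.
  have xe : x * (12 * r) <= e.
    by rewrite -ler_pdivlMr ?mulr_gt0// ge_min lexx orbT.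
  have M0 : 0 <= M.
    by apply: (has_int_le (has_int0 _) h) => z; rewrite mulr_ge0 ?sqr_ge0// ltW// gauss1_gt0.
  have := key (1 + x) (ltr_pwDl ltr01 (ltW x0)).
  have -> : M * ((1 + x) ^+ 2 - 1) = x * (M * (2 + x)) by ring.
  have -> : 4 * r * (1 + x) ^+ 2 * (1 + x - 1) = x * (4 * r * (1 + x) ^+ 2) by ring.
  rewrite ler_pM2l// => k1.
  have k2 : 0 <= M * x by rewrite mulr_ge0// ltW.
  have k3 : r * x ^+ 2 <= r * x by rewrite ler_pM2l//; nra.
  nra.
pose x := Num.min (1 / 2) (e / (8 * r)).
have x0 : 0 < x by rewrite lt_min divr_gt0// divr_gt0// mulr_gt0.
have x1 : x <= 1 / 2 by rewrite ge_min lexx.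
have xe : x * (8 * r) <= e.
  by rewrite -ler_pdivlMr ?mulr_gt0// ge_min lexx orbT.
have xk : 0 < 1 - x by lra.
have := key (1 - x) xk.
have -> : M * ((1 - x) ^+ 2 - 1) = - x * (M * (2 - x)) by ring.
have -> : 4 * r * (1 - x) ^+ 2 * (1 - x - 1) = - x * (4 * r * (1 - x) ^+ 2) by ring.
rewrite ler_nM2l ?oppr_lt0// => k1.
have M0 : 0 <= M.
  by apply: (has_int_le (has_int0 _) h) => z; rewrite mulr_ge0 ?sqr_ge0// ltW// gauss1_gt0.
have k2 : 0 <= M * x by rewrite mulr_ge0// ltW.
have k3 : 0 <= r * x ^+ 2 by rewrite mulr_ge0 ?sqr_ge0// ltW.
nra.
Qed.

End gauss1.

Section has_int_transfer.
Context {R : realType}.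

Lemma has_int_pushforward d1 d2 (X : measurableType d1) (Y : measurableType d2)
    (phi : X -> Y) (mphi : measurable_fun setT phi)
    (mu : {measure set X -> \bar R}) (nu : {measure set Y -> \bar R})
    (F : Y -> R) (a : R) :
  (forall A, measurable A -> nu A = pushforward mu phi A) ->
  measurable_fun setT F -> has_int mu (F \o phi) a -> has_int nu F a.
Proof.
move=> nuE mF [fi fa].
have mF' := (measurable_EFinP _ _).2 mF.
have E f : (\int[nu]_x f x = \int[pushforward mu phi]_x f x)%E.
  by apply: eq_measure_integral => A mA _; exact: nuE.
split; last first.
  rewrite E (@integral_pushforward _ _ _ _ _ _ mphi mu setT (EFin \o F))//.
apply/integrableP; split=> //=; rewrite E.
rewrite (@ge0_integral_pushforward _ _ _ _ _ _ mphi mu setT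
  (EFin \o (fun y => `|F y|)))//; last 2 first.
- by apply/measurable_EFinP; exact: measurableT_comp.
- by move=> y _; rewrite lee_fin /=.
by case/integrableP : fi.
Qed.

Lemma has_int_prod d1 d2 (X : measurableType d1) (Y : measurableType d2)
    (m1 : {sigma_finite_measure set X -> \bar R})
    (m2 : {sigma_finite_measure set Y -> \bar R}) f g (a b : R) :
  has_int m1 f a -> has_int m2 g b ->
  has_int (m1 \x m2)%E (fun p => f p.1 * g p.2) (a * b).
Proof.
move=> fa gb; have [fi fa'] := fa; have [gi gb'] := gb.
have mf := has_int_measurable fa; have mg := has_int_measurable gb.
have mfg : measurable_fun setT (EFin \o (fun p : X * Y => f p.1 * g p.2)).
  apply/measurable_EFinP; apply: measurable_funM.
    exact: (measurableT_comp mf measurable_fst).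
  exact: (measurableT_comp mg measurable_snd).
have [fi1 gi1] := (integrable_norm fi, integrable_norm gi).
have [[A fA] [B gB]] : (exists A, (\int[m1]_x `|f x|%:E = A%:E)%E) /\
    (exists B, (\int[m2]_x `|g x|%:E = B%:E)%E).
  by split; eexists; rewrite -[LHS]fineK//; apply: integrable_fin_num.
have gB' x : (\int[m2]_y `|f x * g y|%:E = (`|f x| * B)%:E)%E.
  under eq_integral do rewrite normrM EFinM.
  by rewrite integralZl// gB.
have I : (m1 \x m2)%E.-integrable setT (EFin \o (fun p : X * Y => f p.1 * g p.2)).
  apply/(integrable12ltyP _ _ mfg) => /=.
  under eq_integral do rewrite gB' EFinM.
  by rewrite integralZr// fA -EFinM ltry.
split=> //.
rewrite -[LHS](@integral12_prod_meas1 _ _ _ _ _ m1 m2 _ I) /fubini_F /=.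
have gb'' x : (\int[m2]_y (f x * g y)%:E = (f x * b)%:E)%E.
  under eq_integral do rewrite EFinM.
  by rewrite integralZl// gb'.
under eq_integral do rewrite gb'' EFinM.
by rewrite integralZr// fa'.
Qed.

Local Notation leb := (@lebesgue_measure R).

Lemma has_int_rV_prod n (g : 'I_n -> R -> R) (a : 'I_n -> R) :
  (forall i, has_int leb (g i) (a i)) ->
  has_int (lebesgue_rV n) (fun z => \prod_(i < n) g i (z ord0 i))
    (\prod_(i < n) a i).
Proof.
elim: n g a => [|n IH] g a h.
  rewrite big_ord0; apply: (@eq_has_int _ _ _ _ (fun=> 1)).
    by move=> x; rewrite big_ord0.
  apply: has_int_ge0 => //=.
  by rewrite integral_dirac//= diracE in_setT mul1e.
have mF : measurable_fun setT (fun z : 'rV[R]_n.+1 =>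
    \prod_(i < n.+1) g i (z ord0 i)).
  apply: measurable_prod => i _.
  exact: (measurableT_comp (has_int_measurable (h i)) (measurable_rV_coord i)).
rewrite big_ord_recl.
apply: (@has_int_pushforward _ _ _ _ (@rV_cons R n) (@measurable_rV_cons R n)
  (leb \x lebesgue_rV n)%E) => //.
have IHn := IH (fun i => g (lift ord0 i)) (fun i => a (lift ord0 i))
  (fun i => h (lift ord0 i)).
apply: eq_has_int (has_int_prod (h ord0) IHn) => -[x v] /=.
rewrite big_ord_recl rV_cons0; congr (_ * _).
by apply: eq_bigr => i _; rewrite rV_consS.
Qed.

End has_int_transfer.

(** * Moments of the heat kernel and the Brownian bridge *)

Section heat_moments.
Context {R : realType} {m : nat}.
Local Notation mu := (@lebesgue_rV R m).
Implicit Types (x y z : 'rV[R]_m) (r t : R).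

Lemma sqnormN z : sqnorm (- z) = sqnorm z.
Proof. by apply: eq_bigr => i _; rewrite mxE sqrrN. Qed.

Lemma heat_kernelN t z : heat_kernel t (- z) = heat_kernel t z.
Proof. by rewrite /heat_kernel sqnormN. Qed.

Lemma heat_kernelC t x y : heat_kernel t (x - y) = heat_kernel t (y - x).
Proof. by rewrite -heat_kernelN opprB. Qed.

Lemma heat_kernelE t x z : 0 < t ->
  heat_kernel t (z - x) = \prod_(i < m) gauss1 t (x ord0 i) (z ord0 i).
Proof.
move=> t0; rewrite big_split /= prodr_const card_ord -expR_sum.
rewrite /heat_kernel; congr (_ * expR _).
  rewrite exprVn; congr (_^-1); rewrite -powR12_sqrt; last first.
    by rewrite !mulr_ge0 ?pi_ge0// ltW.
  by rewrite -powR_mulrn ?powR_ge0// -powRrM [2^-1 * _]mulrC.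
rewrite /sqnorm mulr_suml -sumrN; apply: eq_bigr => i _.
by rewrite !mxE.
Qed.

Lemma heat_kernel_gt0 t z : 0 < t -> 0 < heat_kernel t z.
Proof.
by move=> t0; rewrite -(subr0 z) heat_kernelE// prodr_gt0// => i _; exact: gauss1_gt0.
Qed.

(** Centred moments of [gauss1], meant for [n <= 2]: the last branch is the variance at [n = 2] and
    a default value beyond. *)
Definition gauss_moment r (n : nat) : R :=
  match n with 0 => 1 | 1 => 0 | _ => 2 * r end.

Lemma has_int_gauss_moment r a n : 0 < r -> (n <= 2)%N ->
  has_int (@lebesgue_measure R) (fun w => (w - a) ^+ n * gauss1 r a w)
    (gauss_moment r n).
Proof.
move=> r0; case: n => [|[|[|//]]] _ /=.
- by apply: eq_has_int (has_int_gauss1 a r0) => w; rewrite expr0 mul1r.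
- exact: has_int_gauss1_lin.
- exact: has_int_gauss1_sqr.
Qed.

(** The exponent depends on the coordinate, so that mass, mean and covariance are all instances of
    one product formula. *)
Lemma has_int_heat_moment r x (e : 'I_m -> nat) : 0 < r -> (forall i, e i <= 2)%N ->
  has_int mu (fun z => (\prod_(i < m) (z ord0 i - x ord0 i) ^+ e i) *
    heat_kernel r (x - z)) (\prod_(i < m) gauss_moment r (e i)).
Proof.
move=> r0 e2.
apply: eq_has_int (has_int_rV_prod (fun i => has_int_gauss_moment (x ord0 i) r0 (e2 i))).
by move=> z; rewrite heat_kernelC heat_kernelE// -big_split.
Qed.

Lemma has_int_heat0 r x : 0 < r -> has_int mu (fun z => heat_kernel r (x - z)) 1.
Proof.
move=> r0; have := @has_int_heat_moment r x (fun=> 0%N) r0 (fun=> isT).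
rewrite [X in has_int _ _ X]big1 //; apply: eq_has_int => z.
by rewrite big1 ?mul1r// => i _; rewrite expr0.
Qed.

Lemma has_int_heat1 r x i : 0 < r ->
  has_int mu (fun z => (z ord0 i - x ord0 i) * heat_kernel r (x - z)) 0.
Proof.
move=> r0; have e2 (l : 'I_m) : ((l == i) <= 2)%N by case: eqP.
have := @has_int_heat_moment r x (fun l => (l == i)%N) r0 e2.
rewrite (bigD1 i)//= eqxx /= mul0r.
apply: eq_has_int => z; congr (_ * _); rewrite (bigD1 i)//= eqxx expr1.
by rewrite big1 ?mulr1// => l /negbTE ->; rewrite expr0.
Qed.

Lemma has_int_heat2 r x i j : 0 < r ->
  has_int mu (fun z => (z ord0 i - x ord0 i) * (z ord0 j - x ord0 j) *
    heat_kernel r (x - z)) ((i == j)%:R * (2 * r)).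
Proof.
move=> r0; have e2 (l : 'I_m) : ((l == i) + (l == j) <= 2)%N.
  by case: eqP; case: eqP.
have := @has_int_heat_moment r x (fun l => (l == i) + (l == j))%N r0 e2.
clear e2.
have [->{i}|ij] := eqVneq i j.
  rewrite (bigD1 j)//= eqxx /= mul1r big1 ?mulr1; last first.
    by move=> l /negbTE ->.
  apply: eq_has_int => z; congr (_ * _); rewrite (bigD1 j)//= eqxx.
  by rewrite big1 ?mulr1// => l /negbTE ->; rewrite expr0.
rewrite (bigD1 i)//= eqxx (negbTE ij) /= !mul0r.
apply: eq_has_int => z; congr (_ * _); rewrite (bigD1 i)//= eqxx (negbTE ij).
rewrite (bigD1 j)/=; last by rewrite eq_sym.
rewrite eqxx [j == i]eq_sym (negbTE ij) !expr1.
rewrite big1 ?mulr1// => l /andP[/negbTE -> /negbTE ->].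
by rewrite expr0.
Qed.

(** Completing the square in [z]. Up to the factor [heat_kernel t (x - y)] this is the law at time
    [s] of the Brownian bridge from [x] to [y]: mean [x + (s / t) (y - x)], covariance
    [2 s (t - s) / t]. *)
Lemma heat_kernel_bridge t s x y z : 0 < s -> s < t ->
  heat_kernel s (x - z) * heat_kernel (t - s) (z - y) = heat_kernel t (x - y) *
  heat_kernel (s * (t - s) / t) (x + (s / t) *: (y - x) - z).
Proof.
move=> s0 st; have t0 := lt_trans s0 st; have ts0 : 0 < t - s by rewrite subr_gt0.
have r0 : 0 < s * (t - s) / t by rewrite divr_gt0// mulr_gt0.
rewrite !heat_kernelE// -!big_split /=; apply: eq_bigr => i _.
rewrite !mxE; move: (x ord0 i) (y ord0 i) (z ord0 i) => {}x {}y {}z.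
rewrite /gauss1 mulrACA -expRD [RHS]mulrACA -expRD; congr (_ * expR _).
  rewrite -!invfM; congr (_^-1); rewrite -!sqrtrM.
  - by congr Num.sqrt; field; rewrite lt0r_neq0.
  - by rewrite !mulr_ge0 ?pi_ge0// ltW.
  - by rewrite !mulr_ge0 ?pi_ge0// ltW.
by field; rewrite !lt0r_neq0.
Qed.

(** Quadratic growth costs a doubling of the time, with the factor [2 ^ (m / 2)] coming from the
    normalisations. Hence second moments converge as soon as heat extensions converge at all
    times. *)
Lemma sqnorm_heat_le t z : 0 < t ->
  sqnorm z * heat_kernel t z <= 8 * t * 2 `^ (m%:R / 2) * heat_kernel (2 * t) z.
Proof.
move=> t0; rewrite /heat_kernel; set w := sqnorm z.
have p0 : 0 <= 4 * pi * t by rewrite !mulr_ge0 ?pi_ge0// ltW.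
have -> : 4 * pi * (2 * t) = 2 * (4 * pi * t) by ring.
rewrite (powRM _ (ler0n _ 2) p0); have n0 : 0 < (4 * pi * t) `^ (m%:R / 2).
  by rewrite powR_gt0// !mulr_gt0// pi_gt0.
have s0 : 0 < 2 `^ (m%:R / 2) :> R by rewrite powR_gt0.
move: (2 `^ (m%:R / 2)) s0 => s s0.
move: ((4 * pi * t) `^ (m%:R / 2)) n0 => n n0.
have -> : 8 * t * s * ((s * n)^-1 * expR (- (w / (4 * (2 * t))))) =
    n^-1 * (8 * t * expR (- (w / (8 * t)))).
  have -> : 4 * (2 * t) = 8 * t by ring.
  by field; rewrite !lt0r_neq0.
rewrite mulrCA ler_pM2l ?invr_gt0//.
have -> : - (w / (4 * t)) = - (w / (8 * t)) + - (w / (8 * t)).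
  by field; rewrite lt0r_neq0.
rewrite expRD mulrA ler_pM2r ?expR_gt0// expRN -ler_pdivlMr ?invr_gt0 ?expR_gt0//.
rewrite invrK -ler_pdivrMl ?mulr_gt0// mulrC.
by apply: le_trans (expR_ge1Dx _); rewrite lerDr.
Qed.

Lemma coord_sqr_le z i : z ord0 i ^+ 2 <= sqnorm z.
Proof.
by rewrite /sqnorm (bigD1 i)//= lerDl sumr_ge0// => l _; exact: sqr_ge0.
Qed.

End heat_moments.

(** * Averages of heat extensions *)

Section measurability.
Context {R : realType} d (T : measurableType d).
Implicit Types (u : T -> R).

(** Inversion is discontinuous at 0. It is written as [u (u ^ 2)^-1] with a measurable power
    function, an identity that also holds at 0 since [0^-1 = 0]. *)
Lemma measurable_fun_inv u : measurable_fun setT u ->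
  measurable_fun setT (fun w => (u w)^-1).
Proof.
move=> mu; rewrite (_ : (fun _ => _) = fun w => u w * (u w ^+ 2) `^ (- 1)).
  apply: measurable_funM => //.
  apply: (measurableT_comp (@measurable_powR R (-1))).
  exact: measurable_funX.
apply/funext => w; have [->|u0] := eqVneq (u w) 0; first by rewrite invr0 mul0r.
by rewrite powR_inv1 ?sqr_ge0// expr2 invfM mulrA mulfV// mul1r.
Qed.

Variable m : nat.

Lemma measurable_sqnorm (z : T -> 'rV[R]_m) :
  (forall i, measurable_fun setT (fun w => z w ord0 i)) ->
  measurable_fun setT (fun w => sqnorm (z w)).
Proof. by move=> mz; apply: measurable_sum => i; exact: measurable_funX. Qed.

Lemma measurable_heat_kernel (u : T -> R) (z : T -> 'rV[R]_m) :
  measurable_fun setT u ->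
  (forall i, measurable_fun setT (fun w => z w ord0 i)) ->
  measurable_fun setT (fun w => heat_kernel (u w) (z w)).
Proof.
move=> mu mz; have m4 (c : R) : measurable_fun setT (fun w => c * u w).
  exact: measurable_funM.
apply: measurable_funM.
  apply: measurable_fun_inv.
  exact: (measurableT_comp (@measurable_powR R (m%:R / 2)) (m4 _)).
apply: measurableT_comp => //; apply: measurableT_comp => //.
apply: measurable_funM; first exact: measurable_sqnorm.
exact: measurable_fun_inv.
Qed.

End measurability.

Section heat_extension.
Context {R : realType} {m : nat}.
Local Notation mu := (@lebesgue_rV R m).
Implicit Types (x y z : 'rV[R]_m) (s t : R) (F p : 'rV[R]_m -> R).

Lemma heat_kernel_ge0 t z : 0 <= heat_kernel t z.
Proof. by rewrite mulr_ge0 ?expR_ge0// invr_ge0 powR_ge0. Qed.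

Lemma measurable_coord_sub x i :
  measurable_fun setT (fun y : 'rV[R]_m => y ord0 i - x ord0 i).
Proof. by apply: measurable_funB => //; exact: measurable_rV_coord. Qed.

Lemma measurable_heat_kernelB t x :
  measurable_fun setT (fun y => heat_kernel t (x - y)).
Proof.
apply: measurable_heat_kernel => // i; under eq_fun do rewrite !mxE.
by apply: measurable_funB => //; exact: measurable_rV_coord.
Qed.

(** Convergence at all points and all positive times, which a finite characteristic provides for the
    entries of a weight and of its inverse. *)
Definition good F := measurable_fun setT F /\ forall x t, 0 < t ->
  mu.-integrable setT (EFin \o (fun y => F y * heat_kernel t (x - y))).

Definition heat F x t : R := \int[mu]_y (F y * heat_kernel t (x - y)).

(** Moments centred at [x] stand in for spatial derivatives, so that the averages below involve no
    differentiation under the integral. *)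
Definition heat1 F i x t : R :=
  \int[mu]_y ((y ord0 i - x ord0 i) * (F y * heat_kernel t (x - y))).

Definition heat2 F i j x t : R :=
  \int[mu]_y ((y ord0 i - x ord0 i) * (y ord0 j - x ord0 j) *
    (F y * heat_kernel t (x - y))).

Lemma has_int_heat F x t : good F -> 0 < t ->
  has_int mu (fun y => F y * heat_kernel t (x - y)) (heat F x t).
Proof. by move=> [_ gF] t0; apply: has_int_Rintegral; exact: gF. Qed.

Lemma sqnormB_ge0 x : 0 <= sqnorm x :> R.
Proof. by apply: sumr_ge0 => i _; exact: sqr_ge0. Qed.

Lemma good_weight F p x t (c : R) : good F -> 0 < t -> 0 <= c ->
  measurable_fun setT p -> (forall y, `|p y| <= c * (1 + sqnorm (y - x))) ->
  mu.-integrable setT (EFin \o (fun y => p y * (F y * heat_kernel t (x - y)))).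
Proof.
move=> [mF gF] t0 c0 mp pc.
have t20 : 0 < 2 * t by rewrite mulr_gt0.
pose k := 8 * t * 2 `^ (m%:R / 2) : R.
have k0 : 0 <= k by rewrite !mulr_ge0 ?powR_ge0// ltW.
have [I1 _] := has_intZ c (has_intD
  (has_int_Rintegral (integrable_norm (gF x t t0)))
  (has_intZ k (has_int_Rintegral (integrable_norm (gF x (2 * t) t20))))).
apply: le_integrable I1 => //.
  apply/measurable_EFinP; do 2 apply: measurable_funM => //.
  exact: measurable_heat_kernelB.
move=> y _ /=; rewrite lee_fin.
rewrite [leRHS]ger0_norm; last first.
  by rewrite mulr_ge0// addr_ge0// mulr_ge0.
rewrite (normrM (p y)) !(normrM (F y)) !(ger0_norm (heat_kernel_ge0 _ _)).
have h1 := heat_kernel_ge0 t (x - y).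
have h2 := sqnorm_heat_le (x - y) t0; rewrite -/k in h2.
have Fy := normr_ge0 (F y).
have E : sqnorm (y - x) = sqnorm (x - y) by rewrite -sqnormN opprB.
have := pc y; rewrite E => pcy.
have : `|p y| * (`|F y| * heat_kernel t (x - y)) <=
   c * (1 + sqnorm (x - y)) * (`|F y| * heat_kernel t (x - y)).
  by apply: ler_wpM2r => //; rewrite mulr_ge0.
move=> h3; apply: (le_trans h3).
have -> : c * (1 + sqnorm (x - y)) * (`|F y| * heat_kernel t (x - y)) =
  c * (`|F y| * heat_kernel t (x - y)) +
  c * `|F y| * (sqnorm (x - y) * heat_kernel t (x - y)) by ring.
have : c * `|F y| * (sqnorm (x - y) * heat_kernel t (x - y)) <=
  c * `|F y| * (k * heat_kernel (2 * t) (x - y)).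
  by apply: ler_wpM2l => //; rewrite mulr_ge0.
lra.
Qed.

Lemma coord_le x y i : `|y ord0 i - x ord0 i| <= 1 * (1 + sqnorm (y - x)).
Proof.
have := coord_sqr_le (y - x) i; rewrite !mxE mul1r.
move: (y ord0 i - x ord0 i) (sqnorm _) => w s ws.
rewrite ler_norml.
by have := sqr_ge0 (w - 1 / 2); have := sqr_ge0 (w + 1 / 2); lra.
Qed.

Lemma coord2_le x y i j : `|(y ord0 i - x ord0 i) * (y ord0 j - x ord0 j)| <=
  1 * (1 + sqnorm (y - x)).
Proof.
have := coord_sqr_le (y - x) i; have := coord_sqr_le (y - x) j; rewrite !mxE mul1r.
move: (y ord0 i - x ord0 i) (y ord0 j - x ord0 j) (sqnorm _) => w v s ws vs.
rewrite ler_norml.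
by have := sqr_ge0 (w - v); have := sqr_ge0 (w + v); lra.
Qed.

Lemma has_int_good1 F i x t : good F -> 0 < t ->
  has_int mu (fun y => (y ord0 i - x ord0 i) * (F y * heat_kernel t (x - y)))
    (heat1 F i x t).
Proof.
move=> gF t0; apply: has_int_Rintegral; apply: (good_weight gF t0 ler01).
  exact: measurable_coord_sub.
by move=> y; exact: coord_le.
Qed.

Lemma has_int_good2 F i j x t : good F -> 0 < t ->
  has_int mu (fun y => (y ord0 i - x ord0 i) * (y ord0 j - x ord0 j) *
    (F y * heat_kernel t (x - y))) (heat2 F i j x t).
Proof.
move=> gF t0; apply: has_int_Rintegral; apply: (good_weight gF t0 ler01).
  by apply: measurable_funM; exact: measurable_coord_sub.
by move=> y; exact: coord2_le.
Qed.

Lemma has_int_shift1 r x a i : 0 < r -> has_int mu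
  (fun z => (z ord0 i - x ord0 i) * heat_kernel r (a - z)) (a ord0 i - x ord0 i).
Proof.
move=> r0; have := has_intD (has_int_heat1 a i r0)
  (has_intZ (a ord0 i - x ord0 i) (has_int_heat0 a r0)).
rewrite add0r mulr1; apply: eq_has_int => z; ring.
Qed.

Lemma has_int_shift2 r x a i j : 0 < r -> has_int mu
  (fun z => (z ord0 i - x ord0 i) * (z ord0 j - x ord0 j) * heat_kernel r (a - z))
  ((i == j)%:R * (2 * r) + (a ord0 i - x ord0 i) * (a ord0 j - x ord0 j)).
Proof.
move=> r0; pose u := a ord0 i - x ord0 i; pose v := a ord0 j - x ord0 j.
have := has_intD (has_intD (has_int_heat2 a i j r0) (has_intD
  (has_intZ v (has_int_heat1 a i r0)) (has_intZ u (has_int_heat1 a j r0))))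
  (has_intZ (u * v) (has_int_heat0 a r0)).
rewrite !mulr0 !addr0 mulr1; apply: eq_has_int => z; rewrite /u /v; ring.
Qed.

Lemma has_int_shift_sqnorm r x a : 0 < r -> has_int mu
  (fun z => (1 + sqnorm (z - x)) * heat_kernel r (a - z))
  (1 + (m%:R * (2 * r) + sqnorm (a - x))).
Proof.
move=> r0; have := has_intD (has_int_heat0 a r0) (has_int_sum (index_enum 'I_m)
  (fun i => has_int_shift2 x a i i r0)).
have -> : \sum_(i <- index_enum 'I_m) ((i == i)%:R * (2 * r) +
    (a ord0 i - x ord0 i) * (a ord0 i - x ord0 i)) =
    m%:R * (2 * r) + sqnorm (a - x).
  rewrite big_split /=; congr (_ + _).
    under eq_bigr do rewrite eqxx mul1r.
    by rewrite sumr_const card_ord [RHS]mulr_natl.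
  by apply: eq_bigr => i _; rewrite !mxE expr2.
apply: eq_has_int => z; rewrite mulrDl mul1r; congr (_ + _).
by rewrite /sqnorm mulr_suml; apply: eq_bigr => i _; rewrite !mxE expr2.
Qed.

Section average.
Variables (F p P : 'rV[R]_m -> R) (x : 'rV[R]_m) (t s c V : R).
Hypotheses (gF : good F) (s0 : 0 < s) (st : s < t) (c0 : 0 <= c).
Hypothesis mp : measurable_fun setT p.
Hypothesis pc : forall z, `|p z| <= c * (1 + sqnorm (z - x)).
Hypothesis pP : forall y, has_int mu
  (fun z => p z * heat_kernel (s * (t - s) / t) (x + (s / t) *: (y - x) - z)) (P y).
Hypothesis hV : has_int mu (fun y => P y * (F y * heat_kernel t (x - y))) V.

Let t0 : 0 < t. Proof. exact: lt_trans st. Qed.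
Let ts0 : 0 < t - s. Proof. by rewrite subr_gt0. Qed.
Let r0 : 0 < s * (t - s) / t. Proof. by rewrite divr_gt0// mulr_gt0. Qed.

Let G (w : 'rV[R]_m * 'rV[R]_m) : R :=
  p w.1 * (F w.2 * (heat_kernel s (x - w.1) * heat_kernel (t - s) (w.1 - w.2))).

Let mG : measurable_fun setT G.
Proof.
have mc1 i : measurable_fun setT (fun w : 'rV[R]_m * 'rV[R]_m => w.1 ord0 i).
  exact: (measurableT_comp (measurable_rV_coord i) measurable_fst).
have mc2 i : measurable_fun setT (fun w : 'rV[R]_m * 'rV[R]_m => w.2 ord0 i).
  exact: (measurableT_comp (measurable_rV_coord i) measurable_snd).
apply: measurable_funM; first exact: (measurableT_comp mp measurable_fst).
apply: measurable_funM; first exact: (measurableT_comp gF.1 measurable_snd).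
apply: measurable_funM; apply: measurable_heat_kernel => // i.
  by under eq_fun do rewrite !mxE; exact: measurable_funB.
by under eq_fun do rewrite !mxE; exact: measurable_funB.
Qed.

Let mG' : measurable_fun setT (EFin \o G). Proof. exact/measurable_EFinP. Qed.

Let GE z y : G (z, y) = (F y * heat_kernel t (x - y)) *
  (p z * heat_kernel (s * (t - s) / t) (x + (s / t) *: (y - x) - z)).
Proof. by rewrite /G /= heat_kernel_bridge//; ring. Qed.

Let GI : (mu \x mu)%E.-integrable setT (EFin \o G).
Proof.
apply/(integrable21ltyP _ _ mG') => /=.
(* Under the bridge the mean of [1 + sqnorm (z - x)] is [1 + m (2 s (t - s) / t) + (s / t) ^ 2
   sqnorm (y - x)], which is at most the factor of [c] in [K] times [1 + sqnorm (y - x)]. *)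
pose K := c * (1 + m%:R * (2 * (s * (t - s) / t)) + (s / t) ^+ 2).
have K0 : 0 <= K.
  rewrite mulr_ge0// addr_ge0 ?sqr_ge0// addr_ge0// mulr_ge0// mulr_ge0//.
  exact: ltW.
have I : mu.-integrable setT (EFin \o (fun y => K * (1 + sqnorm (y - x)) *
    (F y * heat_kernel t (x - y)))).
  apply: (good_weight gF t0 K0).
    apply: measurable_funM => //; apply: measurable_funD => //.
    apply: measurable_sqnorm => i; under eq_fun do rewrite !mxE.
    exact: measurable_coord_sub.
  move=> y; rewrite ger0_norm// mulr_ge0// addr_ge0//; exact: sqnormB_ge0.
have /integrableP[_] := I; apply: le_lt_trans; apply: ge0_le_integral => //.
- by move=> y _; exact: integral_ge0.
- apply: (measurable_fun_fubini_tonelli_G (fun w => `|(G w)%:E|)%E) => //.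
  by apply/measurable_EFinP; apply: measurableT_comp => //; exact: mG.
- apply/measurable_EFinP; apply: measurableT_comp => //.
  by apply/measurable_EFinP; exact: (measurable_int mu I).
move=> y _ /=.
set a := x + (s / t) *: (y - x).
have h := has_intZ c (has_int_shift_sqnorm x a r0).
have h' := has_intZ `|F y * heat_kernel t (x - y)| h.
apply: (@le_trans _ _ (\int[mu]_z (`|F y * heat_kernel t (x - y)| * (c *
   ((1 + sqnorm (z - x)) * heat_kernel (s * (t - s) / t) (a - z))))%:E)%E).
  apply: ge0_le_integral => //.
  - apply/measurable_EFinP; apply: measurableT_comp => //.
    exact: (measurableT_comp mG (pair2_measurable y)).
  - by apply/measurable_EFinP; exact: (has_int_measurable h').
  move=> z _; rewrite lee_fin GE normrM; apply: ler_wpM2l => //.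
  rewrite normrM (ger0_norm (heat_kernel_ge0 _ _)) mulrA.
  by apply: ler_wpM2r; [exact: heat_kernel_ge0|exact: pc].
rewrite h'.2 lee_fin [leRHS]normrM mulrC; apply: ler_wpM2r => //.
have -> : sqnorm (a - x) = (s / t) ^+ 2 * sqnorm (y - x).
  rewrite /a addrAC subrr add0r /sqnorm mulr_sumr; apply: eq_bigr => i _.
  by rewrite mxE exprMn.
have n0 := sqnormB_ge0 (y - x); have q0 := sqr_ge0 (s / t).
have r0' : 0 <= m%:R * (2 * (s * (t - s) / t)).
  by rewrite mulr_ge0// mulr_ge0// ltW.
rewrite ger0_norm; last by rewrite mulr_ge0// addr_ge0.
rewrite /K -[leRHS]mulrA; apply: ler_wpM2l => //.
have : 0 <= m%:R * (2 * (s * (t - s) / t)) * sqnorm (y - x) by exact: mulr_ge0.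
lra.
Qed.

(** [P y] is the mean of [p] under the bridge from [x] to [y]. The bridge identity factors the
    integrand [G], and Fubini exchanges the two integrations. *)
Lemma has_int_average : has_int mu
  (fun z => p z * heat F z (t - s) * heat_kernel s (x - z)) V.
Proof.
have E1 z : fubini_F mu (EFin \o G) z =
    (p z * heat F z (t - s) * heat_kernel s (x - z))%:E.
  rewrite /fubini_F /=.
  have [_] := has_intZ (p z * heat_kernel s (x - z)) (has_int_heat z gF ts0).
  have -> : p z * heat F z (t - s) * heat_kernel s (x - z) =
    p z * heat_kernel s (x - z) * heat F z (t - s) by ring.
  by move=> <-; apply: eq_integral => y _; congr EFin; rewrite /G /=; ring.
have E2 y : fubini_G mu (EFin \o G) y =
    (P y * (F y * heat_kernel t (x - y)))%:E.
  rewrite /fubini_G /=.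
  have [_] := has_intZ (F y * heat_kernel t (x - y)) (pP y).
  rewrite [P y * _]mulrC => <-; apply: eq_integral => z _; congr EFin.
  by rewrite GE.
split.
  by apply: eq_integrable (integrable_fubini_F GI) => // z _; rewrite E1.
rewrite -hV.2; transitivity (\int[mu]_z fubini_F mu (EFin \o G) z)%E.
  by apply: eq_integral => z _; rewrite E1.
transitivity (\int[mu]_y fubini_G mu (EFin \o G) y)%E; first exact: Fubini GI.
by apply: eq_integral => y _; rewrite -E2.
Qed.

End average.

Section averages.
Variables (F : 'rV[R]_m -> R) (x : 'rV[R]_m) (t s : R).
Hypotheses (gF : good F) (s0 : 0 < s) (st : s < t).

Let t0 : 0 < t. Proof. exact: lt_trans st. Qed.
Let r0 : 0 < s * (t - s) / t.
Proof. by rewrite divr_gt0// mulr_gt0// subr_gt0. Qed.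

Let shift i y : (x + (s / t) *: (y - x)) ord0 i - x ord0 i =
  (s / t) * (y ord0 i - x ord0 i).
Proof. by rewrite !mxE; ring. Qed.

Lemma has_int_average0 : has_int mu
  (fun z => heat F z (t - s) * heat_kernel s (x - z)) (heat F x t).
Proof.
have := @has_int_average F (fun=> 1) (fun=> 1) x t s 1 (heat F x t) gF s0 st ler01.
move=> /(_ (measurable_cst _)) h.
apply: eq_has_int (h _ _ _) => [z|z|y|]; first by rewrite mul1r.
- by rewrite normr1 mul1r lerDl sqnormB_ge0.
- by apply: eq_has_int (has_int_heat0 _ r0) => z; rewrite mul1r.
- by apply: eq_has_int (has_int_heat x gF t0) => z; rewrite mul1r.
Qed.

Lemma has_int_average1 i : has_int mu
  (fun z => (z ord0 i - x ord0 i) * heat F z (t - s) * heat_kernel s (x - z))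
  ((s / t) * heat1 F i x t).
Proof.
apply: (@has_int_average F (fun z => z ord0 i - x ord0 i)
    (fun y => (s / t) * (y ord0 i - x ord0 i)) x t s 1) => //.
- exact: measurable_coord_sub.
- by move=> z; exact: coord_le.
- by move=> y; have := has_int_shift1 x (x + (s / t) *: (y - x)) i r0; rewrite shift.
by apply: eq_has_int (has_intZ (s / t) (has_int_good1 i x gF t0)) => y; ring.
Qed.

(** The covariance of the bridge is of first order in [s], while its mean displacement
    [(s / t) (y - x)] enters squared: the second term will be an error that disappears with the time
    step. *)
Lemma has_int_average2 i j : has_int mu
  (fun z => (z ord0 i - x ord0 i) * (z ord0 j - x ord0 j) * heat F z (t - s) *
    heat_kernel s (x - z))
  ((i == j)%:R * (2 * (s * (t - s) / t)) * heat F x t +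
   (s / t) ^+ 2 * heat2 F i j x t).
Proof.
apply: (@has_int_average F
    (fun z => (z ord0 i - x ord0 i) * (z ord0 j - x ord0 j))
    (fun y => (i == j)%:R * (2 * (s * (t - s) / t)) +
      (s / t) * (y ord0 i - x ord0 i) * ((s / t) * (y ord0 j - x ord0 j)))
    x t s 1) => //.
- by apply: measurable_funM; exact: measurable_coord_sub.
- by move=> z; exact: coord2_le.
- move=> y; have := has_int_shift2 x (x + (s / t) *: (y - x)) i j r0.
  by rewrite !shift.
by apply: eq_has_int (has_intD
  (has_intZ ((i == j)%:R * (2 * (s * (t - s) / t))) (has_int_heat x gF t0))
  (has_intZ ((s / t) ^+ 2) (has_int_good2 i j x gF t0))) => y; ring.
Qed.

End averages.
End heat_extension.

(** * Heat extensions of weights *)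

Section almost_everywhere.
Context d (T : measurableType d) {R : realType}.
Variable mu : {measure set T -> \bar R}.
Implicit Types (f g : T -> R).

Lemma has_int_ge0_ae f a : has_int mu f a -> {ae mu, forall x, 0 <= f x} ->
  (\int[mu]_x `|(f x)%:E| = a%:E)%E.
Proof.
move=> fa f0; have mf := (measurable_EFinP _ _).2 (has_int_measurable fa).
rewrite -fa.2; apply: ae_eq_integral => //; first exact: measurableT_comp.
by apply: filterS f0 => x fx0 _; rewrite /= ger0_norm.
Qed.

Lemma has_int_le_ae f g a b : has_int mu f a -> has_int mu g b ->
  {ae mu, forall x, f x <= g x} -> a <= b.
Proof.
move=> fa gb fg; rewrite -subr_ge0 -lee_fin.
rewrite -(has_int_ge0_ae (has_intB gb fa)); first exact: integral_ge0.
by apply: filterS fg => x; rewrite subr_ge0.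
Qed.

Lemma has_int_gt0_ae f a : (0 < mu setT)%E -> has_int mu f a ->
  {ae mu, forall x, 0 < f x} -> 0 < a.
Proof.
move=> mu0 fa f0; have mf := (measurable_EFinP _ _).2 (has_int_measurable fa).
have f0' : {ae mu, forall x, 0 <= f x} by apply: filterS f0 => x /ltW.
have I := has_int_ge0_ae fa f0'.
rewrite lt_neqAle; apply/andP; split; last first.
  by rewrite -lee_fin -I; exact: integral_ge0.
apply/eqP => a0; rewrite -a0 in I.
have /(ae_eq_integral_abs _ measurableT mf) E := I.
(* As the space has positive measure, what holds almost everywhere holds somewhere. *)
have PF := ae_properfilter_algebraOfSetsType mu0.
have [x [fx0 fx]] := filter_ex (filterI f0 E).
by move: (fx Logic.I) => -[fxE]; rewrite fxE ltxx in fx0.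
Qed.

End almost_everywhere.

Section matrix_integral.
Context d (T : measurableType d) {R : realType}.
Local Notation C := R[i].
Variable mu : {measure set T -> \bar R}.

Definition mxint p q (w : T -> R) (F : T -> 'M[C]_(p, q)) (N : 'M[C]_(p, q)) :=
  forall i j, has_int mu (fun y => w y * complex.Re (F y i j)) (complex.Re (N i j)) /\
              has_int mu (fun y => w y * complex.Im (F y i j)) (complex.Im (N i j)).

Lemma Re_mul (x y : C) : complex.Re (x * y) =
  complex.Re x * complex.Re y - complex.Im x * complex.Im y.
Proof. by case: x y => [a b] [a' b']. Qed.

Lemma rtr_mulE p q (M : 'M[C]_(q, p)) (F : 'M[C]_(p, q)) : rtr (M *m F) =
  \sum_i \sum_j (complex.Re (M i j) * complex.Re (F j i) -
                 complex.Im (M i j) * complex.Im (F j i)).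
Proof.
rewrite /rtr /mxtrace Re_sum; apply: eq_bigr => i _; rewrite mxE Re_sum.
by apply: eq_bigr => j _; rewrite Re_mul.
Qed.

(** Real linear forms on matrices are traces against a fixed [M]; quadratic forms and inner products
    at fixed vectors are instances. *)
Lemma has_int_rtr p q (w : T -> R) F N (M : 'M[C]_(q, p)) : mxint w F N ->
  has_int mu (fun y => w y * rtr (M *m F y)) (rtr (M *m N)).
Proof.
move=> h; rewrite rtr_mulE.
apply: (@eq_has_int _ _ _ _ (fun y => \sum_i \sum_j
    (complex.Re (M i j) * (w y * complex.Re (F y j i)) -
     complex.Im (M i j) * (w y * complex.Im (F y j i))))).
  move=> y; rewrite rtr_mulE mulr_sumr; apply: eq_bigr => i _.
  by rewrite mulr_sumr; apply: eq_bigr => j _; ring.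
apply: has_int_sum => i; apply: has_int_sum => j.
by apply: has_intB; apply: has_intZ; have [] := h j i.
Qed.

End matrix_integral.

Section forms.
Context {R : realType} {d : nat}.
Local Notation C := R[i].

Lemma ip_rtr (A : 'M[C]_d) (u v : 'cV[C]_d) :
  ip (A *m u) v = rtr ((u *m v^t*) *m A).
Proof.
rewrite /ip cdotE /rtr -mulmxA mxtrace_mulC -mulmxA.
by rewrite /mxtrace big_ord1.
Qed.

Lemma ip_rtr1 (u v : 'cV[C]_d) : ip u v = rtr (v^t* *m u).
Proof. by rewrite /ip cdotE /rtr /mxtrace big_ord1. Qed.

End forms.

(** * Heat extensions of matrix functions *)

Section matrix_heat.
Context {R : realType} {m : nat}.
Local Notation C := R[i].
Local Notation mu := (@lebesgue_rV R m).
Implicit Types (x y z : 'rV[R]_m) (s t : R).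

Section size.
Variables (p q : nat) (F : 'rV[R]_m -> 'M[C]_(p, q)).

Definition mxgood := forall i j, good (fun y => complex.Re (F y i j)) /\
                                 good (fun y => complex.Im (F y i j)).

Definition mxheat1 i x t : 'M[C]_(p, q) := \matrix_(k, l)
  Complex (heat1 (fun y => complex.Re (F y k l)) i x t)
          (heat1 (fun y => complex.Im (F y k l)) i x t).

Definition mxheat2 i j x t : 'M[C]_(p, q) := \matrix_(k, l)
  Complex (heat2 (fun y => complex.Re (F y k l)) i j x t)
          (heat2 (fun y => complex.Im (F y k l)) i j x t).

Lemma Re_real_mul (r : R) (a : C) : complex.Re (a * r%:C%C) = complex.Re a * r.
Proof. by rewrite mulrC ReZ mulrC. Qed.

Lemma Im_real_mul (r : R) (a : C) : complex.Im (a * r%:C%C) = complex.Im a * r.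
Proof. by case: a => a b /=; rewrite mulr0 add0r. Qed.

Lemma heat_extE x t : heat_ext F x t = \matrix_(k, l)
  Complex (heat (fun y => complex.Re (F y k l)) x t)
          (heat (fun y => complex.Im (F y k l)) x t).
Proof.
apply/matrixP => k l; rewrite !mxE /cintegral /heat_integrand.
by congr Complex; apply: eq_Rintegral => y _; rewrite ?Re_real_mul ?Im_real_mul.
Qed.

Hypothesis gF : mxgood.

Lemma mxint_heat x t : 0 < t ->
  mxint mu (fun y => heat_kernel t (x - y)) F (heat_ext F x t).
Proof.
move=> t0 i j; have [gr gi] := gF i j; rewrite heat_extE mxE /=.
by split; [apply: eq_has_int (has_int_heat x gr t0) => y|
           apply: eq_has_int (has_int_heat x gi t0) => y]; rewrite mulrC.
Qed.

Lemma mxint_heat_average x t s : 0 < s -> s < t ->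
  mxint mu (fun z => heat_kernel s (x - z)) (fun z => heat_ext F z (t - s))
    (heat_ext F x t).
Proof.
move=> s0 st i j; have [gr gi] := gF i j; rewrite heat_extE mxE /=.
by split; [apply: eq_has_int (has_int_average0 x gr s0 st) => y|
           apply: eq_has_int (has_int_average0 x gi s0 st) => y];
  rewrite heat_extE mxE mulrC.
Qed.

Lemma mxint_heat_average1 x t s i : 0 < s -> s < t ->
  mxint mu (fun z => heat_kernel s (x - z) * (z ord0 i - x ord0 i))
    (fun z => heat_ext F z (t - s)) ((s / t)%:C%C *: mxheat1 i x t).
Proof.
move=> s0 st k l; have [gr gi] := gF k l.
rewrite !mxE mulrC Re_real_mul Im_real_mul mulrC [X in _ /\ has_int _ _ X]mulrC.
by split; [apply: eq_has_int (has_int_average1 x gr s0 st i) => y|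
           apply: eq_has_int (has_int_average1 x gi s0 st i) => y];
  rewrite heat_extE mxE /=; ring.
Qed.

Lemma mxint_heat_average2 x t s i j : 0 < s -> s < t ->
  mxint mu (fun z => heat_kernel s (x - z) *
      ((z ord0 i - x ord0 i) * (z ord0 j - x ord0 j)))
    (fun z => heat_ext F z (t - s))
    (((i == j)%:R * (2 * (s * (t - s) / t)))%:C%C *: heat_ext F x t +
     ((s / t) ^+ 2)%:C%C *: mxheat2 i j x t).
Proof.
move=> s0 st k l; have [gr gi] := gF k l.
rewrite heat_extE !mxE ![_%:C%C * _]mulrC ReD !Re_real_mul.
have ImD (a b : C) : complex.Im (a + b) = complex.Im a + complex.Im b.
  by case: a b => [? ?] [? ?].
rewrite ImD !Im_real_mul.
have := has_int_average2 x gr s0 st i j; have := has_int_average2 x gi s0 st i j.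
rewrite ![_ * heat _ _ _]mulrC ![_ * heat2 _ _ _ _ _]mulrC => hi hr.
by split; [apply: eq_has_int hr => y|apply: eq_has_int hi => y];
  rewrite heat_extE mxE /=; ring.
Qed.

End size.

(** A null measure would give the heat kernel the integral 0 instead of 1. *)
Lemma lebesgue_rV_gt0 : (0 < mu setT)%E.
Proof.
rewrite lt0e measure_ge0 andbT; apply/eqP => mu0.
have h := has_int_heat0 (0 : 'rV[R]_m) (@ltr01 R).
have : (1 : R) <= 0.
  apply: (has_int_le_ae h (has_int0 _)).
  by exists setT; split.
by rewrite ler10.
Qed.

Section weights.
Variable d : nat.
Variables (W V : 'rV[R]_m -> 'M[C]_d).
Hypotheses (gW : mxgood W) (gV : mxgood V).
Hypothesis WV : {ae mu, forall x, pd (W x) /\ V x = invmx (W x)}.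

Lemma ip_heat_has_int x t u v : 0 < t -> has_int mu
  (fun y => heat_kernel t (x - y) * ip (W y *m u) v) (ip (heat_ext W x t *m u) v).
Proof.
move=> t0; rewrite ip_rtr.
apply: eq_has_int (has_int_rtr (u *m v^t*) (mxint_heat gW x t0)) => y.
by rewrite ip_rtr.
Qed.

Lemma heat_ext_herm x t : 0 < t -> herm (heat_ext W x t).
Proof.
move=> t0; apply/matrixP => i j.
have -> : (heat_ext W x t)^t* i j = Num.conj (heat_ext W x t j i) by rewrite !mxE.
have [h1 h2] := mxint_heat gW x t0 j i; have [h3 h4] := mxint_heat gW x t0 i j.
have WH : {ae mu, forall y, W y i j = Num.conj (W y j i)}.
  apply: filterS WV => y [[hW _] _].
  by rewrite -[in LHS]hW !mxE.
have E1 : complex.Re (heat_ext W x t j i) = complex.Re (heat_ext W x t i j).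
  by apply/eqP; rewrite eq_le; apply/andP; split;
    [apply: (has_int_le_ae h1 h3)|apply: (has_int_le_ae h3 h1)];
    apply: filterS WH => y ->; rewrite ReJ.
have E2 : - complex.Im (heat_ext W x t j i) = complex.Im (heat_ext W x t i j).
  have h2' := has_intN h2.
  by apply/eqP; rewrite eq_le; apply/andP; split;
    [apply: (has_int_le_ae h2' h4)|apply: (has_int_le_ae h4 h2')];
    apply: filterS WH => y ->; case: (W y j i) => a b /=; rewrite mulrN.
move: (heat_ext W x t j i) (heat_ext W x t i j) E1 E2 => [a b] [a' b'] /= -> <-.
by [].
Qed.

Lemma heat_ext_pd x t : 0 < t -> pd (heat_ext W x t).
Proof.
move=> t0; split; first exact: heat_ext_herm.
move=> v v0; apply: (has_int_gt0_ae lebesgue_rV_gt0 (ip_heat_has_int x v v t0)).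
apply: filterS WV => y [[_ pW] _].
by rewrite mulr_gt0 ?heat_kernel_gt0// pW.
Qed.

End weights.

Section pair.
Variable d : nat.
Variables (W V : 'rV[R]_m -> 'M[C]_d).
Hypotheses (gW : mxgood W) (gV : mxgood V).
Hypothesis WV : {ae mu, forall x, pd (W x) /\ V x = invmx (W x)}.

Lemma ae_pair_sym : {ae mu, forall x, pd (V x) /\ W x = invmx (V x)}.
Proof.
apply: filterS WV => y [pW ->]; split; first exact: pd_inv.
by rewrite invmxK.
Qed.

(** Fenchel's inequality between [W y] and its inverse, averaged over [y]. With [u] the image of [v]
    under the inverse of the averaged weight it becomes the operator Jensen inequality. *)
Lemma heat_ext_dual x t u v : 0 < t ->
  2 * ip u v <= ip (heat_ext W x t *m u) u + ip (heat_ext V x t *m v) v.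
Proof.
move=> t0; have h0 := has_intZ (2 * ip u v) (has_int_heat0 x t0).
rewrite mulr1 in h0; apply: (has_int_le_ae h0 (has_intD
  (ip_heat_has_int gW x u u t0) (ip_heat_has_int gV x v v t0))).
apply: filterS WV => y [pW ->].
rewrite -mulrDr mulrC; apply: ler_wpM2l; first exact: heat_kernel_ge0.
by have := pd_fenchel v u pW; rewrite ipC; lra.
Qed.

Lemma heat_ext_jensen x t v : 0 < t ->
  ip (invmx (heat_ext W x t) *m v) v <= ip (heat_ext V x t *m v) v.
Proof.
move=> t0; have pA := heat_ext_pd gW WV x t0.
have := heat_ext_dual x (invmx (heat_ext W x t) *m v) v t0.
rewrite mulKVmx ?pd_unit// [ip v _]ipC; lra.
Qed.

(* applied with [N] the heat extension of [ip (W f) f] *)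
Lemma heat_ext_schwarz x t (f : 'rV[R]_m -> 'cV[C]_d) (N : R) : 0 < t ->
  mxgood f ->
  has_int mu (fun y => heat_kernel t (x - y) * ip (W y *m f y) (f y)) N ->
  ip (invmx (heat_ext V x t) *m heat_ext f x t) (heat_ext f x t) <= N.
Proof.
move=> t0 gf hN; have pB := heat_ext_pd gV ae_pair_sym x t0.
set B := heat_ext V x t in pB *; set u := heat_ext f x t.
pose w := invmx B *m u.
have h1 : has_int mu (fun y => heat_kernel t (x - y) * ip (f y) w) (ip u w).
  rewrite ip_rtr1; apply: eq_has_int (has_int_rtr (w^t*) (mxint_heat gf x t0)) => y.
  by rewrite ip_rtr1.
have h2 := has_intB (has_intZ 2 h1) (ip_heat_has_int gV x w w t0).
have : 2 * ip u w - ip (B *m w) w <= N.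
  apply: (has_int_le_ae h2 hN); apply: filterS WV => y [pW ->].
  rewrite mulrCA -mulrBr; apply: ler_wpM2l; first exact: heat_kernel_ge0.
  have := pd_fenchel (f y) w (pd_inv pW); rewrite invmxK; lra.
rewrite /w mulKVmx ?pd_unit// [ip u (_ *m u)]ipC; lra.
Qed.

End pair.
End matrix_heat.

(** * One time step *)

(** Meant for [g] the Bellman function times the kernel, whose integral is not known to be finite in
    advance; an infinite value is a separate case. *)
Lemma has_int_le_integral d (T : measurableType d) (R : realType)
    (mu : {measure set T -> \bar R}) (f g : T -> R) (a : R) :
  has_int mu f a -> measurable_fun setT g -> (forall x, 0 <= g x) ->
  (forall x, f x <= g x) -> (a%:E <= \int[mu]_x (g x)%:E)%E.
Proof.
move=> fa mg g0 fg.
have [gy|gy] := leP +oo%E (\int[mu]_x (g x)%:E)%E; first exact: le_trans (leey _) gy.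
have [b gb] : exists b, (\int[mu]_x (g x)%:E = b%:E)%E.
  exists (fine (\int[mu]_x (g x)%:E)%E); rewrite fineK// ge0_fin_numE//.
  by apply: integral_ge0 => x _; rewrite lee_fin.
by rewrite gb lee_fin; apply: has_int_le fa (has_int_ge0 mg g0 gb) fg.
Qed.

Section trace_differences.
Context {F : comUnitRingType} {n : nat}.
Implicit Types A B X Y : 'M[F]_n.

Lemma tr_diff_inner X Y B B0 : \tr (X *m (Y *m (B - B0) *m Y)) =
  \tr ((Y *m X *m Y) *m B) - \tr ((Y *m X *m Y) *m B0).
Proof.
have E D : \tr (X *m (Y *m D *m Y)) = \tr ((Y *m X *m Y) *m D).
  by rewrite !mulmxA mxtrace_mulC !mulmxA.
by rewrite E mulmxBr raddfB.
Qed.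

Lemma tr_diff_outer X Y A A0 : \tr ((X *m (A - A0) *m X) *m Y) =
  \tr ((X *m Y *m X) *m A) - \tr ((X *m Y *m X) *m A0).
Proof.
have E D : \tr ((X *m D *m X) *m Y) = \tr ((X *m Y *m X) *m D).
  by rewrite -(mulmxA (X *m D)) mxtrace_mulC !mulmxA.
by rewrite E mulmxBr raddfB.
Qed.

End trace_differences.

Section integral_forms.
Context d (T : measurableType d) {R : realType} (mu : {measure set T -> \bar R}).
Variables (n : nat) (w : T -> R).
Local Notation C := R[i].

Lemma has_int_form (F : T -> 'M[C]_n) N (u v : 'cV[C]_n) : mxint mu w F N ->
  has_int mu (fun z => w z * ip (F z *m u) v) (ip (N *m u) v).
Proof.
move=> h; rewrite ip_rtr; apply: eq_has_int (has_int_rtr (u *m v^t*) h) => z.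
by rewrite ip_rtr.
Qed.

Lemma has_int_ip (F : T -> 'cV[C]_n) N (v : 'cV[C]_n) : mxint mu w F N ->
  has_int mu (fun z => w z * ip (F z) v) (ip N v).
Proof.
move=> h; rewrite ip_rtr1; apply: eq_has_int (has_int_rtr (v^t*) h) => z.
by rewrite ip_rtr1.
Qed.

End integral_forms.

Section one_step.
Context {R : realType} {m d : nat}.
Local Notation C := R[i].
Local Notation mu := (@lebesgue_rV R m).
Implicit Types (x y z : 'rV[R]_m) (s t : R).

Definition flat_weights (r : R) (W V : 'rV[R]_m -> 'M[C]_d) :=
  [/\ mxgood W, mxgood V, {ae mu, forall x, pd (W x) /\ V x = invmx (W x)} &
      forall x t, 0 < t -> flat_pair r (heat_ext W x t) (heat_ext V x t)].

(** The differential is linear in increments whose averages vanish, [A0] and [B0] being the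
    means. *)
Lemma has_int_defect_diff (w : 'rV[R]_m -> R)
    (F G : 'rV[R]_m -> 'M[C]_d) (A0 B0 : 'M[C]_d) :
  has_int mu w 1 -> mxint mu w F A0 -> mxint mu w G B0 ->
  has_int mu (fun z => w z * defect_diff A0 B0 (F z) (G z)) 0.
Proof.
move=> w1 hF hG.
pose M2 := invmx B0 *m invmx A0 *m invmx B0.
pose M1 := invmx A0 *m invmx B0 *m invmx A0.
have := has_intD
  (has_intB (has_int_rtr M2 hG) (has_intZ (rtr (M2 *m B0)) w1))
  (has_intB (has_int_rtr M1 hF) (has_intZ (rtr (M1 *m A0)) w1)).
rewrite !mulr1 !subrr addr0; apply: eq_has_int => z.
have -> : defect_diff A0 B0 (F z) (G z) =
    (rtr (M2 *m G z) - rtr (M2 *m B0)) + (rtr (M1 *m F z) - rtr (M1 *m A0)).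
  congr (_ + _).
    apply: (etrans (congr1 (@complex.Re R) (tr_diff_inner (invmx A0) (invmx B0) (G z) B0))).
    by rewrite ReD ReN.
  apply: (etrans (congr1 (@complex.Re R) (tr_diff_outer (invmx A0) (invmx B0) (F z) A0))).
  by rewrite ReD ReN.
move: (rtr (M2 *m G z)) (rtr (M2 *m B0)) (rtr (M1 *m F z)) (rtr (M1 *m A0)).
by move=> a b c e; ring.
Qed.

Variables (r H e : R) (W V : 'rV[R]_m -> 'M[C]_d) (f : 'rV[R]_m -> 'cV[C]_d).
Hypotheses (r1 : 1 <= r) (r43 : r <= 4 / 3) (HE : H = d%:R * (r - 1)).
Hypotheses (H0 : 0 < H) (H1 : H <= 1 / 2048) (e0 : 0 < e).
Hypothesis eH : e ^+ 2 = 2048 * H.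
Hypothesis WV : flat_weights r W V.
Hypothesis gf : mxgood f.

Definition bell_at x t : R :=
  bell H e (heat_ext f x t) (heat_ext W x t) (heat_ext V x t).

Hypothesis mbell : forall t, 0 < t -> measurable_fun setT (bell_at ^~ t).

Lemma weight_fun_at_ge1 x t : 0 < t ->
  1 <= weight_fun H e (defect (heat_ext W x t) (heat_ext V x t)).
Proof.
move=> t0; have [_ _ _ fl] := WV.
have hH := defect_bounds r1 (fl x t t0); rewrite -HE in hH.
by have /andP[] := weight_fun_bounds H0 e0 eH hH.
Qed.

Lemma bell_at_ge0 x t : 0 < t -> 0 <= bell_at x t.
Proof.
move=> t0; have [_ _ _ fl] := WV; have [_ pB _ _] := fl x t t0.
rewrite /bell_at /bell divr_ge0//; first by have [_] := pd_psd (pd_inv pB); exact.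
exact: le_trans ler01 (weight_fun_at_ge1 x t0).
Qed.

(** The spatial derivative of [heat_ext f], written as a moment; [partial_heat_ext] identifies the
    two for test functions. *)
Definition grad i x t : 'cV[C]_d := ((2 * t)^-1)%:C%C *: mxheat1 f i x t.

Definition dual_grad i x t : 'cV[C]_d :=
  invmx (heat_ext V x t) *m grad i x t.

Definition energy x t : R := \sum_(i < m) ip (dual_grad i x t) (grad i x t).

(** The coefficient of [(s / t) ^ 2] when the form of [heat_ext V] at the test vector is averaged:
    the error of a time step. *)
Definition spread x t : R := \sum_(i < m) \sum_(j < m)
  ip (mxheat2 V i j x t *m dual_grad i x t) (dual_grad j x t).

Lemma ip_quadratic (B : 'M[C]_d) (a : 'I_m -> R) (v : 'I_m -> 'cV[C]_d) :
  ip (B *m (\sum_i (a i)%:C%C *: v i)) (\sum_i (a i)%:C%C *: v i) =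
  \sum_i \sum_j a i * a j * ip (B *m v i) (v j).
Proof.
rewrite mulmx_sumr ip_suml; apply: eq_bigr => i _.
rewrite ip_sumr; apply: eq_bigr => j _.
by rewrite -scalemxAr ipZl ipZr mulrA.
Qed.

Lemma ip_combination (u : 'cV[C]_d) (a : 'I_m -> R) (v : 'I_m -> 'cV[C]_d) :
  ip u (\sum_i (a i)%:C%C *: v i) = \sum_i a i * ip u (v i).
Proof. by rewrite ip_sumr; apply: eq_bigr => i _; rewrite ipZr. Qed.

Let one_step_arith (w k g b uc q1 q2 q3 uv bv s1 s2 bc dd bl : R) :
  s1 = 2 * w * (q1 - q2) -> s2 = w * q3 -> uv = q1 - q2 -> bv = q3 -> 0 <= w ->
  2 * uc + 2 * uv - k * bv - g * bc - b * dd <= bl ->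
  2 * (w * uc) + s1 - k * s2 - g * (w * bc) - b * (w * dd) <= bl * w.
Proof.
move=> -> -> -> -> w0 h; have := ler_wpM2l w0 h; rewrite [w * bl]mulrC.
by apply: le_trans; rewrite le_eqVlt; apply/orP; left; apply/eqP; ring.
Qed.

Let delta_mul (i j : 'I_m) (c : R) (a : 'I_m -> R) :
  (i == j)%:R * c * a i = (i == j)%:R * c * a j.
Proof. by case: eqP => [->|]; rewrite ?mul0r. Qed.

Let sum_arith (a b c p q : R) :
  2 * a * (b * c * p - b * c * q) = 2 * b * (a * c * p - a * c * q).
Proof. by ring. Qed.

(* [one_leg] tested with [v] affine in the space variable *)
Lemma bell_average x t s th : 0 < s -> s < t ->
  ((bell_at x t + 4 * th * s * energy x t - (1 + 2 * e) * th ^+ 2 *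
     (2 * (s * (t - s) / t) * energy x t + (s / t) ^+ 2 * spread x t))%:E <=
   \int[mu]_z (bell_at z (t - s) * heat_kernel s (x - z))%:E)%E.
Proof.
move=> s0 st; have t0 := lt_trans s0 st.
have ts0 : 0 < t - s by rewrite subr_gt0.
have [gW gV _ fl] := WV; have fl0 := fl x t t0.
have [_ pB0 _ _] := fl0; have [hB0 _] := pB0.
have uB0 := pd_unit pB0; have hY0 := herm_inv hB0.
pose w z := heat_kernel s (x - z).
have w1 : has_int mu w 1 by exact: has_int_heat0.
have hA := mxint_heat_average gW x s0 st; have hB := mxint_heat_average gV x s0 st.
have hu := mxint_heat_average gf x s0 st.
have hu1 i := mxint_heat_average1 gf x i s0 st.
have hB2 i j := mxint_heat_average2 gV x i j s0 st.
have leg z v := one_leg (heat_ext f z (t - s)) (heat_ext f x t) v r1 r43 HE H0 H1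
  e0 eH (fl z (t - s) ts0) fl0.
rewrite /= in leg.
pose ev i := dual_grad i x t.
have evE i : heat_ext V x t *m ev i = grad i x t by exact: mulKVmx.
have dd := has_int_defect_diff w1 hA hB.
have gE i : mxheat1 f i x t = (2 * t)%:C%C *: grad i x t.
  rewrite /grad scalerA -rmorphM /= mulfV ?scale1r// lt0r_neq0//.
  by rewrite mulr_gt0.
rewrite /bell_at; rewrite {1}/bell.
set u0 := heat_ext f x t in leg hu *.
set B0 := heat_ext V x t in leg hB hB2 dd evE pB0 hB0 uB0 hY0 *.
set A0 := heat_ext W x t in leg hA dd *.
set g := weight_fun H e (defect A0 B0) in leg *.
set c := (g^-1)%:C%C *: (invmx B0 *m u0) in leg *.
pose bt := weight_fun' H e (defect A0 B0) * ip (B0 *m c) c.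
have h1 : has_int mu (fun z => w z * ip (heat_ext f z (t - s)) c) (ip u0 c).
  exact: has_int_ip hu.
have h2 i : has_int mu (fun z => w z * (z ord0 i - x ord0 i) *
    ip (heat_ext f z (t - s)) (ev i)) (2 * s * ip (ev i) (grad i x t)).
  have -> : 2 * s * ip (ev i) (grad i x t) =
      ip ((s / t)%:C%C *: mxheat1 f i x t) (ev i).
    rewrite gE scalerA -rmorphM /= ipZl ipC; congr (_ * _).
    by field; rewrite lt0r_neq0.
  exact: has_int_ip (hu1 i).
have h3 i : has_int mu (fun z => w z * (z ord0 i - x ord0 i) * ip u0 (ev i)) 0.
  have := has_intZ (ip u0 (ev i)) (has_int_heat1 x i s0); rewrite mulr0.
  by apply: eq_has_int => z; rewrite /w; ring.
have h4 i j : has_int mu (fun z => w z * ((z ord0 i - x ord0 i) *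
    (z ord0 j - x ord0 j)) * ip (heat_ext V z (t - s) *m ev i) (ev j))
    ((i == j)%:R * (2 * (s * (t - s) / t)) * ip (ev i) (grad i x t) +
     (s / t) ^+ 2 * ip (mxheat2 V i j x t *m ev i) (ev j)).
  have -> : (i == j)%:R * (2 * (s * (t - s) / t)) * ip (ev i) (grad i x t) =
      ip (((i == j)%:R * (2 * (s * (t - s) / t)))%:C%C *: B0 *m ev i) (ev j).
    rewrite -scalemxAl ipZl evE ipC.
    exact: (delta_mul i j (2 * (s * (t - s) / t)) (fun l => ip (grad i x t) (ev l))).
  have -> : (s / t) ^+ 2 * ip (mxheat2 V i j x t *m ev i) (ev j) =
      ip (((s / t) ^+ 2)%:C%C *: mxheat2 V i j x t *m ev i) (ev j).
    by rewrite -scalemxAl ipZl.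
  rewrite -ipDl -mulmxDl; exact: has_int_form (hB2 i j).
have h5 : has_int mu (fun z => w z * ip (heat_ext V z (t - s) *m c) c)
    (ip (B0 *m c) c).
  exact: has_int_form hB.
have hv := has_intB (has_intB (has_intB (has_intD (has_intZ 2 h1)
   (has_int_sum (index_enum 'I_m) (fun i => has_intZ (2 * th) (has_intB (h2 i) (h3 i)))))
   (has_intZ (1 + 2 * e) (has_int_sum (index_enum 'I_m) (fun i =>
     has_int_sum (index_enum 'I_m) (fun j => has_intZ (th ^+ 2) (h4 i j))))))
   (has_intZ g h5)) (has_intZ bt dd).
have g0 : g != 0 := lt0r_neq0 (lt_le_trans ltr01 (weight_fun_at_ge1 x t0)).
(* The affine part takes the value of [bell] at the base point, where [c] is optimal in Fenchel's
   inequality. *)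
have E1 : 2 * ip u0 c - g * ip (B0 *m c) c = ip (invmx B0 *m u0) u0 / g.
  have -> : ip (B0 *m c) c = g^-1 * (g^-1 * ip (invmx B0 *m u0) u0).
    by rewrite /c -scalemxAr ipZl ipZr (mulKVmx uB0) [ip u0 _]ipC.
  by rewrite /c ipZr ipC; field.
have E2 : \sum_(i <- index_enum 'I_m) (2 * th * (2 * s * ip (ev i) (grad i x t) - 0)) =
    4 * th * s * energy x t.
  by rewrite /energy mulr_sumr; apply: eq_bigr => i _; rewrite /ev; ring.
have E3 : \sum_(i <- index_enum 'I_m) \sum_(j <- index_enum 'I_m) (th ^+ 2 *
   ((i == j)%:R * (2 * (s * (t - s) / t)) * ip (ev i) (grad i x t) +
     (s / t) ^+ 2 * ip (mxheat2 V i j x t *m ev i) (ev j))) =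
   th ^+ 2 * (2 * (s * (t - s) / t) * energy x t + (s / t) ^+ 2 * spread x t).
  rewrite /energy /spread !mulr_sumr -big_split mulr_sumr /=.
  apply: eq_bigr => i _; rewrite -mulr_sumr; congr (_ * _).
  rewrite big_split /= mulr_sumr; congr (_ + _).
  rewrite (bigD1 i)//= eqxx mul1r big1 ?addr0// => j; rewrite eq_sym => /negbTE ->.
  by rewrite !mul0r.
rewrite E2 E3 mulr0 subr0 in hv.
have {}hv := has_int_le_integral hv (measurable_funM (mbell ts0)
  (measurable_heat_kernelB s x)).
have -> : ip (invmx B0 *m u0) u0 / g + 4 * th * s * energy x t -
   (1 + 2 * e) * th ^+ 2 * (2 * (s * (t - s) / t) * energy x t +
     (s / t) ^+ 2 * spread x t) =
  2 * ip u0 c + 4 * th * s * energy x t - (1 + 2 * e) * (th ^+ 2 *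
    (2 * (s * (t - s) / t) * energy x t + (s / t) ^+ 2 * spread x t)) -
  g * ip (B0 *m c) c by rewrite -E1; ring.
apply: hv => [z|z]; first by rewrite mulr_ge0 ?heat_kernel_ge0 ?bell_at_ge0.
(* The best [v] in [one_leg] would be [B^-1 (u - u0) / (1 + 2 e)]. Here [u - u0] is linearised in
   space, [B] is frozen at the base point, and the scalar [th] is left free. *)
pose v : 'cV[C]_d := \sum_i (th * (z ord0 i - x ord0 i))%:C%C *: ev i.
pose q1 := \sum_i th * (z ord0 i - x ord0 i) * ip (heat_ext f z (t - s)) (ev i).
pose q2 := \sum_i th * (z ord0 i - x ord0 i) * ip u0 (ev i).
pose q3 := \sum_i \sum_j th * (z ord0 i - x ord0 i) * (th * (z ord0 j - x ord0 j)) *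
  ip (heat_ext V z (t - s) *m ev i) (ev j).
have Q1 : ip (heat_ext f z (t - s) - u0) v = q1 - q2.
  apply: (etrans (ipBl _ _ _)); congr (_ - _); exact: ip_combination.
have Q3 : ip (heat_ext V z (t - s) *m v) v = q3 by exact: ip_quadratic.
have S1 : \sum_(i <- index_enum 'I_m) (2 * th * (w z * (z ord0 i - x ord0 i) *
    ip (heat_ext f z (t - s)) (ev i) - w z * (z ord0 i - x ord0 i) * ip u0 (ev i))) =
  2 * w z * (q1 - q2).
  rewrite /q1 /q2 -sumrB mulr_sumr; apply: eq_bigr => i _.
  exact: sum_arith.
have S2 : \sum_(i <- index_enum 'I_m) \sum_(j <- index_enum 'I_m) (th ^+ 2 *
    (w z * ((z ord0 i - x ord0 i) * (z ord0 j - x ord0 j)) *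
     ip (heat_ext V z (t - s) *m ev i) (ev j))) = w z * q3.
  rewrite /q3 mulr_sumr; apply: eq_bigr => i _.
  by rewrite mulr_sumr; apply: eq_bigr => j _; ring.
exact: (one_step_arith S1 S2 Q1 Q3 (heat_kernel_ge0 s (x - z)) (leg z v)).
Qed.

End one_step.

(** * Measurability in space-time *)

Section complex_measurability.
Context d (T : measurableType d) {R : realType}.
Local Notation C := R[i].
Implicit Types h : T -> C.

Definition cmeas h := measurable_fun setT (fun w => complex.Re (h w)) /\
                      measurable_fun setT (fun w => complex.Im (h w)).

Lemma cmeas_cst c : cmeas (fun=> c).
Proof. by split; exact: measurable_cst. Qed.

Lemma cmeasD h1 h2 : cmeas h1 -> cmeas h2 -> cmeas (fun w => h1 w + h2 w).
Proof.
move=> [a b] [a' b']; split.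
  by under eq_fun do rewrite ReD; exact: measurable_funD.
rewrite (_ : (fun _ => _) = fun w => complex.Im (h1 w) + complex.Im (h2 w)).
  exact: measurable_funD.
by apply/funext => w; case: (h1 w) (h2 w) => [? ?] [? ?].
Qed.

Lemma cmeasM h1 h2 : cmeas h1 -> cmeas h2 -> cmeas (fun w => h1 w * h2 w).
Proof.
move=> [a b] [a' b']; split.
  by under eq_fun do rewrite Re_mul; apply: measurable_funB; exact: measurable_funM.
rewrite (_ : (fun _ => _) = fun w => complex.Re (h1 w) * complex.Im (h2 w) +
    complex.Im (h1 w) * complex.Re (h2 w)).
  by apply: measurable_funD; exact: measurable_funM.
by apply/funext => w; case: (h1 w) (h2 w) => [? ?] [? ?].
Qed.

Lemma cmeasJ h : cmeas h -> cmeas (fun w => Num.conj (h w)).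
Proof.
move=> [a b]; split; first by under eq_fun do rewrite ReJ.
rewrite (_ : (fun _ => _) = fun w => - complex.Im (h w)).
  exact: measurableT_comp.
by apply/funext => w; case: (h w) => ? ?.
Qed.

Lemma cmeasV h : cmeas h -> cmeas (fun w => (h w)^-1).
Proof.
move=> [a b]; have mn : measurable_fun setT (fun w =>
    (complex.Re (h w) ^+ 2 + complex.Im (h w) ^+ 2)^-1).
  apply: measurable_fun_inv.
  by apply: measurable_funD; exact: measurable_funX.
split.
  rewrite (_ : (fun _ => _) = fun w => complex.Re (h w) *
      (complex.Re (h w) ^+ 2 + complex.Im (h w) ^+ 2)^-1).
    exact: measurable_funM.
  by apply/funext => w; case: (h w) => ? ?.
rewrite (_ : (fun _ => _) = fun w => - (complex.Im (h w) *
    (complex.Re (h w) ^+ 2 + complex.Im (h w) ^+ 2)^-1)).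
  by apply: measurableT_comp => //; exact: measurable_funM.
by apply/funext => w; case: (h w) => ? ? /=.
Qed.

Lemma cmeas_sum (I : Type) (s : seq I) (h : I -> T -> C) :
  (forall i, cmeas (h i)) -> cmeas (fun w => \sum_(i <- s) h i w).
Proof.
move=> mh; elim: s => [|i s IH].
  by under eq_fun do rewrite big_nil; exact: cmeas_cst.
by under eq_fun do rewrite big_cons; exact: cmeasD.
Qed.

Lemma cmeas_prod (I : Type) (s : seq I) (h : I -> T -> C) :
  (forall i, cmeas (h i)) -> cmeas (fun w => \prod_(i <- s) h i w).
Proof.
move=> mh; elim: s => [|i s IH].
  by under eq_fun do rewrite big_nil; exact: cmeas_cst.
by under eq_fun do rewrite big_cons; exact: cmeasM.
Qed.

Definition mxmeas p q (F : T -> 'M[C]_(p, q)) := forall i j, cmeas (fun w => F w i j).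

Lemma mxmeas_mul p q r (F : T -> 'M[C]_(p, q)) (G : T -> 'M[C]_(q, r)) :
  mxmeas F -> mxmeas G -> mxmeas (fun w => F w *m G w).
Proof.
move=> mF mG i j; under eq_fun do rewrite mxE.
by apply: cmeas_sum => k; exact: cmeasM.
Qed.

Lemma mxmeas_scale p q (a : T -> C) (F : T -> 'M[C]_(p, q)) :
  cmeas a -> mxmeas F -> mxmeas (fun w => a w *: F w).
Proof. by move=> ma mF i j; under eq_fun do rewrite mxE; exact: cmeasM. Qed.

Lemma cmeas_det n (F : T -> 'M[C]_n) : mxmeas F -> cmeas (fun w => \det (F w)).
Proof.
move=> mF; apply: cmeas_sum => s; apply: cmeasM; first exact: cmeas_cst.
by apply: cmeas_prod => i; exact: mF.
Qed.

(* unlike [invmx], a measurable function of the entries on all matrices *)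
Definition cramer n (A : 'M[C]_n) : 'M[C]_n := (\det A)^-1 *: \adj A.

Lemma cramerE n (A : 'M[C]_n) : A \in unitmx -> cramer A = invmx A.
Proof. by move=> uA; rewrite /cramer /invmx uA. Qed.

Lemma mxmeas_cramer n (F : T -> 'M[C]_n) : mxmeas F -> mxmeas (fun w => cramer (F w)).
Proof.
move=> mF; apply: mxmeas_scale; first by apply: cmeasV; exact: cmeas_det.
move=> i j; under eq_fun do rewrite mxE.
apply: cmeasM; first exact: cmeas_cst.
by apply: cmeas_det => k l; under eq_fun do rewrite !mxE; exact: mF.
Qed.

Lemma measurable_ip n (u v : T -> 'cV[C]_n) : mxmeas u -> mxmeas v ->
  measurable_fun setT (fun w => ip (u w) (v w)).
Proof.
move=> mu mv; have [] // : cmeas (fun w => cdot (u w) (v w)).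
by apply: cmeas_sum => k; apply: cmeasM; [exact: mu|apply: cmeasJ; exact: mv].
Qed.

Lemma measurable_rtr n (F : T -> 'M[C]_n) : mxmeas F ->
  measurable_fun setT (fun w => rtr (F w)).
Proof.
move=> mF; have [] // : cmeas (fun w => \tr (F w)).
by apply: cmeas_sum => k; exact: mF.
Qed.

Lemma measurable_form n (A : T -> 'M[C]_n) (u : T -> 'cV[C]_n) : mxmeas A ->
  mxmeas u -> measurable_fun setT (fun w => ip (A w *m u w) (u w)).
Proof. by move=> mA mu; apply: measurable_ip => //; exact: mxmeas_mul. Qed.

(** Invertibility at every point allows [cramer] to replace [invmx]. *)
Lemma measurable_bell n (H e : R) (u : T -> 'cV[C]_n) (A B : T -> 'M[C]_n) :
  mxmeas u -> mxmeas A -> mxmeas B -> (forall w, A w \in unitmx) ->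
  (forall w, B w \in unitmx) ->
  measurable_fun setT (fun w => bell H e (u w) (A w) (B w)).
Proof.
move=> mu mA mB uA uB.
rewrite /bell /defect; under eq_fun do rewrite -!cramerE//.
have mBi := mxmeas_cramer mB; have mAi := mxmeas_cramer mA.
have md : measurable_fun setT (fun w => n%:R - rtr (cramer (A w) *m cramer (B w))).
  by apply: measurable_funB => //; apply: measurable_rtr; exact: mxmeas_mul.
apply: (measurable_funM (measurable_form mBi mu)).
apply: measurable_fun_inv; apply: measurable_funB.
  by apply: measurable_funD => //; exact: measurable_funM.
by apply: measurable_funM => //; exact: measurable_funX.
Qed.

End complex_measurability.

(** * Integrals depending on a parameter *)

Section parametric_integrals.
Context {R : realType} {m : nat} d (T : measurableType d).
Local Notation C := R[i].
Local Notation mu := (@lebesgue_rV R m).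

(** Positive and negative parts are measurable in the parameter by Tonelli. Points where the
    integral diverges are covered as well, [fine] being measurable on all extended reals. *)
Lemma measurable_Rintegral (h : T * 'rV[R]_m -> R) : measurable_fun setT h ->
  measurable_fun setT (fun p => \int[mu]_y h (p, y)).
Proof.
move=> mh; have mh' := (measurable_EFinP _ _).2 mh.
apply: (measurableT_comp (fine_measurable measurableT)).
have m1 := measurable_fun_fubini_tonelli_F (m2 := mu) ((EFin \o h)^\+)%E
  (measurable_funepos mh') (funepos_ge0 _).
have m2 := measurable_fun_fubini_tonelli_F (m2 := mu) ((EFin \o h)^\-)%E
  (measurable_funeneg mh') (funeneg_ge0 _).
rewrite (_ : (fun _ => _) = (fubini_F mu ((EFin \o h)^\+) \-
    fubini_F mu ((EFin \o h)^\-))%E); first exact: (emeasurable_funB m1 m2).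
apply/funext => p; rewrite [LHS]integralE /fubini_F.
by congr (_ - _)%E; apply: eq_integral => y _; rewrite ?funeposE ?funenegE.
Qed.

Variables (X : T -> 'rV[R]_m) (tau : T -> R).
Hypotheses (mX : forall i, measurable_fun setT (fun p => X p ord0 i)).
Hypothesis mtau : measurable_fun setT tau.

Let mker (F : 'rV[R]_m -> R) : measurable_fun setT F ->
  measurable_fun setT (fun w : T * 'rV[R]_m =>
    F w.2 * heat_kernel (tau w.1) (X w.1 - w.2)).
Proof.
move=> mF; apply: measurable_funM; first exact: (measurableT_comp mF measurable_snd).
apply: measurable_heat_kernel; first exact: (measurableT_comp mtau measurable_fst).
move=> i; under eq_fun do rewrite !mxE; apply: measurable_funB.
  exact: (measurableT_comp (mX i) measurable_fst).
exact: (measurableT_comp (measurable_rV_coord i) measurable_snd).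
Qed.

Let mdiff i : measurable_fun setT (fun w : T * 'rV[R]_m =>
  w.2 ord0 i - X w.1 ord0 i).
Proof.
apply: measurable_funB.
  exact: (measurableT_comp (measurable_rV_coord i) measurable_snd).
exact: (measurableT_comp (mX i) measurable_fst).
Qed.

Lemma measurable_heat F : measurable_fun setT F ->
  measurable_fun setT (fun p => heat F (X p) (tau p)).
Proof. by move=> mF; exact: (measurable_Rintegral (mker mF)). Qed.

Lemma measurable_heat1 F i : measurable_fun setT F ->
  measurable_fun setT (fun p => heat1 F i (X p) (tau p)).
Proof.
by move=> mF; exact: (measurable_Rintegral (measurable_funM (mdiff i) (mker mF))).
Qed.

Lemma measurable_heat2 F i j : measurable_fun setT F ->
  measurable_fun setT (fun p => heat2 F i j (X p) (tau p)).
Proof.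
by move=> mF; exact: (measurable_Rintegral (measurable_funM
  (measurable_funM (mdiff i) (mdiff j)) (mker mF))).
Qed.

Variables (p q : nat) (F : 'rV[R]_m -> 'M[C]_(p, q)).
Hypothesis gF : mxgood F.

Lemma mxmeas_heat_ext : mxmeas (fun w => heat_ext F (X w) (tau w)).
Proof.
move=> k l; under eq_fun do rewrite heat_extE mxE.
have [[mr _] [mi _]] := gF k l.
by split; exact: measurable_heat.
Qed.

Lemma mxmeas_mxheat1 i : mxmeas (fun w => mxheat1 F i (X w) (tau w)).
Proof.
move=> k l; under eq_fun do rewrite mxE.
have [[mr _] [mi _]] := gF k l.
by split; exact: measurable_heat1.
Qed.

Lemma mxmeas_mxheat2 i j : mxmeas (fun w => mxheat2 F i j (X w) (tau w)).
Proof.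
move=> k l; under eq_fun do rewrite mxE.
have [[mr _] [mi _]] := gF k l.
by split; exact: measurable_heat2.
Qed.

End parametric_integrals.

(** * The energy estimate *)

Section telescoping.
Context {R : realType}.
Local Notation leb := (@lebesgue_measure R).
Local Open Scope ereal_scope.

Lemma measurable_fun_between (i : interval R) (G : R -> \bar R) :
  measurable_fun setT G ->
  measurable_fun setT (fun t => if t \in i then G t else 0).
Proof.
move=> mG; rewrite (_ : (fun _ => _) = G \_ [set` i]).
  by apply/(measurable_restrictT _ _).1 => //; exact: measurable_funTS.
apply/funext => t; rewrite /patch; case: ifPn => ti; last first.
  by rewrite ifF//; apply/negbTE; apply: contra ti => /set_mem.
by rewrite ifT//; exact/mem_set.
Qed.

Lemma integral_le_cst_itv (a b N : R) (i : interval R) (G : R -> \bar R) :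
  (a <= b)%R -> (forall t, t \in i -> t \in `[a, b]) ->
  measurable_fun setT G -> (forall t, 0 <= G t) ->
  (0 <= N)%R -> (forall t, t \in i -> G t <= N%:E) ->
  \int[leb]_t (if t \in i then G t else 0) <= (N * (b - a))%:E.
Proof.
move=> ab iab mG G0 N0 GN.
apply: (@le_trans _ _ (\int[leb]_(t in `[a, b]) N%:E)); last first.
  rewrite integral_cst//= lebesgue_measure_itv/= lte_fin.
  by case: ltP => // ba; rewrite mule0 lee_fin mulr_ge0// subr_ge0.
rewrite [leRHS]integral_mkcond; apply: ge0_le_integral => //.
- by move=> t _; case: ifP.
- exact: measurable_fun_between.
- by apply/(measurable_restrictT _ _).1.
move=> t _; rewrite patchE; case: ifPn => ti.
  by rewrite ifT ?GN//; apply/mem_set/iab.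
by case: ifP => //; rewrite lee_fin.
Qed.

(* Integrating [G t + K t <= G (t - s)] over [s < t < T] leaves on the right
   only the integral of [G] over [0 < t <= s]. *)
Lemma telescoping_bound (G K : R -> \bar R) (N s T : R) :
  measurable_fun setT G -> measurable_fun setT K ->
  (forall t, 0 <= G t) -> (forall t, 0 <= K t) -> (0 < s)%R -> (0 <= N)%R ->
  (forall t, (0 < t)%R -> G t <= N%:E) ->
  (forall t, (s < t)%R -> G t + K t <= G (t - s)%R) ->
  (forall t, t \notin `]s, T[ -> K t = 0) ->
  \int[leb]_t K t <= (N * s)%:E.
Proof.
move=> mG mK G0 K0 s0 N0 GN GK KT.
have [Ts|sT] := leP T s.
  rewrite (_ : K = fun=> 0).
    by rewrite integral0 lee_fin mulr_ge0// ltW.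
  apply/funext => t; apply: KT; rewrite in_itv /=; apply/negP => /andP[st tT].
  by have := lt_trans st tT; rewrite ltNge Ts.
pose a t := if t \in `]s, T[ then G t else 0.
pose b t := if t \in `]0%R, s] then G t else 0.
pose c t := if t \in `]0%R, (T - s)%R[ then G t else 0.
have [ma [mb mc]] : measurable_fun setT a /\ measurable_fun setT b /\
    measurable_fun setT c.
  by split; [|split]; exact: measurable_fun_between.
have [a0 [b0 c0]] : (forall t, 0 <= a t) /\ (forall t, 0 <= b t) /\
    (forall t, 0 <= c t).
  by split; [|split]; move=> t; rewrite /a /b /c; case: ifP.
have T0 := lt_trans s0 sT.
have Ia : \int[leb]_t a t <= (N * (T - 0))%:E.
  apply: integral_le_cst_itv => //; first exact: ltW.
  - move=> t; rewrite !in_itv /= => /andP[st tT].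
    by rewrite (ltW tT) (ltW (lt_trans s0 st)).
  - by move=> t; rewrite in_itv /= => /andP[st _]; apply: GN; exact: lt_trans st.
have Ib : \int[leb]_t b t <= (N * s)%:E.
  rewrite -[X in (N * X)%R](subr0 s); apply: integral_le_cst_itv => //; first exact: ltW.
  - by move=> t; rewrite !in_itv /= => /andP[/ltW -> ->].
  - by move=> t; rewrite in_itv /= => /andP[t0 _]; exact: GN.
have Kac t : K t + a t <= c (t - s)%R.
  rewrite /a /c; case: ifPn => [|ts]; rewrite in_itv /=.
    move=> /andP[st tT]; rewrite in_itv /= subr_gt0 st ltrD2r tT /=.
    by rewrite addeC; exact: GK.
  by rewrite KT// adde0; case: ifP.
(* The interval []0, T - s[] is covered by []s, T[] and []0, s]]. *)
have cab t : c t <= a t + b t.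
  rewrite /a /b /c !in_itv /=; case: ifPn => [/andP[t0 tT]|_]; last first.
    by apply: adde_ge0; case: ifP.
  have tT' : (t < T)%R by apply: lt_trans tT _; rewrite ltrBlDr ltrDl.
  rewrite t0 tT'; case: (ltP s t) => _ /=; first by rewrite adde0.
  by rewrite add0e.
have I1 : \int[leb]_t K t + \int[leb]_t a t <= \int[leb]_t c t.
  rewrite -ge0_integralD// -(ge0_integral_translate (- s) mc c0).
  apply: ge0_le_integral => //.
  - by move=> t _; exact: adde_ge0.
  - exact: emeasurable_funD.
  - by apply: (measurableT_comp mc); exact: measurable_funD.
have I2 : \int[leb]_t c t <= \int[leb]_t a t + \int[leb]_t b t.
  rewrite -ge0_integralD//; apply: ge0_le_integral => //.
  exact: emeasurable_funD.
have I3 := le_trans I1 I2.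
(* The integral of [a] is to be cancelled on both sides, so it must be finite; the cut at [T]
   ensures this. *)
have afin : \int[leb]_t a t \is a fin_num.
  rewrite ge0_fin_numE; last by apply: integral_ge0 => t _; exact: a0.
  by apply: le_lt_trans Ia _; rewrite ltry.
rewrite addeC leeD2lE// in I3.
exact: le_trans I3 Ib.
Qed.

End telescoping.

(** * Letting the time step tend to zero *)

Section truncated_convergence.
Context d (T : measurableType d) {R : realType}.
Variable mu : {measure set T -> \bar R}.
Variables (tau E M : T -> R) (c : R).
Hypotheses (mtau : measurable_fun setT tau) (mE : measurable_fun setT E).
Hypothesis mM : measurable_fun setT M.
Hypotheses (M0 : forall p, 0 <= M p) (E0 : forall p, 0 < tau p -> 0 <= E p).

(** The energy minus the error of a step of length [s], replaced by 0 where this is negative and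
    outside bounded times. It increases when [s] decreases and [L] grows, so monotone convergence
    along [s = 1 / (n + 1)], [L = n + 1] recovers [E]. *)
Definition truncated (s L : R) p : R := if tau p \in `]s, L[ then
  Num.max 0 (E p - s / (2 * tau p ^+ 2) * M p) else 0.

Lemma measurable_truncated s L : measurable_fun setT (truncated s L).
Proof.
apply: measurable_fun_ifT => //.
- rewrite (_ : (fun _ => _) = fun p => (s < tau p) && (tau p < L)).
    by apply: measurable_and; apply: measurable_fun_ltr.
  by apply/funext => p; rewrite in_itv.
- apply: measurable_maxr => //; apply: measurable_funB => //.
  apply: measurable_funM => //; apply: measurable_funM => //.
  apply: measurable_fun_inv; apply: measurable_funM => //.
  exact: measurable_funX.
Qed.

Lemma truncated_ge0 s L p : 0 <= truncated s L p.
Proof. by rewrite /truncated; case: ifP => // _; rewrite le_max lexx. Qed.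

Lemma truncated_bound :
  (forall n : nat, (\int[mu]_p (truncated n.+1%:R^-1 n.+1%:R p)%:E <= c%:E)%E) ->
  (\int[mu]_(p in [set p | (0 < tau p)%R]) (E p)%:E <= c%:E)%E.
Proof.
move=> H; pose h n p := (truncated n.+1%:R^-1 n.+1%:R p)%:E.
pose F p := if 0 < tau p then E p else 0.
have nd p : nondecreasing_seq (h ^~ p).
  move=> i j ij; rewrite lee_fin /truncated !in_itv /=.
  have ij' : (i.+1%:R : R) <= j.+1%:R by rewrite ler_nat ltnS.
  have ji' : (j.+1%:R : R)^-1 <= i.+1%:R^-1 by rewrite lef_pV2 ?posrE.
  case: ifPn => [/andP[it ti]|_]; last by case: ifP => // _; rewrite le_max lexx.
  rewrite (le_lt_trans ji' it) (lt_le_trans ti ij') /=.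
  rewrite ge_max le_max lexx /= le_max; apply/orP; right.
  rewrite lerB// ler_wpM2r// ler_wpM2r// invr_ge0.
  by rewrite mulr_ge0// sqr_ge0.
have cv p : h n p @[n --> \oo] --> (F p)%:E.
  rewrite /F; case: ifPn => t0; last first.
    rewrite (_ : h ^~ p = fun=> 0%:E); first exact: cvg_cst.
    apply/funext => n; rewrite /h /truncated in_itv /= ifF//.
    apply/negbTE; apply: contra t0 => /andP[nt _].
    by apply: le_lt_trans nt; rewrite invr_ge0.
  apply: cvg_EFin; first exact: nearW.
  pose k n := Num.max 0 (E p - n.+1%:R^-1 / (2 * tau p ^+ 2) * M p).
  have kE : k n @[n --> \oo] --> E p.
    have e1 : (E p - n.+1%:R^-1 / (2 * tau p ^+ 2) * M p) @[n --> \oo] -->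
        E p - 0 / (2 * tau p ^+ 2) * M p.
      apply: cvgB; first exact: cvg_cst.
      apply: cvgM; last exact: cvg_cst.
      apply: cvgM; last exact: cvg_cst.
      exact: cvg_harmonic.
    rewrite mul0r mul0r subr0 in e1.
    apply/cvgrPdist_lt => eps eps0.
    move/cvgrPdist_lt : e1 => /(_ _ eps0); apply: filterS => n.
    rewrite /k; move: (_ - _ * _) => w; have := E0 t0.
    rewrite !ltr_norml /Num.max; case: ifP => w0; first by [].
    move=> Ep /andP[h1 h2]; move/negbT: w0; rewrite -leNgt => w0.
    by rewrite subr0; apply/andP; split; lra.
  apply: cvg_trans kE; apply: near_eq_cvg.
  have [n1 Hn1] : exists n1 : nat, tau p < n1%:R.
    by exists (Num.truncn (tau p)).+1; exact: truncnS_gt.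
  have [n2 Hn2] : exists n2 : nat, (tau p)^-1 < n2%:R.
    by exists (Num.truncn (tau p)^-1).+1; exact: truncnS_gt.
  near=> n.
  rewrite /k /h /= /truncated in_itv /= ifT//; apply/andP; split.
    rewrite invf_plt ?posrE//; apply: lt_le_trans Hn2 _.
    rewrite ler_nat; near: n; exists n2 => // i /= ni; exact: leq_trans ni _.
  apply: lt_le_trans Hn1 _.
  rewrite ler_nat; near: n; exists n1 => // i /= ni; exact: leq_trans ni _.
have := @cvg_monotone_convergence _ _ _ mu setT measurableT h
  (fun n => (measurable_EFinP _ _).2 (measurable_truncated _ _))
  (fun n p _ => truncated_ge0 _ _ p) (fun p _ => nd p).
have -> : (fun p => limn (h ^~ p)) = EFin \o F.
  by apply/funext => p; apply/cvg_lim => //; exact: cv.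
move=> cvI.
have -> : (\int[mu]_(p in [set p | (0 < tau p)%R]) (E p)%:E =
    \int[mu]_p (EFin \o F) p)%E.
  rewrite integral_mkcond; apply: eq_integral => p _.
  rewrite patchE /F /=; case: ifPn => [/set_mem /= ->//|].
  by rewrite notin_setE /= => /negP/negbTE ->.
rewrite -(cvg_lim _ cvI)//; apply: lime_le; first by apply/cvg_ex; eexists; exact: cvI.
by apply: nearW => n; exact: H.
Unshelve. all: by end_near.
Qed.

End truncated_convergence.

(** * Conservation of mass by the heat flow *)

Section mass.
Context {R : realType} {m : nat}.
Local Notation mu := (@lebesgue_rV R m).
Implicit Types (x y z : 'rV[R]_m) (s t : R) (b q : 'rV[R]_m -> R).

(** Tonelli, the mass of the kernel being computed in its other variable. *)
Lemma heat_average_mass b s : 0 < s -> measurable_fun setT b ->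
  (forall z, 0 <= b z) ->
  (\int[mu]_x \int[mu]_z (b z * heat_kernel s (x - z))%:E =
   \int[mu]_z (b z)%:E)%E.
Proof.
move=> s0 mb b0.
pose G (w : 'rV[R]_m * 'rV[R]_m) := (b w.2 * heat_kernel s (w.1 - w.2))%:E.
have mG : measurable_fun setT G.
  apply/measurable_EFinP; apply: measurable_funM.
    exact: (measurableT_comp mb measurable_snd).
  apply: measurable_heat_kernel => // i; under eq_fun do rewrite !mxE.
  by apply: measurable_funB; [exact: (measurableT_comp (measurable_rV_coord i)
    measurable_fst)|exact: (measurableT_comp (measurable_rV_coord i) measurable_snd)].
have G0 w : (0 <= G w)%E by rewrite lee_fin mulr_ge0// heat_kernel_ge0.
have := @fubini_tonelli1 _ _ _ _ _ mu mu G mG G0.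
rewrite (@fubini_tonelli2 _ _ _ _ _ mu mu G mG G0).
rewrite /fubini_F /fubini_G /= => <-; apply: eq_integral => z _.
have [_] := has_intZ (b z) (has_int_heat0 z s0).
rewrite mulr1 => <-; apply: eq_integral => x _.
by rewrite /G /= heat_kernelC.
Qed.

Lemma heat_kernel_le t z : 0 < t ->
  heat_kernel t z <= ((4 * pi * t) `^ (m%:R / 2))^-1.
Proof.
move=> t0; rewrite /heat_kernel -[leRHS]mulr1; apply: ler_wpM2l.
  by rewrite invr_ge0 powR_ge0.
by rewrite -expR0 ler_expR oppr_le0 divr_ge0 ?sqnormB_ge0// mulr_ge0// ltW.
Qed.

(** At a fixed time the kernel is bounded by its value at the origin. *)
Lemma has_int_good q N : has_int mu q N -> good q.
Proof.
move=> qN; split=> [|x t t0]; first exact: has_int_measurable qN.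
have [I _] := has_intZ ((4 * pi * t) `^ (m%:R / 2))^-1
  (has_int_Rintegral (integrable_norm qN.1)).
apply: le_integrable I => //.
  apply/measurable_EFinP; apply: measurable_funM; first exact: has_int_measurable qN.
  exact: measurable_heat_kernelB.
move=> y _ /=; rewrite lee_fin !normrM mulrC normr_id; apply: ler_wpM2r => //.
rewrite !ger0_norm ?heat_kernel_ge0 ?invr_ge0 ?powR_ge0//.
exact: heat_kernel_le.
Qed.

End mass.

Section energy_estimate.
Context {R : realType} {m d : nat}.
Local Notation C := R[i].
Local Notation mu := (@lebesgue_rV R m).
Local Notation leb := (@lebesgue_measure R).
Implicit Types (x y z : 'rV[R]_m) (s t : R).

Variables (r H e N : R) (W V : 'rV[R]_m -> 'M[C]_d) (f : 'rV[R]_m -> 'cV[C]_d).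
Hypotheses (r1 : 1 <= r) (r43 : r <= 4 / 3) (HE : H = d%:R * (r - 1)).
Hypotheses (H0 : 0 < H) (H1 : H <= 1 / 2048) (e0 : 0 < e).
Hypothesis eH : e ^+ 2 = 2048 * H.
Hypothesis WV : flat_weights r W V.
Hypothesis gf : mxgood f.
Hypothesis fN : has_int mu (fun y => ip (W y *m f y) (f y)) N.

Local Notation bell_at := (bell_at H e W V f).
Local Notation energy := (energy V f).
Local Notation spread := (spread V f).

Let gW : mxgood W. Proof. by have [] := WV. Qed.
Let gV : mxgood V. Proof. by have [] := WV. Qed.

(** The identity is the default value at nonpositive times: the matrix stays invertible on the whole
    product space, as [measurable_bell] asks. *)
Let extended (F : 'rV[R]_m -> 'M[C]_d) (p : 'rV[R]_m * measurableTypeR R) :=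
  if 0 < p.2 then heat_ext F p.1 p.2 else 1%:M.

Let mx1 i : measurable_fun setT
  (fun p : 'rV[R]_m * measurableTypeR R => p.1 ord0 i).
Proof. exact: (measurableT_comp (measurable_rV_coord i) measurable_fst). Qed.

Let mt : measurable_fun setT (fun p : 'rV[R]_m * measurableTypeR R => p.2 : R).
Proof. exact: measurable_snd. Qed.

Let mt0 : measurable_fun setT (fun p : 'rV[R]_m * measurableTypeR R => 0 < (p.2 : R)).
Proof. exact: measurable_fun_ltr. Qed.

Let mxmeas_extended F : mxgood F -> mxmeas (extended F).
Proof.
move=> gF k l; have [mr mi] := mxmeas_heat_ext mx1 mt gF k l; rewrite /extended.
split.
  rewrite (_ : (fun _ => _) = fun p : 'rV[R]_m * measurableTypeR R => if 0 < p.2 then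
     complex.Re (heat_ext F p.1 p.2 k l) else complex.Re ((1%:M : 'M[C]_d) k l)).
    exact: measurable_fun_ifT.
  by apply/funext => p; case: ifP.
rewrite (_ : (fun _ => _) = fun p : 'rV[R]_m * measurableTypeR R => if 0 < p.2 then
   complex.Im (heat_ext F p.1 p.2 k l) else complex.Im ((1%:M : 'M[C]_d) k l)).
  exact: measurable_fun_ifT.
by apply/funext => p; case: ifP.
Qed.

Let unit_extended p : extended W p \in unitmx /\ extended V p \in unitmx.
Proof.
rewrite /extended; case: ifP => p0; last by split; exact: unitmx1.
have [_ _ _ fl] := WV; have [pA pB _ _] := fl p.1 p.2 p0.
by split; exact: pd_unit.
Qed.

Lemma measurable_bell_at : measurable_fun setT
  (fun p : 'rV[R]_m * measurableTypeR R => if 0 < p.2 then bell_at p.1 p.2 else 0).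
Proof.
have mb := measurable_bell H e (mxmeas_heat_ext mx1 mt gf) (mxmeas_extended gW)
  (mxmeas_extended gV) (fun p => (unit_extended p).1) (fun p => (unit_extended p).2).
rewrite (_ : (fun _ => _) = fun p : 'rV[R]_m * measurableTypeR R => if 0 < p.2 then
    bell H e (heat_ext f p.1 p.2) (extended W p) (extended V p) else 0).
  exact: measurable_fun_ifT.
by apply/funext => p; rewrite /extended; case: (0 < p.2); exact: erefl.
Qed.

Let mbell t : 0 < t -> measurable_fun setT (bell_at ^~ t).
Proof.
move=> t0; have := measurableT_comp measurable_bell_at (pair2_measurable t).
congr measurable_fun; apply/funext => x /=; by rewrite t0.
Qed.

Let mxmeas_grad i : mxmeas (fun p : 'rV[R]_m * measurableTypeR R => grad f i p.1 p.2).
Proof.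
rewrite /grad; apply: mxmeas_scale; last exact: (mxmeas_mxheat1 mx1 mt gf).
split => //=; apply: measurable_fun_inv; exact: measurable_funM.
Qed.

Let mxmeas_dual_grad i : mxmeas (fun p : 'rV[R]_m * measurableTypeR R =>
  cramer (extended V p) *m grad f i p.1 p.2).
Proof.
apply: mxmeas_mul; last exact: mxmeas_grad.
by apply: mxmeas_cramer; exact: mxmeas_extended.
Qed.

Let cramer_extended i (p : 'rV[R]_m * measurableTypeR R) : 0 < p.2 ->
  cramer (extended V p) *m grad f i p.1 p.2 = dual_grad V f i p.1 p.2.
Proof.
move=> p0; rewrite cramerE; last exact: (unit_extended p).2.
by rewrite /dual_grad /extended p0.
Qed.

Lemma measurable_energy : measurable_fun setT
  (fun p : 'rV[R]_m * measurableTypeR R => if 0 < p.2 then energy p.1 p.2 else 0).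
Proof.
have mE : measurable_fun setT (fun p : 'rV[R]_m * measurableTypeR R =>
    \sum_(i < m) ip (cramer (extended V p) *m grad f i p.1 p.2) (grad f i p.1 p.2)).
  by apply: measurable_sum => i; apply: measurable_ip.
rewrite (_ : (fun _ => _) = fun p : 'rV[R]_m * measurableTypeR R => if 0 < p.2 then
    \sum_(i < m) ip (cramer (extended V p) *m grad f i p.1 p.2) (grad f i p.1 p.2)
    else 0); first exact: measurable_fun_ifT.
apply/funext => p; case p0: (0 < p.2); last exact: erefl.
rewrite /energy; apply: eq_bigr => i _.
by rewrite cramer_extended.
Qed.

Lemma measurable_spread : measurable_fun setT
  (fun p : 'rV[R]_m * measurableTypeR R => if 0 < p.2 then `|spread p.1 p.2| else 0).
Proof.
have mE : measurable_fun setT (fun p : 'rV[R]_m * measurableTypeR R =>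
    `|\sum_(i < m) \sum_(j < m) ip (mxheat2 V i j p.1 p.2 *m
      (cramer (extended V p) *m grad f i p.1 p.2))
      (cramer (extended V p) *m grad f j p.1 p.2)|).
  apply: measurableT_comp => //.
  apply: measurable_sum => i; apply: measurable_sum => j; apply: measurable_ip => //.
  by apply: mxmeas_mul => //; exact: (mxmeas_mxheat2 mx1 mt gV).
have := measurable_fun_ifT mt0 mE (measurable_cst (0 : R)).
congr measurable_fun; apply/funext => p; case p0: (0 < p.2); last exact: erefl.
rewrite /spread; congr `|_|; apply: eq_bigr => i _.
by apply: eq_bigr => j _; rewrite !cramer_extended.
Qed.

Let q y := ip (W y *m f y) (f y).

Let q0 : {ae mu, forall y, 0 <= q y}.
Proof.
have [_ _ WVi _] := WV; apply: filterS WVi => y [pW _].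
by have [_] := pd_psd pW; exact.
Qed.

Let N0 : 0 <= N.
Proof.
by rewrite -lee_fin -(has_int_ge0_ae fN q0); exact: integral_ge0.
Qed.

(** The weight function is at least 1, so [bell_at] lies below the heat extension of [q] by
    [heat_ext_schwarz], and the heat flow preserves mass. Absolute values appear because [q] is
    nonnegative only almost everywhere. *)
Lemma bell_at_mass t : 0 < t -> (\int[mu]_x (bell_at x t)%:E <= N%:E)%E.
Proof.
move=> t0; have mq : measurable_fun setT (fun y => `|q y|).
  by apply: measurableT_comp => //; exact: has_int_measurable fN.
have <- : (\int[mu]_y (`|q y|)%:E = N%:E)%E by exact: has_int_ge0_ae fN q0.
rewrite -(heat_average_mass t0 mq)//; apply: ge0_le_integral => //.
- by move=> x _; rewrite lee_fin; exact: (bell_at_ge0 f r1 HE H0 e0 eH WV).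
- by apply/measurable_EFinP; exact: mbell.
- have mG : measurable_fun setT (fun w : 'rV[R]_m * 'rV[R]_m =>
      (`|q w.2| * heat_kernel t (w.1 - w.2))%:E).
    apply/measurable_EFinP; apply: measurable_funM.
      exact: (measurableT_comp mq measurable_snd).
    apply: measurable_heat_kernel => // i; under eq_fun do rewrite !mxE.
    by apply: measurable_funB; [exact: (measurableT_comp (measurable_rV_coord i)
      measurable_fst)|exact: (measurableT_comp (measurable_rV_coord i) measurable_snd)].
  by apply: (measurable_fun_fubini_tonelli_F _ mG) => w;
    rewrite lee_fin mulr_ge0// heat_kernel_ge0.
move=> x _; have hq := has_int_heat x (has_int_good fN) t0.
have hle : ((bell_at x t)%:E <= (heat q x t)%:E)%E.
  have g1 := weight_fun_at_ge1 r1 HE H0 e0 eH WV x t0.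
  have [_ _ WVi _] := WV.
  have b1 : ip (invmx (heat_ext V x t) *m heat_ext f x t) (heat_ext f x t) <=
      heat q x t.
    apply: (heat_ext_schwarz gV WVi t0 gf); apply: eq_has_int hq => y.
    exact: mulrC.
  have [_ _ _ fl] := WV; have [_ pB _ _] := fl x t t0.
  rewrite lee_fin; apply: le_trans b1; rewrite /bell_at /bell.
  rewrite ler_pdivrMr; last exact: lt_le_trans g1.
  by rewrite ler_peMr//; have [_] := pd_psd (pd_inv pB); exact.
apply: (le_trans hle); apply: (has_int_le_integral hq) => [|y|y].
- by apply: measurable_funM => //; exact: measurable_heat_kernelB.
- by rewrite mulr_ge0// heat_kernel_ge0.
- by apply: ler_wpM2r; [exact: heat_kernel_ge0|exact: ler_norm].
Qed.

Let energy_ge0 x t : 0 < t -> 0 <= energy x t.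
Proof.
move=> t0; have [_ _ _ fl] := WV; have [_ pB _ _] := fl x t t0.
by apply: sumr_ge0 => i _; have [_] := pd_psd (pd_inv pB); exact.
Qed.

(** The [th] that maximises [4 th s - 2 (1 + 2 e) th ^ 2 s], the coefficient of the energy in
    [bell_average] up to order [s ^ 2]; the maximum is [2 k s]. *)
Let k := (1 + 2 * e)^-1.

Let k0 : 0 < k.
Proof. by rewrite invr_gt0 addr_gt0// mulr_gt0. Qed.

Let E p := if 0 < p.2 then energy p.1 p.2 else 0.
Let M p := if 0 < p.2 then `|spread p.1 p.2| else 0.
Let tau (p : 'rV[R]_m * measurableTypeR R) : R := p.2.
Local Notation trunc := (truncated tau E M).

Let mtr s L : measurable_fun setT (trunc s L).
Proof. exact: (measurable_truncated mt measurable_energy measurable_spread). Qed.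

Let one_step_arith (b s t en sp : R) : 0 < s -> 0 < t -> 0 <= en ->
  b + 2 * k * s * (en - s / (2 * t ^+ 2) * `|sp|) <=
  b + 4 * k * s * en - (1 + 2 * e) * k ^+ 2 *
     (2 * (s * (t - s) / t) * en + (s / t) ^+ 2 * sp).
Proof.
move=> s0 t0 en0; have k0' := k0.
have -> : (1 + 2 * e) * k ^+ 2 = k.
  by rewrite expr2 mulrA mulfV ?mul1r// gt_eqF// addr_gt0// mulr_gt0.
rewrite -subr_ge0.
have -> : b + 4 * k * s * en - k * (2 * (s * (t - s) / t) * en + (s / t) ^+ 2 * sp) -
    (b + 2 * k * s * (en - s / (2 * t ^+ 2) * `|sp|)) =
  k * (s ^+ 2 / t) * (2 * en) + k * (s / t) ^+ 2 * (`|sp| - sp).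
  by move: `|sp| => a; field; rewrite gt_eqF.
have st0 : 0 <= k * (s ^+ 2 / t).
  by rewrite mulr_ge0 ?divr_ge0 ?sqr_ge0//; exact: ltW.
have ss0 : 0 <= k * (s / t) ^+ 2 by rewrite mulr_ge0 ?sqr_ge0//; exact: ltW.
apply: addr_ge0; apply: mulr_ge0 => //; first by rewrite mulr_ge0.
by rewrite subr_ge0 ler_norm.
Qed.

(** [bell_average] with [th = 0] covers the times outside the cut and the branch 0 of the maximum;
    [th = k] gives the other branch. *)
Let step x t s L : 0 < s -> s < t ->
  ((bell_at x t + 2 * k * s * trunc s L (x, t))%:E <=
   \int[mu]_z (bell_at z (t - s) * heat_kernel s (x - z))%:E)%E.
Proof.
move=> s0 st; have t0 := lt_trans s0 st.
have h0 : ((bell_at x t)%:E <=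
    \int[mu]_z (bell_at z (t - s) * heat_kernel s (x - z))%:E)%E.
  have := bell_average r1 r43 HE H0 H1 e0 eH WV gf mbell x 0 s0 st.
  by rewrite expr0n /= !mulr0 !mul0r subr0 addr0.
rewrite /truncated; case: ifP => _; last by rewrite mulr0 addr0.
rewrite /Num.max; case: ifP => _; last by rewrite mulr0 addr0.
apply: le_trans (bell_average r1 r43 HE H0 H1 e0 eH WV gf mbell x k s0 st).
rewrite lee_fin /E /M /tau /= t0; apply: one_step_arith => //.
exact: energy_ge0.
Qed.

Let b' p := if 0 < p.2 then bell_at p.1 p.2 else 0.

Let b'0 p : 0 <= b' p.
Proof.
rewrite /b'; case: ifP => // p0; exact: (bell_at_ge0 f r1 HE H0 e0 eH WV).
Qed.

(** Integrated in space, the right side of [step] has the mass of [bell_at] at time [t - s], so the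
    inequality telescopes. The factor [2 k s] and the slab of length [s] left over by the
    telescoping cancel to [N / (2 k)], whatever the step. *)
Let mass_step s L : 0 < s -> 0 < L ->
  (\int[mu \x leb]_p (trunc s L p)%:E <= ((1 + 2 * e) / 2 * N)%:E)%E.
Proof.
move=> s0 L0; have k0' := k0.
have c0 : 0 <= 2 * k * s by rewrite !mulr_ge0// ltW.
pose Kf p := (2 * k * s * trunc s L p)%:E.
have mK : measurable_fun setT Kf.
  by apply/measurable_EFinP; apply: measurable_funM.
have K0 p : (0 <= Kf p)%E by rewrite lee_fin mulr_ge0// truncated_ge0.
have mB : measurable_fun setT (EFin \o b') by apply/measurable_EFinP; exact: measurable_bell_at.
have B0 p : (0 <= (EFin \o b') p)%E by rewrite lee_fin.
have T : (\int[leb]_t fubini_G mu Kf t <= (N * s)%:E)%E.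
  apply: (@telescoping_bound _ (fubini_G mu (EFin \o b')) _ N s L) => //.
  - exact: measurable_fun_fubini_tonelli_G.
  - exact: measurable_fun_fubini_tonelli_G.
  - by move=> t; apply: integral_ge0 => x _; exact: B0.
  - by move=> t; apply: integral_ge0 => x _; exact: K0.
  - move=> t t0; apply: le_trans (bell_at_mass t0).
    by rewrite /fubini_G /b' /= t0.
  - move=> t st; have t0 := lt_trans s0 st; have ts0 : 0 < t - s by rewrite subr_gt0.
    have mBt : measurable_fun setT (fun x => (b' (x, t))%:E).
      exact: (measurableT_comp mB (pair2_measurable t)).
    have mKt : measurable_fun setT (fun x => Kf (x, t)).
      exact: (measurableT_comp mK (pair2_measurable t)).
    have -> : (fubini_G mu (EFin \o b') t + fubini_G mu Kf t =
        \int[mu]_x ((b' (x, t))%:E + Kf (x, t)))%E.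
      apply/esym; apply: (ge0_integralD mu measurableT _ mBt _ mKt) => x _.
        exact: B0.
      exact: K0.
    have <- : (\int[mu]_x \int[mu]_z (bell_at z (t - s) * heat_kernel s (x - z))%:E =
        fubini_G mu (EFin \o b') (t - s)%R)%E.
      rewrite (heat_average_mass s0 (mbell ts0)) => [|z].
        by apply: eq_integral => z _; rewrite /b' /= ts0.
      exact: (bell_at_ge0 f r1 HE H0 e0 eH WV).
    apply: ge0_le_integral; first exact: measurableT.
    - by move=> x _; apply: adde_ge0; [exact: B0|exact: K0].
    - exact: emeasurable_funD.
    - pose G (w : 'rV[R]_m * 'rV[R]_m) :=
        (bell_at w.2 (t - s) * heat_kernel s (w.1 - w.2))%:E.
      have mG : measurable_fun setT G.
        apply/measurable_EFinP; apply: measurable_funM.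
          exact: (measurableT_comp (mbell ts0) measurable_snd).
        apply: measurable_heat_kernel => // i; under eq_fun do rewrite !mxE.
        apply: measurable_funB.
          exact: (measurableT_comp (measurable_rV_coord i) measurable_fst).
        exact: (measurableT_comp (measurable_rV_coord i) measurable_snd).
      apply: (measurable_fun_fubini_tonelli_F G mG) => w.
      rewrite lee_fin mulr_ge0 ?heat_kernel_ge0//.
      exact: (bell_at_ge0 f r1 HE H0 e0 eH WV).
    move=> x _; rewrite /Kf /b' /= t0 -EFinD; exact: step.
  - move=> t tL; rewrite /fubini_G (eq_integral (cst 0%E)) ?integral0// => x _.
    by rewrite /Kf /truncated /tau /= (negbTE tL) mulr0.
have E1 : (\int[mu \x leb]_p Kf p = (2 * k * s)%:E * \int[mu \x leb]_p (trunc s L p)%:E)%E.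
  rewrite -ge0_integralZl//; first by apply/measurable_EFinP; exact: mtr.
  by move=> p _; rewrite lee_fin truncated_ge0.
have := @fubini_tonelli2 _ _ _ _ _ mu leb Kf mK K0; rewrite E1 => E2.
have {E2}T' : ((2 * k * s)%:E * \int[mu \x leb]_p (trunc s L p)%:E <= (N * s)%:E)%E.
  by rewrite E2.
have c1 : 0 < 2 * k * s by rewrite !mulr_gt0.
have -> : (((1 + 2 * e) / 2 * N)%:E = (2 * k * s)^-1%:E * (N * s)%:E)%E.
  rewrite -EFinM /k; congr EFin; field.
  by rewrite !gt_eqF// addr_gt0// mulr_gt0.
by rewrite lee_pdivlMl.
Qed.

Lemma energy_bound :
  (\int[mu \x leb]_(p in [set p | (0 < p.2)%R]) (energy p.1 p.2)%:E <=
   ((1 + 2 * e) / 2 * N)%:E)%E.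
Proof.
have -> : (\int[mu \x leb]_(p in [set p | (0 < p.2)%R]) (energy p.1 p.2)%:E =
    \int[mu \x leb]_(p in [set p | (0 < tau p)%R]) (E p)%:E)%E.
  by apply: eq_integral => p /set_mem /= p0; rewrite /E p0.
apply: (@truncated_bound _ _ _ _ tau E M) => //.
- exact: measurable_energy.
- exact: measurable_spread.
- by move=> p; rewrite /M; case: ifP.
- by move=> p p0; rewrite /E; case: ifP => // p0'; exact: energy_ge0.
- by move=> n; apply: mass_step => //; rewrite invr_gt0.
Qed.

End energy_estimate.

(** * Test functions *)

Section heat_derivative.
Context {R : realType} {m : nat}.
Local Notation mu := (@lebesgue_rV R m).
Implicit Types (x y z : 'rV[R]_m) (s t : R) (F : 'rV[R]_m -> R).

Lemma sqnorm_line i (h : R) z :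
  sqnorm (h *: 'e_i + z) = sqnorm z + 2 * h * z ord0 i + h ^+ 2.
Proof.
rewrite /sqnorm (bigD1 i)//= [in RHS](bigD1 i)//= !mxE !eqxx /= mulr1.
rewrite (eq_bigr (fun j => z ord0 j ^+ 2)) => [|j ji]; first by ring.
by rewrite !mxE (negbTE ji) andbF mulr0 add0r.
Qed.

Lemma is_derive_heat_kernel_line i t (h : R) z : 0 < t ->
  is_derive h 1 (fun h : R => heat_kernel t (h *: 'e_i + z))
    (- (h + z ord0 i) / (2 * t) * heat_kernel t (h *: 'e_i + z)).
Proof.
move=> t0; rewrite (_ : (fun _ => _) = fun h : R => ((4 * pi * t) `^ (m%:R / 2))^-1 *
    expR (- ((sqnorm z + 2 * h * z ord0 i + h ^+ 2) / (4 * t)))); last first.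
  by apply/funext => w; rewrite /heat_kernel sqnorm_line.
rewrite /heat_kernel sqnorm_line.
set c := _^-1; set a := sqnorm z; set b := z ord0 i.
apply: is_derive_eq.
rewrite /GRing.scale /=; field.
by rewrite gt_eqF.
Qed.

(** From [|w| <= 1 + w ^ 2] and [1 + x <= exp x]. Uniformity in [z] is what makes it a domination
    along the whole line of differentiation. *)
Lemma heat_kernel_coord_le t z i : 0 < t -> `|z ord0 i| * heat_kernel t z <=
  (1 + 4 * t) * ((4 * pi * t) `^ (m%:R / 2))^-1.
Proof.
move=> t0; rewrite /heat_kernel; set c := _^-1.
have c0 : 0 <= c by rewrite invr_ge0 powR_ge0.
rewrite mulrCA [leRHS]mulrC; apply: ler_wpM2l => //.
have t4 : 0 < 4 * t by rewrite mulr_gt0.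
rewrite expRN ler_pdivrMr ?expR_gt0//.
have h1 := expR_ge1Dx (sqnorm z / (4 * t)).
have h2 : z ord0 i ^+ 2 / (4 * t) <= sqnorm z / (4 * t).
  by rewrite ler_pM2r ?invr_gt0// coord_sqr_le.
apply: (@le_trans _ _ ((1 + 4 * t) * (1 + z ord0 i ^+ 2 / (4 * t)))); last first.
  by apply: ler_wpM2l; [rewrite addr_ge0// ltW|lra].
move: (z ord0 i) => w.
have h3 : 0 <= w ^+ 2 / (4 * t) by rewrite divr_ge0 ?sqr_ge0// ltW.
have -> : (1 + 4 * t) * (1 + w ^+ 2 / (4 * t)) =
    1 + 4 * t + w ^+ 2 / (4 * t) + w ^+ 2 by field; rewrite gt_eqF.
have : `|w| <= 1 + w ^+ 2.
  by rewrite ler_norml; have := sqr_ge0 (w - 1 / 2); have := sqr_ge0 (w + 1 / 2); lra.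
lra.
Qed.

(** As [F] is integrable, a constant multiple of its absolute value dominates the differentiated
    integrand for all [h], and differentiation under the integral applies. *)
Lemma rpartial_heat F N i x t : has_int mu F N -> 0 < t ->
  rpartial i (fun x => heat F x t) x = (2 * t)^-1 * heat1 F i x t.
Proof.
move=> FN t0; have gF := has_int_good FN.
pose f (h : R) y := F y * heat_kernel t (h *: 'e_i + x - y).
pose df (h : R) y := F y * (- (h + (x - y) ord0 i) / (2 * t) *
  heat_kernel t (h *: 'e_i + (x - y))).
have fE y (h : R) : is_derive h 1 (f ^~ y) (df h y).
  rewrite (_ : f ^~ y = fun h : R => F y * heat_kernel t (h *: 'e_i + (x - y))).
    have := is_derive_heat_kernel_line i h (x - y) t0.
    by move=> dh; apply: is_deriveZ.
  by apply/funext => w; rewrite /f addrA.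
pose K := (2 * t)^-1 * ((1 + 4 * t) * ((4 * pi * t) `^ (m%:R / 2))^-1).
have K0 : 0 <= K.
  have t40 : 0 <= 1 + 4 * t by rewrite addr_ge0// mulr_ge0// ltW.
  by rewrite !mulr_ge0 ?invr_ge0 ?powR_ge0// mulr_ge0// ltW.
have [G1 _] := has_intZ K (has_int_Rintegral (integrable_norm FN.1)).
have p1 (h : R) y : partial1of2 f h y = df h y.
  by rewrite partial1of2E; exact: (derive_val (is_derive := fE y h)).
have If h : mu.-integrable setT (EFin \o f h).
  by have [_ gi] := gF; exact: (gi (h *: 'e_i + x) t t0).
have hb : forall h y, `|partial1of2 f h y| <= K * `|F y|.
  move=> h y; rewrite p1 /df normrM mulrC; apply: ler_wpM2r => //.
  rewrite normrM mulNr normrN normrM -mulrA mulrCA /K.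
  rewrite (gtr0_norm (_ : 0 < (2 * t)^-1)) ?invr_gt0 ?mulr_gt0//.
  apply: ler_wpM2l; first by rewrite invr_ge0 mulr_ge0// ltW.
  have := heat_kernel_coord_le (h *: 'e_i + (x - y)) i t0.
  rewrite [in X in X * _ <= _]mxE [in X in X * _ <= _]mxE.
  rewrite [in X in X * _ <= _]mxE !eqxx mulr1.
  by rewrite (ger0_norm (heat_kernel_ge0 _ _)).
have I0 : (0 : R) \in `](-1), 1[ by rewrite in_itv /= oppr_lt0 ltr01.
have := @cvg_differentiation_under_integral R _ _ mu f setT measurableT 0 (-1) 1
  I0 (fun h _ => If h) (fun h y _ _ => @ex_derive _ _ _ _ _ _ _ (fE y h))
  (fun y => K * `|F y|) (fun y => mulr_ge0 K0 (normr_ge0 _)) G1 (fun h y _ _ => hb h y).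
have E : \int[mu]_(y in setT) partial1of2 f 0 y = (2 * t)^-1 * heat1 F i x t.
  apply: has_intE; apply: eq_has_int (has_intZ (2 * t)^-1 (has_int_good1 i x gF t0)).
  move=> y; rewrite p1 /df scale0r add0r add0r !mxE; field.
  by rewrite gt_eqF.
rewrite E => cv; rewrite /rpartial /derive.
pose quot (h : R) : R :=
  h^-1 *: (\int[mu]_(y in setT) f (h + 0) y - \int[mu]_(y in setT) f 0 y).
rewrite [X in lim (X @ _)](_ : _ = quot); last first.
  by apply/funext => h; rewrite /quot /f addr0 scale0r add0r.
exact: (cvg_lim (@Rhausdorff R) cv).
Qed.


End heat_derivative.

(** * Measurability of continuous functions, and supports in boxes *)

Section continuous_functions.
Context {R : realType} {m : nat}.
Local Notation mu := (@lebesgue_rV R m).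
Implicit Types (x y : 'rV[R]_m) (u : 'rV[R]_m -> R).

(* [u] is the limit of its values at the grid points [floor (n x) / n] *)
Lemma continuous_rV_measurable u : continuous u -> measurable_fun setT u.
Proof.
move=> cu.
pose pt (n : nat) (k : {ffun 'I_m -> int}) : 'rV[R]_m :=
  \row_i ((k i)%:~R / n.+1%:R).
pose fl (n : nat) x : {ffun 'I_m -> int} :=
  [ffun i => Num.floor (x ord0 i * n.+1%:R)].
pose cell n k : set 'rV[R]_m := [set x | fl n x = k].
have mcell n k : measurable (cell n k).
  have -> : cell n k = \bigcap_(i in [set: 'I_m]) ((fun x : 'rV[R]_m => x ord0 i)
      @^-1` [set w : R | (k i)%:~R <= w * n.+1%:R < (k i + 1)%:~R]).
    apply/seteqP; split => x /=.
      by move=> <- i _ /=; rewrite ffunE; exact: floor_itv.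
    by move=> h; apply/ffunP => i; rewrite ffunE; apply: floor_def; exact: h.
  apply: fin_bigcap_measurable => // i _.
  rewrite -[X in measurable X]setTI; apply: measurable_rV_coord => //.
  have mw : measurable_fun setT (fun w : R => w * n.+1%:R) by exact: measurable_funM.
  have mb : measurable_fun setT
      (fun w : R => ((k i)%:~R <= w * n.+1%:R) && (w * n.+1%:R < (k i + 1)%:~R)).
    by apply: measurable_and; [exact: measurable_fun_ler|exact: measurable_fun_ltr].
  have -> : [set w : R | (k i)%:~R <= w * n.+1%:R < (k i + 1)%:~R] = setT `&`
      (fun w : R => ((k i)%:~R <= w * n.+1%:R) && (w * n.+1%:R < (k i + 1)%:~R))
        @^-1` [set true].
    by rewrite setTI.
  exact: mb.
pose g n x := u (pt n (fl n x)).
have mg n : measurable_fun setT (g n).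
  move=> _ Y mY; rewrite setTI.
  have -> : g n @^-1` Y = \bigcup_(j in [set: nat]) (if unpickle j is Some k then
      (if `[< Y (u (pt n k)) >] then cell n k else set0) else set0).
    apply/seteqP; split => x /=.
      move=> gx; exists (pickle (fl n x)) => //; rewrite pickleK.
      by case: asboolP.
    move=> [j _]; case: (unpickle j) => // k; case: asboolP => // Yk.
    by rewrite /cell /= /g => ->.
  apply: bigcup_measurable => j _; case: (unpickle j) => // k.
  by case: ifP.
apply: (@measurable_fun_cvg _ _ _ setT g u mg) => x _.
apply: (@cvg_comp _ _ _ (fun n => pt n (fl n x)) u \oo (nbhs x) (nbhs (u x))); last exact: cu.
apply/cvg_ballP => e e0.
have [n1 Hn1] : exists n1 : nat, e^-1 < n1%:R.
  by exists (Num.truncn e^-1).+1; exact: truncnS_gt.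
exists n1 => // n /= n1n; split=> // a i; rewrite (ord1 a) mxE ffunE -ball_normE /=.
have n0 : (0 : R) < n.+1%:R by [].
have ne : e^-1 < n.+1%:R by apply: lt_le_trans Hn1 _; rewrite ler_nat leqW.
have /andP[h1 h2] := floor_itv (x ord0 i * n.+1%:R).
set k := Num.floor _ in h1 h2 *.
have -> : x ord0 i - k%:~R / n.+1%:R = (x ord0 i * n.+1%:R - k%:~R) / n.+1%:R.
  by field.
rewrite intrD in h2.
rewrite ger0_norm; last by rewrite divr_ge0 ?subr_ge0// ltW.
rewrite ltr_pdivrMr//; apply: (@lt_trans _ _ 1); first lra.
by move: ne; rewrite -(ltr_pM2l e0) mulfV// lt0r_neq0.
Qed.

Definition box (M : R) := [set x : 'rV[R]_m | forall i, x ord0 i \in `[- M, M]].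

Lemma box_fin (M : R) : 0 <= M ->
  (mu (box M) < +oo)%E.
Proof.
move=> M0; rewrite lebesgue_rV_box ?ltry// => i.
by rewrite lerNl (le_trans _ M0)// oppr_le0.
Qed.

Lemma measurable_box (M : R) : measurable (box M).
Proof.
rewrite (_ : box M = \bigcap_(i in [set: 'I_m]) ((fun x : 'rV[R]_m => x ord0 i)
    @^-1` `[- M, M])).
  apply: fin_bigcap_measurable => // i _.
  by rewrite -[X in measurable X]setTI; exact: measurable_rV_coord.
by apply/seteqP; split => x /= h => [i _|i]; exact: h.
Qed.

Lemma bounded_has_int u (M c : R) : measurable_fun setT u -> 0 <= M ->
  (forall x, `|u x| <= c) ->
  (forall x, u x != 0 -> box M x) ->
  exists N, has_int mu u N.
Proof.
move=> mu' M0 uc uM; eexists; apply: has_int_Rintegral.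
have mD := measurable_box M; set D := box M in uM mD *.
have I : mu.-integrable setT (EFin \o (fun x => c * \1_D x)).
  apply: (has_intZ c (a := fine (mu D)) _).1; apply: has_int_ge0 => //.
  by rewrite integral_indic// setIT fineK// ge0_fin_numE// box_fin.
apply: le_integrable I => //; first exact/measurable_EFinP.
move=> x _; rewrite /= lee_fin.
have c0 : 0 <= c by exact: le_trans (normr_ge0 _) (uc x).
have [->|ux] := eqVneq (u x) 0; first by rewrite normr0.
rewrite indicE mem_set ?mulr1; last exact: uM.
by rewrite (ger0_norm c0).
Qed.

Lemma Ccinfty_component d (f : 'rV[R]_m -> 'cV[R[i]]_d) : Ccinfty f ->
  exists M c : R, [/\ 0 <= M, 0 <= c, forall x, f x != 0 -> box M x &
    forall k, [/\ measurable_fun setT (fun x => complex.Re (f x k ord0)),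
      measurable_fun setT (fun x => complex.Im (f x k ord0)),
      forall x, `|complex.Re (f x k ord0)| <= c &
      forall x, `|complex.Im (f x k ord0)| <= c]].
Proof.
move=> [sf cK]; set K := closure _ in cK.
have [M [M0 MK]] : exists M : R, 0 <= M /\ forall x, K x -> `|x| <= M.
  have [M0 [_ h]] := compact_bounded cK.
  exists (Num.max 0 M0 + 1); split; first by rewrite addr_ge0// le_max lexx.
  by apply: h; rewrite ltr_pwDr// le_max lexx orbT.
have Kout x : ~ K x -> f x = 0.
  by apply: contra_notP => /eqP fx; exact: subset_closure.
have bd u : continuous u -> (forall x, ~ K x -> u x = 0) ->
    exists c : R, 0 <= c /\ forall x, `|u x| <= c.
  move=> cu u0.
  have cuK : compact (u @` K).
    apply: continuous_compact => //; exact: continuous_subspaceT.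
  have [c0 [_ h]] := compact_bounded cuK.
  exists (Num.max 0 c0 + 1); split; first by rewrite addr_ge0// le_max lexx.
  move=> x; have [Kx|/u0 ->] := pselect (K x); last first.
    by rewrite normr0 addr_ge0// le_max lexx.
  apply: (h (Num.max 0 c0 + 1)); last by exists x.
  by rewrite ltr_pwDr// le_max lexx orbT.
have cr k : continuous (fun x => complex.Re (f x k ord0)) := ((sf k).1 [::]).1.
have ci k : continuous (fun x => complex.Im (f x k ord0)) := ((sf k).2 [::]).1.
have /choice[c Hc] : forall k, exists c : R, 0 <= c /\
    forall x, `|complex.Re (f x k ord0)| <= c /\ `|complex.Im (f x k ord0)| <= c.
  move=> k; have [|c1 [c10 h1]] := bd _ (cr k).
    by move=> x /Kout ->; rewrite mxE.
  have [|c2 [c20 h2]] := bd _ (ci k).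
    by move=> x /Kout ->; rewrite mxE.
  exists (c1 + c2); split; first exact: addr_ge0.
  move=> x; split; first by apply: le_trans (h1 x) _; rewrite lerDl.
  by apply: le_trans (h2 x) _; rewrite lerDr.
have cs k : c k <= \sum_l c l.
  by rewrite (bigD1 k)//= lerDl sumr_ge0// => l _; exact: (Hc l).1.
exists M, (\sum_k c k); split => //.
- by apply: sumr_ge0 => k _; exact: (Hc k).1.
- move=> x fx i; have Kx : K x by exact: subset_closure.
  rewrite in_itv /= -ler_norml; apply: le_trans (MK x Kx).
  have -> : `|x| = \big[Num.max/0]_ij `|x ij.1 ij.2| by exact: mx_normrE.
  exact: (le_bigmax _ (fun ij : 'I_1 * 'I_m => `|x ij.1 ij.2|) (ord0, i)).
move=> k; split.
- exact: continuous_rV_measurable.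
- exact: continuous_rV_measurable.
- by move=> x; apply: le_trans ((Hc k).2 x).1 (cs k).
- by move=> x; apply: le_trans ((Hc k).2 x).2 (cs k).
Qed.

End continuous_functions.

Section test_functions.
Context {R : realType} {m d : nat}.
Local Notation C := R[i].
Local Notation mu := (@lebesgue_rV R m).
Implicit Types (x y : 'rV[R]_m) (f : 'rV[R]_m -> 'cV[C]_d).

(** On a box the heat kernel at time 1 has a positive lower bound [k], so convergence of one heat
    extension dominates the integral of [F] against a bounded function supported there. *)
Lemma good_mul_has_int (F p : 'rV[R]_m -> R) (M c : R) : good F ->
  measurable_fun setT p -> (forall x, `|p x| <= c) ->
  (forall x, p x != 0 -> box M x) ->
  exists N, has_int mu (fun x => p x * F x) N.
Proof.
move=> gF mp pc pM; eexists; apply: has_int_Rintegral.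
pose b := m%:R * M ^+ 2 : R.
pose k := ((4 * pi * 1) `^ (m%:R / 2))^-1 * expR (- (b / (4 * 1))) : R.
have k0 : 0 < k.
  by rewrite mulr_gt0 ?expR_gt0// invr_gt0 powR_gt0// mulr_gt0// mulr_gt0// pi_gt0.
have hk x : box M x -> k <= heat_kernel 1 (0 - x).
  move=> bx; rewrite sub0r heat_kernelN; apply: ler_wpM2l.
    by rewrite invr_ge0 powR_ge0.
  rewrite ler_expR lerN2 ler_pM2r ?invr_gt0 ?mulr_gt0//.
  have -> : b = \sum_(i < m) M ^+ 2.
    by rewrite sumr_const card_ord /b mulr_natl.
  apply: ler_sum => i _; have := bx i; rewrite in_itv /= -ler_norml.
  move=> h; rewrite -real_normK ?num_real//; rewrite ler_sqr ?nnegrE//.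
  exact: le_trans h.
have [I _] := has_intZ (c / k) (has_int_Rintegral (integrable_norm (gF.2 0 1 ltr01))).
apply: le_integrable I => //.
  by apply/measurable_EFinP; apply: measurable_funM => //; exact: gF.1.
move=> x _; rewrite /= lee_fin.
have c0 : 0 <= c by exact: le_trans (normr_ge0 _) (pc x).
have ck0 : 0 <= c / k by rewrite divr_ge0// ltW.
have [->|px] := eqVneq (p x) 0; first by rewrite mul0r normr0.
rewrite [leRHS]ger0_norm; last by apply: mulr_ge0.
rewrite (normrM (p x)) (normrM (F x)) (ger0_norm (heat_kernel_ge0 _ _)).
have h := hk x (pM x px); have F0 := normr_ge0 (F x).
apply: (@le_trans _ _ (c * `|F x|)); first exact: ler_wpM2r.
have -> : c / k * (`|F x| * heat_kernel 1 (0 - x)) =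
    c * `|F x| * (heat_kernel 1 (0 - x) / k) by ring.
by rewrite ler_peMr ?mulr_ge0// ler_pdivlMr// mul1r.
Qed.

Variable f : 'rV[R]_m -> 'cV[C]_d.
Hypothesis Cf : Ccinfty f.

Let Cf_int k : exists N1 N2, has_int mu (fun x => complex.Re (f x k ord0)) N1 /\
  has_int mu (fun x => complex.Im (f x k ord0)) N2.
Proof.
have [M [c [M0 c0 fM fc]]] := Ccinfty_component Cf.
have [mr mi rc ic] := fc k.
have [x|N1 h1] := bounded_has_int mr M0 rc.
  by move=> h; apply: fM; apply: contra h => /eqP ->; rewrite mxE.
have [x|N2 h2] := bounded_has_int mi M0 ic.
  by move=> h; apply: fM; apply: contra h => /eqP ->; rewrite mxE.
by exists N1, N2.
Qed.

Lemma Ccinfty_mxgood : mxgood f.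
Proof.
move=> k l; rewrite (ord1 l); have [N1 [N2 [h1 h2]]] := Cf_int k.
by split; [exact: has_int_good h1|exact: has_int_good h2].
Qed.

Lemma partial_heat_ext i x t : 0 < t ->
  partial i (fun x => heat_ext f x t) x = grad f i x t.
Proof.
move=> t0; apply/matrixP => k l; rewrite (ord1 l) !mxE.
have [N1 [N2 [h1 h2]]] := Cf_int k.
rewrite [RHS]mulrC.
have -> : (fun y => complex.Re (heat_ext f y t k ord0)) =
    (fun y => heat (fun y => complex.Re (f y k ord0)) y t).
  by apply/funext => y; rewrite heat_extE mxE.
have -> : (fun y => complex.Im (heat_ext f y t k ord0)) =
    (fun y => heat (fun y => complex.Im (f y k ord0)) y t).
  by apply/funext => y; rewrite heat_extE mxE.
rewrite (rpartial_heat i x h1 t0) (rpartial_heat i x h2 t0).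
rewrite -[RHS]/(Complex _ _) /=; congr Complex; ring.
Qed.

Variable W : 'rV[R]_m -> 'M[C]_d.
Hypothesis gW : mxgood W.

Lemma Ccinfty_form_has_int :
  exists N, has_int mu (fun y => ip (W y *m f y) (f y)) N.
Proof.
have [M [c [M0 c0 fM fc]]] := Ccinfty_component Cf.
(* [ip (W y *m f y) (f y)] is the trace of [P y] times [W y], a finite sum of bounded, compactly
   supported factors times entries of [W]. *)
pose P y := f y *m (f y)^t*.
have PE y k l : P y k l = f y k ord0 * Num.conj (f y l ord0).
  by rewrite mxE big_ord1 !mxE.
have mf : mxmeas f.
  by move=> k l; rewrite (ord1 l); have [mr mi _ _] := fc k.
have mP k l : cmeas (fun y => P y k l).
  by under eq_fun do rewrite PE; apply: cmeasM => //; apply: cmeasJ; exact: mf.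
have Ps k l y : P y k l != 0 -> box M y.
  move=> h; apply: fM; apply: contra h => /eqP fy.
  by rewrite PE fy mxE mul0r.
have Pb k l y : `|complex.Re (P y k l)| <= 2 * c ^+ 2 /\
    `|complex.Im (P y k l)| <= 2 * c ^+ 2.
  have [_ _ rk ik] := fc k; have [_ _ rl il] := fc l.
  move: (rk y) (ik y) (rl y) (il y); rewrite PE.
  case: (f y k ord0) (f y l ord0) => [a b] [a' b'] /= h1 h2 h3 h4.
  have b1 u v : `|u| <= c -> `|v| <= c -> `|u * v| <= c ^+ 2.
    by move=> hu hv; rewrite normrM expr2; apply: ler_pM.
  rewrite mulr2n mulrDl mul1r; split.
    by apply: le_trans (ler_normB _ _) _; rewrite mulrN normrN lerD// b1.
  by apply: le_trans (ler_normD _ _) _; rewrite mulrN normrN lerD// b1.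
have hr k l : exists N, has_int mu (fun y => complex.Re (P y k l) *
    complex.Re (W y l k) - complex.Im (P y k l) * complex.Im (W y l k)) N.
  have [gr gi] := gW l k.
  have [y|N1 h1] := good_mul_has_int (M := M) gr (mP k l).1 (fun y => (Pb k l y).1).
    by move=> h; apply: (Ps k l); apply: contra h => /eqP ->.
  have [y|N2 h2] := good_mul_has_int (M := M) gi (mP k l).2 (fun y => (Pb k l y).2).
    by move=> h; apply: (Ps k l); apply: contra h => /eqP ->.
  by exists (N1 - N2); exact: has_intB.
have /choice[N HN] : forall kl : 'I_d * 'I_d, exists N, has_int mu
    (fun y => complex.Re (P y kl.1 kl.2) * complex.Re (W y kl.2 kl.1) -
     complex.Im (P y kl.1 kl.2) * complex.Im (W y kl.2 kl.1)) N.
  by move=> kl; exact: hr.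
exists (\sum_k \sum_l N (k, l)).
have := has_int_sum (index_enum 'I_d) (fun k => has_int_sum (index_enum 'I_d)
  (fun l => HN (k, l))).
by apply: eq_has_int => y; rewrite ip_rtr rtr_mulE.
Qed.

Lemma wnorm_has_int : {ae mu, forall y, pd (W y)} ->
  exists N, [/\ 0 <= N, has_int mu (fun y => ip (W y *m f y) (f y)) N &
    wnorm W f = (Num.sqrt N)%:E].
Proof.
move=> pW; have [N hN] := Ccinfty_form_has_int; exists N; split => //.
  rewrite -lee_fin -(has_int_ge0_ae hN) ?integral_ge0//.
  by apply: filterS pW => y /pd_psd[_]; exact.
by rewrite /wnorm; have [_ ->] := hN.
Qed.

End test_functions.

(** * The heat characteristic *)

Lemma invmx_sqr (F : comUnitRingType) n (S : 'M[F]_n) : S \in unitmx ->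
  invmx (S *m S) = invmx S *m invmx S.
Proof.
move=> uS; have uSS : S *m S \in unitmx by rewrite unitmx_mul uS.
rewrite -[RHS](mulKmx uSS); by rewrite [S *m S *m _]mulmxA -(mulmxA S) mulmxV// mulmx1 mulmxV// mulmx1.
Qed.

Section characteristic.
Context {R : realType} {d : nat}.
Local Notation C := R[i].
Implicit Types (A B P Q M : 'M[C]_d) (u v : 'cV[C]_d).

Lemma pd1 : pd (1%:M : 'M[C]_d).
Proof.
split; first by rewrite /herm trmx1 map_mx1.
by move=> v v0; rewrite mul1mx ip_gt0.
Qed.

Lemma psd_le_rtr P v : psd P -> ip (P *m v) v <= rtr P * ip v v.
Proof.
move=> pP; have := psd_le_trace v pP pd1.
by rewrite invmx1 !mul1mx.
Qed.

(** Inversion reverses the order of forms; here through Fenchel's inequality for [P] at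
    [c^-1 Q v]. *)
Lemma form_le_sym P Q c : pd P -> pd Q -> 0 < c ->
  (forall v, ip (P *m v) v <= c * ip (invmx Q *m v) v) ->
  forall v, ip (Q *m v) v <= c * ip (invmx P *m v) v.
Proof.
move=> pP pQ c0 h v; have uQ := pd_unit pQ.
have := pd_fenchel v ((c^-1)%:C%C *: (Q *m v)) pP.
have := h (Q *m v); rewrite (mulKmx uQ) -scalemxAr !ipZr ipZl.
rewrite [ip v (Q *m v)]ipC; move: (ip (Q *m v) v) (ip (P *m (Q *m v)) _).
move: (ip (invmx P *m v) v) => a b e' h1 h2.
have c10 : 0 < c^-1 by rewrite invr_gt0.
have : c^-1 * (c^-1 * e') <= c^-1 * b.
  by rewrite ler_pM2l// ler_pdivrMl.
move=> h3; rewrite -ler_pdivrMl//; lra.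
Qed.

Lemma flat_pair_sym r A B : 0 < r -> flat_pair r A B -> flat_pair r B A.
Proof.
move=> r0 [pA pB AB BA].
split; [exact: pB|exact: pA| |exact: (form_le_sym pB pA r0 BA)].
have h w : ip (invmx A *m w) w <= 1 * ip (invmx (invmx B) *m w) w.
  by rewrite invmxK mul1r.
have := form_le_sym (pd_inv pA) (pd_inv pB) ltr01 h.
by rewrite invmxK => h' v; rewrite -[leRHS]mul1r.
Qed.

Lemma enorm_sqr u : enorm u ^+ 2 = ip u u.
Proof. by rewrite sqr_sqrtr// ip_ge0. Qed.

(** The bound by [K] shows that the set defining [opnorm] is bounded above, so that its [sup] is an
    upper bound and not a default value. *)
Lemma opnorm_le M rho K v : (forall w, ip (M *m w) (M *m w) <= K * ip w w) ->
  0 <= K -> opnorm M <= rho -> ip (M *m v) (M *m v) <= rho ^+ 2 * ip v v.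
Proof.
move=> MK K0 Mrho; have [->|v0] := eqVneq v 0; first by rewrite mulmx0 !ip0l mulr0.
have n0 := ip_gt0 v0; pose a := (Num.sqrt (ip v v))^-1.
have a0 : 0 < a by rewrite invr_gt0 sqrtr_gt0.
have a2 : a ^+ 2 * ip v v = 1.
  by rewrite exprVn sqr_sqrtr ?mulVf ?lt0r_neq0// ltW.
pose w := a%:C%C *: v.
have wE : ip w w = 1 by rewrite ipZl ipZr mulrA -expr2.
have MwE : ip (M *m w) (M *m w) = a ^+ 2 * ip (M *m v) (M *m v).
  by rewrite /w -scalemxAr ipZl ipZr mulrA -expr2.
have : enorm (M *m w) <= rho.
  apply: le_trans Mrho; apply: ub_le_sup; last first.
    by exists w => //=; rewrite /enorm -/(ip w w) wE sqrtr1.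
  exists (Num.sqrt K) => _ [z /= z1 <-]; apply: ler_wsqrtr.
  apply: le_trans (MK z) _; rewrite -[leRHS]mulr1; apply: ler_wpM2l => //.
  by rewrite -enorm_sqr expr_le1// sqrtr_ge0.
move=> h; have e0 : 0 <= enorm (M *m w) by exact: sqrtr_ge0.
have : enorm (M *m w) ^+ 2 <= rho ^+ 2.
  by rewrite ler_sqr ?nnegrE//; exact: le_trans h.
rewrite enorm_sqr MwE => h2.
have <- : (a ^+ 2)^-1 = ip v v by rewrite -[RHS](mulKf (lt0r_neq0 (exprn_gt0 2 a0))) a2 mulr1.
by rewrite ler_pdivlMr ?exprn_gt0// mulrC.
Qed.

(** Let [S] and [T] be the roots of [A] and [B], [z = S^-1 v] and [w = S T T v]. Then
    [(z, w) = (B v, v)], and the norm bound gives [(w, w) <= rho ^ 2 (B v, v)]. Expanding the square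
    of [rho ^ 2 z - w] yields the claim. *)
Lemma opnorm_sqrt_form A B rho v : pd A -> pd B -> 0 < rho ->
  opnorm (sqrtmx A *m sqrtmx B) <= rho ->
  ip (B *m v) v <= rho ^+ 2 * ip (invmx A *m v) v.
Proof.
move=> pA pB rho0 h; have uA := pd_unit pA.
have psA := pd_psd pA; have psB := pd_psd pB.
have [[hS _] SS] := sqrtmxP (psd_possemidef psA).
have [[hT _] TT] := sqrtmxP (psd_possemidef psB).
set S := sqrtmx A in h hS SS; set T := sqrtmx B in h hT TT.
have sq y : ip (S *m y) (S *m y) = ip (A *m y) y.
  by rewrite -SS -mulmxA [RHS]ip_adj hS.
have tq y : ip (T *m y) (T *m y) = ip (B *m y) y.
  by rewrite -TT -mulmxA [RHS]ip_adj hT.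
have bd w : ip (S *m T *m w) (S *m T *m w) <= rtr A * rtr B * ip w w.
  rewrite -mulmxA sq; apply: le_trans (psd_le_rtr _ psA) _; rewrite tq -mulrA.
  by apply: ler_wpM2l; [exact: psd_tr|exact: psd_le_rtr].
have bd0 : 0 <= rtr A * rtr B by rewrite mulr_ge0// psd_tr.
have uS : S \in unitmx by move: uA; rewrite -SS unitmx_mul => /andP[].
pose z := invmx S *m v; pose y := T *m v.
have zz : ip z z = ip (invmx A *m v) v.
  have -> : invmx A = invmx S *m invmx S.
    by rewrite -SS invmx_sqr.
  by rewrite -mulmxA [RHS]ip_adj trmxCV hS.
have yy : ip y y = ip (B *m v) v by exact: tq.
pose w := S *m T *m y.
have zw : ip z w = ip (B *m v) v.
  by rewrite -yy {1}/y [RHS]ip_adj hT -{1}(mulKVmx uS v) -/z [RHS]ip_adj hS /w mulmxA.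
have := opnorm_le y bd bd0 h; rewrite -/w yy => ww.
have := ip_ge0 ((rho ^+ 2)%:C%C *: z - w).
rewrite ipBl !ipBr !ipZl !ipZr zz zw [ip w z]ipC zw.
move: ww; move: (ip w w) (ip (B *m v) v) (ip (invmx A *m v) v) => c b a h1 h2.
by rewrite -(ler_pM2l (exprn_gt0 2 rho0)); lra.
Qed.

End characteristic.

(** * From the characteristic to form inequalities *)

Section flat.
Context {R : realType} {m d : nat}.
Local Notation C := R[i].
Local Notation mu := (@lebesgue_rV R m).
Variable W : 'rV[R]_m -> 'M[C]_d.
Hypothesis wW : matrix_weight W.
Variable rho : R.
Hypotheses (rho0 : 0 < rho) (Wrho : (heat_A2 W <= rho%:E)%E).

Let A2_at x t : 0 < t -> (heat_A2_at W (x, t) <= rho%:E)%E.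
Proof.
by move=> t0; apply: le_trans Wrho; apply: ereal_sup_ubound; exists (x, t).
Qed.

Let A2P x t : 0 < t -> [/\ heat_converges W x t, heat_converges (winv W) x t &
  opnorm (sqrtmx (heat_ext W x t) *m sqrtmx (heat_ext (winv W) x t)) <= rho].
Proof.
by move=> /(A2_at x); rewrite /heat_A2_at; case: asboolP => //= -[].
Qed.

Lemma heat_A2_fin_num : heat_A2 W \is a fin_num.
Proof.
have [c1 c2 _] := A2P 0 ltr01.
rewrite fin_numE; apply/andP; split; last by rewrite lt_eqF// (le_lt_trans Wrho) ?ltry.
rewrite gt_eqF//; have : (heat_A2_at W (0%R, 1%R) <= heat_A2 W)%E.
  by apply: ereal_sup_ubound; exists (0, 1) => //=; exact: ltr01.
apply: lt_le_trans; rewrite /heat_A2_at /= ifT ?ltNyr//.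
by apply/asboolP.
Qed.

Let mxgood_conv (F : 'rV[R]_m -> 'M[C]_d) :
  (forall x t, 0 < t -> heat_converges F x t) -> mxgood F.
Proof.
move=> cF i j.
have Ir x t : 0 < t -> mu.-integrable setT
    (EFin \o (fun y => complex.Re (F y i j) * heat_kernel t (x - y))).
  move=> t0; have [h _] := cF x t t0 i j.
  by apply: eq_integrable h => // y _; rewrite /= -Re_real_mul.
have Ii x t : 0 < t -> mu.-integrable setT
    (EFin \o (fun y => complex.Im (F y i j) * heat_kernel t (x - y))).
  move=> t0; have [_ h] := cF x t t0 i j.
  by apply: eq_integrable h => // y _; rewrite /= -Im_real_mul.
(* Measurability is recovered by dividing the integrand by the positive kernel; this also serves the
   entries of the inverse weight. *)
have mk (p : 'rV[R]_m -> R) : mu.-integrable setT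
    (EFin \o (fun y => p y * heat_kernel 1 (0 - y))) -> measurable_fun setT p.
  move=> /(measurable_int mu)/measurable_EFinP mp.
  have := measurable_funM mp (measurable_fun_inv (measurable_heat_kernelB 1 0)).
  congr measurable_fun; apply/funext => y.
  by rewrite /= mulfK// lt0r_neq0// heat_kernel_gt0.
by split; split; [exact: (mk _ (Ir _ _ ltr01))|exact: Ir|
  exact: (mk _ (Ii _ _ ltr01))|exact: Ii].
Qed.

Lemma heat_A2_flat_weights : flat_weights (rho ^+ 2) W (winv W).
Proof.
have gW : mxgood W by apply: mxgood_conv => x t t0; have [] := A2P x t0.
have gV : mxgood (winv W) by apply: mxgood_conv => x t t0; have [] := A2P x t0.
have ae : {ae mu, forall x, pd (W x) /\ winv W x = invmx (W x)}.
  by have [_ _ pW] := wW; apply: filterS pW => x /posdef_pd.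
split => // x t t0; have [_ _ h] := A2P x t0.
have pA := heat_ext_pd gW ae x t0.
have pB := heat_ext_pd gV (ae_pair_sym ae) x t0.
split => // v; first exact: heat_ext_jensen.
exact: opnorm_sqrt_form.
Qed.

End flat.

Lemma flat_weights_sym {R : realType} {m d : nat} (r : R)
    (W V : 'rV[R]_m -> 'M[R[i]]_d) : 0 < r ->
  flat_weights r W V -> flat_weights r V W.
Proof.
move=> r0 [gW gV ae fl]; split=> [|||x t t0]; [exact: gV|exact: gW| |].
  exact: ae_pair_sym ae.
by apply: flat_pair_sym; [exact: r0|exact: fl].
Qed.

(** * The bilinear estimate *)

Section bilinear.
Context {R : realType} {d : nat}.
Local Notation C := R[i].

Lemma normc_cdot_le (B : 'M[C]_d) (u v : 'cV[C]_d) (a : R) : pd B -> 0 < a ->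
  2 * Normc.normc (cdot u v) <= a * ip (invmx B *m u) u + a^-1 * ip (B *m v) v.
Proof.
move=> pB a0; have pY := pd_psd (pd_inv pB).
have [n0|n0] := eqVneq (Normc.normc (cdot u v)) 0.
  rewrite n0 mulr0 addr_ge0// mulr_ge0 ?invr_ge0 ?(ltW a0)//.
    by have [_] := pY; exact.
  by have [_] := pd_psd pB; exact.
have [x [y [E nE]]] : exists x y, cdot u v = Complex x y /\
    Normc.normc (cdot u v) ^+ 2 = x ^+ 2 + y ^+ 2.
  case: (cdot u v) => x y; exists x, y; split=> //=.
  by rewrite sqr_sqrtr// addr_ge0// sqr_ge0.
set n := Normc.normc _ in n0 nE *.
(* The phase of [cdot u v]: replacing [v] by [c *: v] makes the real part of the pairing equal to
   its modulus and leaves the form of [B] unchanged. *)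
pose c : C := Complex (x / n) (y / n).
have h1 : ip u (c *: v) = n.
  rewrite /ip cdotZr E /= mulNr opprK.
  have -> : x / n * x + y / n * y = (x ^+ 2 + y ^+ 2) / n by ring.
  by rewrite -nE expr2 mulfK.
have h2 : ip (B *m (c *: v)) (c *: v) = ip (B *m v) v.
  rewrite /ip -scalemxAr cdotZr cdotZl mulrA.
  have -> : Num.conj c * c = 1%:C%C.
    rewrite /c; congr Complex; last ring.
    rewrite /= mulNr opprK.
    have -> : x / n * (x / n) + y / n * (y / n) = (x ^+ 2 + y ^+ 2) / n ^+ 2.
      by field.
    by rewrite -nE mulfV// expf_neq0.
  by rewrite mul1r.
have := pd_fenchel u ((a^-1)%:C%C *: (c *: v)) pB.
rewrite -scalemxAr !ipZr ipZl h1 h2.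
move: (ip (invmx B *m u) u) (ip (B *m v) v) => p q h.
have : a * (2 * (a^-1 * n) - a^-1 * (a^-1 * q)) <= a * p by rewrite ler_pM2l.
have -> : a * (2 * (a^-1 * n) - a^-1 * (a^-1 * q)) = 2 * n - a^-1 * q.
  by field; rewrite gt_eqF.
lra.
Qed.

End bilinear.

Lemma le_small {R : realType} (x y k e0 : R) : 0 < e0 -> 0 <= k ->
  (forall e, 0 < e -> e <= e0 -> x <= y + e * k) -> x <= y.
Proof.
move=> e00 k0 h; apply/ler_addgt0Pr => e e1.
pose e' := Num.min e0 (e / (k + 1)).
have k1 : 0 < k + 1 by rewrite ltr_wpDl.
have e'0 : 0 < e' by rewrite lt_min e00 divr_gt0.
apply: le_trans (h e' e'0 _) _; first by rewrite ge_min lexx.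
rewrite lerD2l; apply: (@le_trans _ _ (e / (k + 1) * (k + 1))).
  by apply: ler_pM; rewrite ?(ltW e'0)// ?ge_min ?lexx ?orbT// lerDl.
by rewrite divfK// gt_eqF.
Qed.

Section form.
Context {R : realType} {m d : nat}.
Local Notation C := R[i].
Local Notation mu := (@lebesgue_rV R m).
Local Notation leb := (@lebesgue_measure R).

Variables (rho H e N1 N2 : R) (W V : 'rV[R]_m -> 'M[C]_d).
Variables f g : 'rV[R]_m -> 'cV[C]_d.
Hypotheses (rho1 : 1 <= rho) (r43 : rho ^+ 2 <= 4 / 3).
Hypotheses (HE : H = d%:R * (rho ^+ 2 - 1)) (H0 : 0 < H) (H1 : H <= 1 / 2048).
Hypotheses (e0 : 0 < e) (eH : e ^+ 2 = 2048 * H).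
Hypothesis WV : flat_weights (rho ^+ 2) W V.
Hypotheses (Cf : Ccinfty f) (Cg : Ccinfty g).
Hypothesis fN : has_int mu (fun y => ip (W y *m f y) (f y)) N1.
Hypothesis gN : has_int mu (fun y => ip (V y *m g y) (g y)) N2.
Hypotheses (N10 : 0 <= N1) (N20 : 0 <= N2).

Let rho0 : 0 < rho. Proof. exact: lt_le_trans rho1. Qed.
Let r1 : 1 <= rho ^+ 2. Proof. by rewrite expr_ge1// ltW. Qed.
Let r0 : 0 < rho ^+ 2. Proof. exact: exprn_gt0. Qed.
Let VW : flat_weights (rho ^+ 2) V W. Proof. exact: flat_weights_sym. Qed.
Let gf := Ccinfty_mxgood Cf.
Let gg := Ccinfty_mxgood Cg.

Let D : set ('rV[R]_m * measurableTypeR R) := [set p | (0 < p.2)%R].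

Let mD : measurable D.
Proof.
have -> : D = setT `*` `]0, +oo[%classic.
  by apply/seteqP; split=> p; rewrite /D /= in_itv /= andbT => // -[].
by apply: measurableX.
Qed.

Let bilinear_le a p : 0 < a -> 0 < p.2 -> 2 * bilinear_integrand f g p <=
  a * energy V f p.1 p.2 + a^-1 * (rho ^+ 2 * energy W g p.1 p.2).
Proof.
move=> a0 p0; have [_ _ _ fl] := WV; have [pA pB _ BA] := fl p.1 p.2 p0.
rewrite /bilinear_integrand /energy !mulr_sumr -big_split /=.
apply: ler_sum => i _; rewrite !partial_heat_ext//.
apply: le_trans (normc_cdot_le _ _ pB a0) _.
by rewrite lerD2l ler_pM2l ?invr_gt0.
Qed.

Let measurable_bilinear : measurable_fun D (bilinear_integrand f g).
Proof.
have mx1 i : measurable_fun setT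
    (fun p : 'rV[R]_m * measurableTypeR R => p.1 ord0 i).
  exact: (measurableT_comp (measurable_rV_coord i) measurable_fst).
have mt : measurable_fun setT (fun p : 'rV[R]_m * measurableTypeR R => p.2 : R).
  exact: measurable_snd.
have mgrad (h : 'rV[R]_m -> 'cV[C]_d) i : mxgood h ->
    mxmeas (fun p : 'rV[R]_m * measurableTypeR R => grad h i p.1 p.2).
  move=> gh; rewrite /grad; apply: mxmeas_scale; last exact: (mxmeas_mxheat1 mx1 mt gh).
  by split => //=; apply: measurable_fun_inv; exact: measurable_funM.
apply: (@eq_measurable_fun _ _ _ _ D (fun p : 'rV[R]_m * measurableTypeR R =>
    \sum_(i < m) Normc.normc (cdot (grad f i p.1 p.2) (grad g i p.1 p.2)))).
  move=> p /set_mem p0; rewrite /bilinear_integrand.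
  by apply: eq_bigr => i _; rewrite !partial_heat_ext.
apply: measurable_funTS; apply: measurable_sum => i.
have [m1 m2] : cmeas (fun p : 'rV[R]_m * measurableTypeR R =>
    cdot (grad f i p.1 p.2) (grad g i p.1 p.2)).
  by apply: cmeas_sum => k; apply: cmeasM; [exact: mgrad|apply: cmeasJ; exact: mgrad].
rewrite (_ : (fun _ => _) = fun p : 'rV[R]_m * measurableTypeR R => Num.sqrt
    (complex.Re (cdot (grad f i p.1 p.2) (grad g i p.1 p.2)) ^+ 2 +
     complex.Im (cdot (grad f i p.1 p.2) (grad g i p.1 p.2)) ^+ 2)).
  apply: (measurableT_comp (continuous_measurable_fun (@sqrt_continuous R))).
  by apply: measurable_funD; exact: measurable_funX.
by apply/funext => p; case: (cdot _ _).
Qed.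

Let energy_measurable (W' V' : 'rV[R]_m -> 'M[C]_d) h :
  flat_weights (rho ^+ 2) W' V' -> mxgood h ->
  measurable_fun D (fun p => energy V' h p.1 p.2).
Proof.
move=> fl gh; apply: (@eq_measurable_fun _ _ _ _ D _ _ _
  (measurable_funTS (measurable_energy fl gh))).
by move=> p /set_mem /= p0; rewrite p0.
Qed.

Let energy_ge0 (W' V' : 'rV[R]_m -> 'M[C]_d) (h : 'rV[R]_m -> 'cV[C]_d) p :
  flat_weights (rho ^+ 2) W' V' -> D p -> 0 <= energy V' h p.1 p.2.
Proof.
move=> [_ _ _ fl] p0; have [_ pB _ _] := fl p.1 p.2 p0.
by apply: sumr_ge0 => i _; have [_] := pd_psd (pd_inv pB); exact.
Qed.

Let bilinear_ge0 p : 0 <= bilinear_integrand f g p.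
Proof.
apply: sumr_ge0 => i _; case: (cdot _ _) => x y /=; exact: sqrtr_ge0.
Qed.

Let form_le_param a : 0 < a -> (2%:E * heat_form f g <=
  (a * ((1 + 2 * e) / 2 * N1) + a^-1 * (rho ^+ 2 * ((1 + 2 * e) / 2 * N2)))%:E)%E.
Proof.
move=> a0; rewrite /heat_form -/D.
have b0 : 0 <= a^-1 * rho ^+ 2 by rewrite mulr_ge0 ?invr_ge0// ltW.
have E1 := energy_bound r1 r43 HE H0 H1 e0 eH WV gf fN.
have E2 := energy_bound r1 r43 HE H0 H1 e0 eH VW gg gN.
have m1 := energy_measurable WV gf; have m2 := energy_measurable VW gg.
rewrite -ge0_integralZl//; last 2 first.
- exact/measurable_EFinP.
- by move=> p _; rewrite lee_fin.
have cm (k : R) (h : 'rV[R]_m * measurableTypeR R -> R) : measurable_fun D h ->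
    measurable_fun D (fun p => (k%:E * (h p)%:E)%E).
  move=> mh; apply: (@eq_measurable_fun _ _ _ _ D (EFin \o (k \o* h))).
    by move=> p _; rewrite /= EFinM muleC.
  apply/measurable_EFinP; exact: measurable_funM.
apply: (@le_trans _ _ (\int[mu \x leb]_(p in D) (a%:E * (energy V f p.1 p.2)%:E +
    (a^-1 * rho ^+ 2)%:E * (energy W g p.1 p.2)%:E))%E).
  apply: (ge0_le_integral _ mD).
  - by move=> p _; rewrite -EFinM lee_fin mulr_ge0.
  - exact: cm.
  - by apply: emeasurable_funD; [exact: cm m1|exact: cm m2].
  by move=> p p0; rewrite -!EFinM -EFinD lee_fin -mulrA; exact: bilinear_le.
have n1 p : D p -> (0 <= a%:E * (energy V f p.1 p.2)%:E)%E.
  by move=> p0; rewrite -EFinM lee_fin mulr_ge0 ?(ltW a0)//; exact: energy_ge0 WV p0.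
have n2 p : D p -> (0 <= (a^-1 * rho ^+ 2)%:E * (energy W g p.1 p.2)%:E)%E.
  by move=> p0; rewrite -EFinM lee_fin mulr_ge0//; exact: energy_ge0 VW p0.
rewrite (ge0_integralD _ mD n1 (cm _ _ m1) n2 (cm _ _ m2)).
have Z (k : R) (h : 'rV[R]_m * measurableTypeR R -> R) : 0 <= k ->
    measurable_fun D h -> (forall p, D p -> 0 <= h p) ->
    (\int[mu \x leb]_(p in D) (k%:E * (h p)%:E) =
     k%:E * \int[mu \x leb]_(p in D) (h p)%:E)%E.
  by move=> k0 mh h0; apply: ge0_integralZl => //; exact/measurable_EFinP.
rewrite (Z _ _ (ltW a0) m1 (fun p p0 => energy_ge0 f WV p0)).
rewrite (Z _ _ b0 m2 (fun p p0 => energy_ge0 g VW p0)).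
have -> : ((a * ((1 + 2 * e) / 2 * N1) + a^-1 * (rho ^+ 2 * ((1 + 2 * e) / 2 * N2)))%:E =
    a%:E * ((1 + 2 * e) / 2 * N1)%:E +
    (a^-1 * rho ^+ 2)%:E * ((1 + 2 * e) / 2 * N2)%:E)%E.
  by rewrite -!EFinM -EFinD; congr EFin; ring.
apply: leeD.
  by apply: lee_wpmul2l => //; rewrite lee_fin ltW.
by apply: lee_wpmul2l => //; rewrite lee_fin.
Qed.

Lemma heat_form_le : (2%:E * heat_form f g <=
  ((1 + 2 * e) * rho * (Num.sqrt N1 * Num.sqrt N2))%:E)%E.
Proof.
have X0 : (0 <= 2%:E * heat_form f g)%E.
  by rewrite mule_ge0//; apply: integral_ge0 => p _; rewrite lee_fin.
set X := (2%:E * _)%E in X0 *.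
have hX a : 0 < a -> (X <= (a * ((1 + 2 * e) / 2 * N1) +
    a^-1 * (rho ^+ 2 * ((1 + 2 * e) / 2 * N2)))%:E)%E by exact: form_le_param.
have XE : X = (fine X)%:E.
  rewrite fineK// ge0_fin_numE//; exact: le_lt_trans (hX 1 ltr01) (ltry _).
rewrite XE lee_fin; move: (fine X) XE => x XE {X0}.
set a := Num.sqrt N1; set b := Num.sqrt N2.
have [a0 b0] : 0 <= a /\ 0 <= b by split; exact: sqrtr_ge0.
have [aE bE] : a ^+ 2 = N1 /\ b ^+ 2 = N2 by split; exact: sqr_sqrtr.
have c0 : 0 < 1 + 2 * e by rewrite addr_gt0// mulr_gt0.
have rho0' := rho0; have cr0 := ltW (mulr_gt0 c0 rho0').
apply: (@le_small _ _ _ ((1 + 2 * e) * rho * ((a + b) / 2)) 1) => //.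
  by rewrite mulr_ge0// divr_ge0// addr_ge0.
move=> eps eps0 _.
have [ae be] : 0 < a + eps /\ 0 < b + eps by rewrite !ltr_wpDl.
(* The optimal parameter is [rho * b / a]; adding [eps] to both norms keeps it defined and positive
   when one of them vanishes. *)
have al0 : 0 < rho * (b + eps) / (a + eps) by rewrite divr_gt0// mulr_gt0.
have := hX _ al0; rewrite XE lee_fin -aE -bE => /le_trans; apply.
rewrite -subr_ge0.
have -> : (1 + 2 * e) * rho * (a * b) + eps * ((1 + 2 * e) * rho * ((a + b) / 2)) -
   (rho * (b + eps) / (a + eps) * ((1 + 2 * e) / 2 * a ^+ 2) +
    (rho * (b + eps) / (a + eps))^-1 * (rho ^+ 2 * ((1 + 2 * e) / 2 * b ^+ 2))) =
   (1 + 2 * e) * rho / 2 * (a * (eps / (a + eps)) * (b + eps) +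
     b * (eps / (b + eps)) * (a + eps)).
  by field; rewrite !gt_eqF.
have [ae' be'] := (ltW ae, ltW be); have eps0' := ltW eps0.
apply: mulr_ge0; first exact: divr_ge0.
by apply: addr_ge0; apply: mulr_ge0 => //; apply: mulr_ge0 => //; exact: divr_ge0.
Qed.

End form.

(** Here [D] is the dimension and [1 + s ^ 2] bounds the characteristic, so
    [e ^ 2 = k D s ^ 2 (2 + s ^ 2)] is at most [3 k D s ^ 2] and [e <= K s]. In the product, [2 K s]
    and [2 K s s ^ 2] make up the factor 4, and [s ^ 2 <= s] the summand 1. *)
Lemma bound_constant {R : realType} (k D s e : R) : 1 <= k -> 1 <= D -> 0 < s ->
  s <= 1 -> 0 <= e -> e ^+ 2 = k * (D * ((1 + s ^+ 2) ^+ 2 - 1)) ->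
  (1 + 2 * e) * (1 + s ^+ 2) <= 1 + (1 + 4 * Num.sqrt (3 * (k * D))) * s.
Proof.
move=> k1 D1 s0 s1 e0 eE; set K := Num.sqrt _.
have kD0 : 0 <= k * D by rewrite mulr_ge0//; lra.
have KE : K ^+ 2 = 3 * (k * D) by rewrite sqr_sqrtr// mulr_ge0.
have K0 : 0 <= K by exact: sqrtr_ge0.
have s2 : s ^+ 2 <= s by rewrite expr2 ler_piMr// ltW.
have s20 : 0 <= s ^+ 2 by exact: sqr_ge0.
have eK : e <= K * s.
  rewrite -ler_sqr ?nnegrE ?mulr_ge0 ?(ltW s0)// exprMn KE eE.
  have -> : k * (D * ((1 + s ^+ 2) ^+ 2 - 1)) = k * D * (s ^+ 2 * (2 + s ^+ 2)).
    by ring.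
  have -> : 3 * (k * D) * s ^+ 2 = k * D * (s ^+ 2 * 3) by ring.
  by rewrite ler_wpM2l// ler_wpM2l//; lra.
have Ks : 0 <= K * s by rewrite mulr_ge0// ltW.
apply: (@le_trans _ _ ((1 + 2 * (K * s)) * (1 + s ^+ 2))).
  by apply: ler_wpM2r; lra.
have : K * s * s ^+ 2 <= K * s * 1 by rewrite ler_wpM2l//; lra.
lra.
Qed.

Lemma wnorm_pair {R : realType} {m d : nat} (r : R)
    (W V : 'rV[R]_m -> 'M[R[i]]_d) (f g : 'rV[R]_m -> 'cV[R[i]]_d) :
  flat_weights r W V -> Ccinfty f -> Ccinfty g -> exists N1 N2,
  [/\ 0 <= N1, has_int (lebesgue_rV m) (fun y => ip (W y *m f y) (f y)) N1 &
      wnorm W f = (Num.sqrt N1)%:E] /\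
  [/\ 0 <= N2, has_int (lebesgue_rV m) (fun y => ip (V y *m g y) (g y)) N2 &
      wnorm V g = (Num.sqrt N2)%:E].
Proof.
move=> [gW gV aeW _] Cf Cg; have aeV := ae_pair_sym aeW.
have pW : {ae lebesgue_rV m, forall y, pd (W y)} by apply: filterS aeW => y [].
have pV : {ae lebesgue_rV m, forall y, pd (V y)} by apply: filterS aeV => y [].
have [N1 h1] := wnorm_has_int Cf gW pW; have [N2 h2] := wnorm_has_int Cg gV pV.
by exists N1, N2.
Qed.

(* [k] stands for 2048: the closed numeral would be unfolded by unification *)
Lemma heat_form_le_perturbed {R : realType} {m d : nat} (k : R)
    (W : 'rV[R]_m -> 'M[R[i]]_d) (f g : 'rV[R]_m -> 'cV[R[i]]_d) (s : R) :
  k = 2048 -> (0 < d)%N -> matrix_weight W -> Ccinfty f -> Ccinfty g -> 0 < s ->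
  s ^+ 2 <= (3 * (k * d%:R))^-1 -> (heat_A2 W <= (1 + s ^+ 2)%:E)%E ->
  (2%:E * heat_form f g <= (1 + (1 + 4 * Num.sqrt (3 * (k * d%:R))) * s)%:E *
    (wnorm W f * wnorm (winv W) g))%E.
Proof.
move=> kE hd wW Cf Cg s0 sd A2; set rho := 1 + s ^+ 2 in A2.
have k1 : 1 <= k by rewrite kE ler1n.
have k0 : 0 < k by exact: lt_le_trans k1.
have s20 : 0 < s ^+ 2 by exact: exprn_gt0.
have rho0 : 0 < rho by rewrite addr_gt0.
have rho1 : 1 <= rho by rewrite lerDl ltW.
have WV := heat_A2_flat_weights wW rho0 A2.
have [N1 [N2 [[N10 fN ->] [N20 gN ->]]]] := wnorm_pair WV Cf Cg.
have d1 : 1 <= d%:R :> R by rewrite ler1n.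
have d0 : 0 < d%:R :> R by exact: lt_le_trans d1.
pose H := d%:R * (rho ^+ 2 - 1) : R.
(* The hypothesis on [s] is tailored to [H = d s ^ 2 (2 + s ^ 2) <= 3 d s ^ 2 <= 1 / k]; it also
   yields [s <= 1] and [rho ^ 2 <= 4 / 3]. *)
have skd : k * d%:R * s ^+ 2 <= 3^-1.
  by rewrite mulrC -ler_pdivlMr ?mulr_gt0// -invfM.
have k9 : 9 * 1 <= k * d%:R by apply: ler_pM => //; rewrite kE ler_nat.
have s3 : 9 * 1 * s ^+ 2 <= 3^-1.
  by apply: le_trans skd; apply: ler_wpM2r => //; exact: ltW.
have s1 : s <= 1.
  rewrite leNgt; apply/negP => s1.
  have : 1 <= s ^+ 2 by rewrite expr_ge1// ltW.
  lra.
have rE : rho ^+ 2 - 1 = s ^+ 2 * (2 + s ^+ 2) by rewrite /rho; ring.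
have H0 : 0 < H by rewrite /H rE !mulr_gt0// addr_gt0.
have H1 : H <= 1 / 2048.
  rewrite -kE ler_pdivlMr// /H rE.
  have : k * d%:R * s ^+ 2 * (2 + s ^+ 2) <= 3^-1 * 3.
    by apply: ler_pM; rewrite ?mulr_ge0 ?(ltW k0) ?(ltW d0)//; lra.
  rewrite mulVf//; move=> h; apply: le_trans h.
  by rewrite le_eqVlt; apply/orP; left; apply/eqP; ring.
have r43 : rho ^+ 2 <= 4 / 3.
  have : s ^+ 2 * (2 + s ^+ 2) <= s ^+ 2 * 3 by rewrite ler_wpM2l//; lra.
  lra.
pose e := Num.sqrt (k * H).
have kH : 0 < k * H by exact: mulr_gt0.
have e0 : 0 < e by rewrite sqrtr_gt0.
have eH : e ^+ 2 = k * H by rewrite sqr_sqrtr// ltW.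
have eH' : e ^+ 2 = 2048 * H by rewrite -kE.
apply: le_trans (heat_form_le rho1 r43 erefl H0 H1 e0 eH' WV Cf Cg fN gN N10 N20) _.
rewrite -!EFinM lee_fin; apply: ler_wpM2r; first by rewrite mulr_ge0 ?sqrtr_ge0.
exact: bound_constant k1 d1 s0 s1 (ltW e0) eH.
Qed.

Theorem theorem2 (R : realType) (d : nat) (hd : (0 < d)%N) :
  exists c : R, 0 < c /\
    forall m : nat, (0 < m)%N ->
    exists delta0 : R, 0 < delta0 /\
      forall W : 'rV[R]_m -> 'M[R[i]]_d,
        matrix_weight W ->
        (heat_A2 W <= (1 + delta0)%:E)%E ->
        forall f g : 'rV[R]_m -> 'cV[R[i]]_d,
          Ccinfty f -> Ccinfty g ->
          (2%:E * heat_form f g <=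
           (1 + c * Num.sqrt (fine (heat_A2 W) - 1))%:E *
           (wnorm W f * wnorm (winv W) g))%E.
Proof.
have [k kE k0] : exists2 k : R, k = 2048 & 0 < k.
  by exists 2048; [exact: erefl|rewrite ltr0n].
pose c : R := 1 + 4 * Num.sqrt (3 * (k * d%:R)).
have c0 : 0 < c by rewrite ltr_pwDl// mulr_ge0// sqrtr_ge0.
exists c; split=> // m _.
have d0 : 0 < d%:R :> R by rewrite ltr0n.
pose D : R := (3 * (k * d%:R))^-1.
have D0 : 0 < D by rewrite invr_gt0 !mulr_gt0.
(* a quarter of [D], so that [(sqrt (A2 - 1) + eps) ^ 2 <= D] for small [eps] *)
exists (D / 4); split; first by rewrite divr_gt0.
move=> W wW A2 f g Cf Cg.
have A0 : 0 < 1 + D / 4 by rewrite addr_gt0// divr_gt0.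
have fA := heat_A2_fin_num A2.
set q := fine (heat_A2 W) - 1; pose a := Num.sqrt q.
have a0 : 0 <= a by exact: sqrtr_ge0.
(* Negative numbers have square root 0, so both signs of [q] are covered. *)
have qa : q <= a ^+ 2.
  have [q0|q0] := leP 0 q; first by rewrite sqr_sqrtr.
  by rewrite (le_trans (ltW q0))// sqr_ge0.
have AE : heat_A2 W = (1 + q)%:E by rewrite /q addrC subrK fineK.
have aD : a ^+ 2 <= D / 4.
  have [q0|q0] := leP 0 q; last by rewrite /a ltr0_sqrtr// expr0n /= divr_ge0// ltW.
  by rewrite sqr_sqrtr//; move: A2; rewrite AE lee_fin lerD2l.
(* [weight_fun] divides by [H], which must be positive even when the characteristic equals 1; hence
   the estimate is made at [a + eps], and [eps] tends to 0 at the end. *)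
have main eps : 0 < eps -> eps <= Num.sqrt (D / 4) -> (2%:E * heat_form f g <=
    (1 + c * (a + eps))%:E * (wnorm W f * wnorm (winv W) g))%E.
  move=> eps0 epsD; have s0 : 0 < a + eps by rewrite ltr_wpDl.
  apply: (heat_form_le_perturbed kE) => //.
    have e2 : eps ^+ 2 <= D / 4.
      by rewrite -(sqr_sqrtr (ltW (divr_gt0 D0 _)))// ler_sqr ?nnegrE ?sqrtr_ge0// ltW.
    have : 2 * (a * eps) <= a ^+ 2 + eps ^+ 2 by have := sqr_ge0 (a - eps); lra.
    by rewrite -/D; lra.
  rewrite AE lee_fin lerD2l; apply: (le_trans qa).
  by rewrite ler_sqr ?nnegrE// ?lerDl ltW.
have hX : (0 <= 2%:E * heat_form f g)%E.
  rewrite mule_ge0//; apply: integral_ge0 => p _; rewrite lee_fin.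
  by apply: sumr_ge0 => i _; case: (cdot _ _) => x y /=; exact: sqrtr_ge0.
have e00 : 0 < Num.sqrt (D / 4) by rewrite sqrtr_gt0 divr_gt0.
have [N1 [N2 [[_ _ w1] [_ _ w2]]]] := wnorm_pair (heat_A2_flat_weights wW A0 A2) Cf Cg.
rewrite w1 w2 -EFinM in main *.
have XE : (2%:E * heat_form f g = (fine (2%:E * heat_form f g))%:E)%E.
  rewrite fineK// ge0_fin_numE//.
  exact: le_lt_trans (main _ e00 (lexx _)) (ltry _).
rewrite XE -EFinM lee_fin.
have n0 : 0 <= Num.sqrt N1 * Num.sqrt N2 by rewrite mulr_ge0 ?sqrtr_ge0.
apply: (le_small (k := c * (Num.sqrt N1 * Num.sqrt N2)) e00).
  by rewrite mulr_ge0// ltW.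
move=> eps eps0 epsD; have := main eps eps0 epsD.
rewrite XE -EFinM lee_fin => /le_trans; apply.
by rewrite le_eqVlt; apply/orP; left; apply/eqP; rewrite /a; ring.
Qed.
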